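(* Let $s,q$ be integers with $2\le s<q$. Assume the following hypotheses: (i) $f\in W^{s+1,\infty}(\mathbb{R})$. (ii) The exact solution $u$ of the initial value problem $\partial_t u+f(u)\,\partial_x u+\nu\,\partial_x^3u=0$ in $\mathbb{T}\times(0,T)$, $u(0)=u_0$ in $\mathbb{T}$, belongs to $W^{1,\infty}(0,T;H^{s+2}(\mathbb{T}))\cap L^\infty(0,T;H^{s+4}(\mathbb{T}))\cap L^\infty(0,T;H^q(\mathbb{T}))$. (iii) The interpolation operators $\mathcal{I}_h$ satisfy properties (P1), (P2), (P3) (stated in the context) for the integers $s$ and $q$. (iv) The parameter set $\Lambda$ satisfies properties (D1), (D2) and (D3) (stated in the context) for some $r\in(0,1]$. Let $C_\Delta$ and $\varepsilon$ be positive constants. Then there exist $(h_0,\Delta t_0)\in(0,1)^2$ and $C_{\mathrm{E}}>0$, depending on $C_\Delta$, $\varepsilon$, $\|u\|_{L^\infty(0,T;W^{s+1,\infty}(\mathbb{T}))}$, $\|u\|_{L^\infty(0,T;H^q(\mathbb{T}))}$, $\|f\|_{s+1,\infty}$ and $K(u)$ (and independent of $h$, $\Delta t$ and $n$), such that, if $\Delta=(h,\Delta t)\in(0,h_0)\times(0,\Delta t_0)$ satisfies $$\frac{h^{2s}}{\Delta t}\le C_\Delta\qquad\text{and}\qquad \frac{h^{2(q-s)}}{\Delta t^{1+\varepsilon}}\le C_\Delta,$$ then the numerical solutions $u_h^n$ are well defined by the scheme given in the context and $$\|u^n-u_h^n\|_{s,2,\ast}\le C_{\mathrm{E}}\left(\Delta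 t^{r}+\frac{h^{q-s}}{\Delta t^{1/2}}\right),\qquad n=0,\ldots,N_t.$$
   Context: **Setting.** $\mathbb{T}=\mathbb{R}/\mathbb{Z}$, $T>0$, $\nu>0$ are fixed, and $f:\mathbb{R}\to\mathbb{R}$ is a given function ($f=F'$ for the flux $F$ of the conservation law $\partial_t u+\partial_xF(u)+\nu\partial_x^3u=0$). It is assumed that the initial value problem has a unique smooth solution $u$. The data $T,\nu,s,q,r,\Lambda$ and the constants appearing in the properties (P1)–(P3), (D1)–(D3) below are regarded as fixed. **Norms.** $\|\cdot\|_{0,p}$ is the $L^p$-norm, $\|\cdot\|_{k,p}$ is the $W^{k,p}$-norm (on $\mathbb{T}$, or on $\mathbb{R}$ for $f$), and $|v|_{k,p}=\|\partial_x^kv\|_{0,p}$. Moreover $$\|v\|_{s,2,\ast}=\big(\|v\|_{0,2}^2+|v|_{s,2}^2\big)^{1/2},\qquad \|v\|_{s,2,\Delta}=\Big(\|v\|_{0,2}^2+\frac{h^{2s}}{\Delta t}|v|_{s,2}^2\Big)^{1/2}.$$ **Mesh.** $N_x,N_t\in\mathbb{N}$, $0=x_0<x_1<\dots<x_{N_x}=1$, $h=\max_j|x_j-x_{j-1}|$, $\Delta t=T/N_t$, $t_n=n\Delta t$, $u^n=u(\cdot,t_n)$. **Interpolation operator.** $\mathcal{I}_h$ is a linear interpolation operator associated with the mesh, mapping $H^s(\mathbb{T})$ into $H^s(\mathbb{T})$: either $\mathcal{I}_hv$ is determined by the nodal values $(v(x_1),\dots,v(x_{N_x}))$ and $(\mathcal{I}_hv)(x_j)=v(x_j)$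 for all $j$ (e.g. spline interpolation), or $\mathcal{I}_hv$ is determined by the values $\partial_x^kv(x_j)$, $0\le k\le s-1$, $1\le j\le N_x$, and reproduces them (Hermite interpolation). In particular $\mathcal{I}_h\mathcal{I}_h=\mathcal{I}_h$. The properties are ($C_s$, $C_q$ independent of $h$, $I$ the identity): - (P1) $\displaystyle\int_{\mathbb{T}}\partial_x^s(v-\mathcal{I}_hv)\,\partial_x^s(\mathcal{I}_hw)\,\mathrm{d}x=0$ for all $v,w\in H^s(\mathbb{T})$. - (P2) There is $C_s>0$ such that $\|(I-\mathcal{I}_h)v\|_{0,2}\le C_sh^s|v|_{s,2}$ for all $v\in H^s(\mathbb{T})$. - (P3) For the integer $q>s$, there is $C_q>0$ such that $|(I-\mathcal{I}_h)v|_{s,2}\le C_qh^{q-s}|v|_{q,2}$ for all $v\in H^q(\mathbb{T})$. **Operators.** For $v\in C(\mathbb{T})$, $X^1_{\Delta t}[v]:\mathbb{T}\to\mathbb{T}$ is $X^1_{\Delta t}[v](x)=x-v(x)\Delta t$. For $v\in H^s(\mathbb{T})$ with $3\Delta t\,|f|_{1,\infty}|v|_{1,\infty}\le1$, $\mathcal{S}^{\mathrm{A}}_{f,\Delta t}(v)$ denotes the unique $w\in H^s(\mathbb{T})$ with $w=v\circ X^1_{\Delta t}[f\circ w]$ (existence and uniqueness are known). $\Lambda$ is a finite set of pairs $(\gamma,\lambda)$ of real numbers, and $$(\mathcal{S}^{\mathrm{D}}_{\Lambda,\Delta t}v)(x)=\sum_{(\gamma,\lambda)\in\Lambda}\gamma\,v\big(x+\lambda(\nu\Delta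 t)^{1/3}\big).$$ The consistency error is $$\tau^n_{\Delta t}=\frac1{\Delta t}\Big(u^n-(\mathcal{S}^{\mathrm{D}}_{\Lambda,\Delta t}u^{n-1})\circ X^1_{\Delta t}[f\circ u^n]\Big),\qquad n=1,\dots,N_t.$$ The properties of $\Lambda$ (with constants independent of $h$, $\Delta t$) are: - (D1) $\|\mathcal{S}^{\mathrm{D}}_{\Lambda,\Delta t}v\|_{0,2}\le\|v\|_{0,2}$ for $v\in L^2(\mathbb{T})$, and $\|\mathcal{S}^{\mathrm{D}}_{\Lambda,\Delta t}v\|_{s,2,\ast}\le\|v\|_{s,2,\ast}$, $\|\mathcal{S}^{\mathrm{D}}_{\Lambda,\Delta t}v\|_{s,2,\Delta}\le\|v\|_{s,2,\Delta}$ for $v\in H^s(\mathbb{T})$. - (D2) There is $C>0$ such that $\|\mathcal{S}^{\mathrm{D}}_{\Lambda,\Delta t}v\|_{s+1,\infty}\le C\|v\|_{s+1,\infty}$ for all $v\in W^{s+1,\infty}(\mathbb{T})$. - (D3) There are constants $r\in(0,1]$, independent of $u$, and $K=K(u)>0$, possibly depending on $u$, such that $\|\tau^n_{\Delta t}\|_{s,2,\ast}\le K(u)\Delta t^r$ for all $n\in\{1,\dots,N_t\}$, where $u$ is the exact solution. **Scheme.** $u_h^0=\mathcal{I}_hu_0$ and $u_h^n=\mathcal{I}_h\big(\mathcal{S}^{\mathrm{A}}_{f,\Delta t}(\mathcal{S}^{\mathrm{D}}_{\Lambda,\Delta t}u_h^{n-1})\big)$ for $n=1,\dots,N_t$; the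 step is well defined when $3\Delta t\,|f|_{1,\infty}|\mathcal{S}^{\mathrm{D}}_{\Lambda,\Delta t}u_h^{n-1}|_{1,\infty}\le1$. *)

(* Defs.v *)
From HB Require Import structures.
From mathcomp Require Import all_boot all_order all_algebra.
From mathcomp Require Import finmap.
From mathcomp Require Import all_classical all_reals all_analysis.

Set Implicit Arguments.
Unset Strict Implicit.
Unset Printing Implicit Defensive.

Import Order.TTheory GRing.Theory Num.Theory.
Import numFieldNormedType.Exports.

Local Open Scope classical_set_scope.
Local Open Scope ring_scope.

(* Functions on the torus T = R/Z are 1-periodic functions R -> R; integrals
   and essential suprema over T are taken over the fundamental domain [0, 1].
   Elements of W^{k,p} with k >= 1 are represented by their (unique) continuous
   representative, so that point values and compositions make sense. *)

Section Sobolev.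
Variable R : realType.
Implicit Types (D : set R) (p : \bar R) (v w g phi : R -> R) (k : nat).

Notation mu := (@lebesgue_measure R).

Definition unit_cell : set R := [set` `[0, 1]%R].

Definition periodic1 v := forall x, v (x + 1) = v x.

Definition test_function D phi :=
  (forall k x, derivable (derive1n k phi) x 1) /\
  exists K : set R, [/\ compact K, K `<=` D & forall x, ~ K x -> phi x = 0].

Definition is_weak_deriv k v g :=
  [/\ locally_integrable setT v, locally_integrable setT g &
      forall phi, test_function setT phi ->
        \int[mu]_(x in setT) (v x * derive1n k phi x) =
        (-1) ^+ k * \int[mu]_(x in setT) (g x * phi x)].

(* Defined up to a null set; the value 0 is used when there is no weak
   derivative of order k. *)
Definition weak_deriv k v : R -> R := xget (cst 0) [set g | is_weak_deriv k v g].

Definition Lpnorm D p v : \bar R := Lnorm mu p (EFin \o (v \_ D)).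

Definition seminorm D k p v : \bar R := Lpnorm D p (weak_deriv k v).

Definition Wnorm D k p v : \bar R :=
  match p with
  | r%:E => ((\sum_(j < k.+1) seminorm D j p v `^ r) `^ r^-1)%E
  | _ => \big[maxe/0%E]_(j < k.+1) seminorm D j p v
  end.

Definition Wspace D k p : set (R -> R) :=
  [set v | ((0 < k)%N -> continuous v) /\
     forall j, (j <= k)%N ->
       exists g, is_weak_deriv j v g /\ (Lpnorm D p g < +oo)%E].

Definition L2T : set (R -> R) :=
  [set v | [/\ periodic1 v, measurable_fun setT v &
               (Lpnorm unit_cell 2%:E v < +oo)%E]].

Definition WT k p : set (R -> R) :=
  [set v | periodic1 v /\ Wspace unit_cell k p v].

Definition HT k : set (R -> R) := WT k 2%:E.

Definition normT k p v := Wnorm unit_cell k p v.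
Definition seminormT k p v := seminorm unit_cell k p v.
Definition norm2T v := Lpnorm unit_cell 2%:E v.

Definition norm_star (s : nat) v : \bar R :=
  ((norm2T v ^+ 2 + seminormT s 2%:E v ^+ 2) `^ 2^-1)%E.

Definition norm_Delta (s : nat) (h dt : R) v : \bar R :=
  ((norm2T v ^+ 2 + (h ^+ (2 * s) / dt)%:E * seminormT s 2%:E v ^+ 2)
     `^ 2^-1)%E.

End Sobolev.

(* Spaces L^oo(0,T;X) and W^{1,oo}(0,T;X), where X is a space of functions
   R -> R with norm N. *)
Section Bochner.
Variables (R : realType) (T : R) (X : set (R -> R)) (N : (R -> R) -> \bar R).
Implicit Types (u g : R -> R -> R) (sf : seq (set R * (R -> R))).

Notation mu := (@lebesgue_measure R).

Definition time_interval : set R := [set` `]0, T[%R].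

(* [sf] encodes the simple function t |-> \sum_((A, v) <- sf) \1_A(t) v. *)
Definition is_simple sf :=
  forall i, (i < size sf)%N ->
    measurable (nth (set0, cst 0) sf i).1 /\ X (nth (set0, cst 0) sf i).2.

Definition simple_eval sf : R -> R -> R :=
  fun t x => \sum_(Av <- sf) \1_(Av.1) t * Av.2 x.

Definition simple_integral sf : R -> R :=
  fun x => \sum_(Av <- sf) fine (mu (Av.1 `&` time_interval)) * Av.2 x.

Definition strongly_measurable u :=
  exists sf : nat -> seq (set R * (R -> R)),
    (forall n, is_simple (sf n)) /\
    {ae mu, forall t, time_interval t ->
       X (u t) /\ (fun n => N (u t \- simple_eval (sf n) t)) @ \oo --> 0%E}.

Definition Linfty_norm u : \bar R :=
  Lnorm mu +oo%E ((fun t => N (u t)) \_ time_interval).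

Definition Linfty_space : set (R -> R -> R) :=
  [set u | strongly_measurable u /\ (Linfty_norm u < +oo)%E].

Definition is_bochner_integral u (I : R -> R) :=
  [/\ strongly_measurable u, X I &
    exists sf : nat -> seq (set R * (R -> R)),
      [/\ forall n, is_simple (sf n),
          (fun n => (\int[mu]_(t in time_interval)
                       N (u t \- simple_eval (sf n) t)%R)%E) @ \oo --> 0%E &
          (fun n => N (I \- simple_integral (sf n))) @ \oo --> 0%E]].

Definition is_weak_time_deriv u g :=
  forall phi : R -> R, test_function time_interval phi ->
    exists I : R -> R,
      is_bochner_integral (fun t x => derive1 phi t * u t x) I /\
      is_bochner_integral (fun t x => phi t * g t x) (\- I).

Definition W1infty_space : set (R -> R -> R) :=
  [set u | Linfty_space u /\
     exists g, Linfty_space g /\ is_weak_time_deriv u g].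

End Bochner.

Section Problem.
Variables (R : realType) (T nu : R) (f u0 : R -> R).
Implicit Types u : R -> R -> R.

Definition smooth_solution u :=
  let Q := time_interval T `*` [set: R] in
  [/\ forall t, 0 <= t <= T -> periodic1 (u t),
      {within [set` `[0, T]%R] `*` [set: R],
        continuous (fun z : R * R => u z.1 z.2)},
      (forall t x, Q (t, x) -> derivable (fun tau => u tau x) t 1) /\
      {within Q, continuous
        (fun z : R * R => derive1 (fun tau => u tau z.2) z.1)},
      (forall k t x, (k < 3)%N -> Q (t, x) ->
        derivable (derive1n k (u t)) x 1) /\
      (forall k, (k <= 3)%N ->
        {within Q, continuous (fun z : R * R => derive1n k (u z.1) z.2)}) &
      u 0 = u0 /\
      forall t x, Q (t, x) ->
        derive1 (fun tau => u tau x) t + f (u t x) * derive1 (u t) x +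
        nu * derive1n 3 (u t) x = 0].

(* u is the unique smooth solution of the initial value problem. *)
Definition exact_solution u :=
  smooth_solution u /\
  forall v, smooth_solution v -> forall t, 0 <= t <= T -> v t = u t.

End Problem.

Section Mesh.
Variable R : realType.
Implicit Types (x : nat -> R) (Ih : (R -> R) -> (R -> R)) (v w : R -> R).

Definition mesh (Nx : nat) x :=
  [/\ x 0%N = 0, x Nx = 1 & forall j, (j < Nx)%N -> x j < x j.+1].

Definition mesh_size (Nx : nat) x : R :=
  \big[Num.max/0]_(0 <= j < Nx) `|x j.+1 - x j|.

Definition linear_HT (s : nat) Ih :=
  (forall v, HT s v -> HT s (Ih v)) /\
  (forall a v w, HT s v -> HT s w ->
     Ih (fun y => a * v y + w y) = (fun y => a * Ih v y + Ih w y)).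

(* Interpolation of the derivatives of order < m at the nodes x_1, ..., x_Nx:
   m = 1 for nodal values, m = s for Hermite interpolation. *)
Definition interpolates (s m Nx : nat) x Ih :=
  (forall v w, HT s v -> HT s w ->
     (forall j k, (1 <= j <= Nx)%N -> (k < m)%N ->
        derive1n k v (x j) = derive1n k w (x j)) -> Ih v = Ih w) /\
  (forall v, HT s v -> forall j k, (1 <= j <= Nx)%N -> (k < m)%N ->
     derive1n k (Ih v) (x j) = derive1n k v (x j)).

Definition interpolation_operator (s Nx : nat) x Ih :=
  linear_HT s Ih /\ (interpolates s 1 Nx x Ih \/ interpolates s s Nx x Ih).

Definition propP1 (s : nat) Ih :=
  forall v w, HT s v -> HT s w ->
    \int[@lebesgue_measure R]_(y in @unit_cell R)
      (weak_deriv s (v \- Ih v) y * weak_deriv s (Ih w) y) = 0.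

Definition propP2 (s : nat) (Cs h : R) Ih :=
  forall v, HT s v ->
    (norm2T (v \- Ih v)%R <= (Cs * h ^+ s)%:E * seminormT s 2%:E v)%E.

Definition propP3 (s q : nat) (Cq h : R) Ih :=
  forall v, HT q v ->
    (seminormT s 2%:E (v \- Ih v)%R <=
       (Cq * h ^+ (q - s))%:E * seminormT q 2%:E v)%E.

End Mesh.

Section Operators.
Variable R : realType.
Variables (T nu : R) (Lambda : {fset R * R}) (f : R -> R).
Implicit Types (v w : R -> R) (u : R -> R -> R).

Definition time_step (Nt : nat) : R := T / Nt%:R.

Definition X1 (dt : R) v : R -> R := fun x => x - v x * dt.

Definition SD (dt : R) v : R -> R :=
  fun x => \sum_(gl <- Lambda) gl.1 * v (x + gl.2 * (nu * dt) `^ 3^-1).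

Definition step_condition (dt : R) v :=
  ((3 * dt)%:E * seminorm setT 1 +oo f * seminormT 1 +oo v <= 1)%E.

Definition SA_solution (s : nat) (dt : R) v w :=
  HT s w /\ w = v \o X1 dt (f \o w).

Definition SA (s : nat) (dt : R) v : R -> R :=
  xget (cst 0) [set w | SA_solution s dt v w].

Definition consistency_error u (Nt n : nat) : R -> R :=
  let dt := time_step Nt in
  let t k := k%:R * dt in
  fun x => dt^-1 *
    (u (t n) x - (SD dt (u (t n.-1)) \o X1 dt (f \o u (t n))) x).

Fixpoint scheme (s : nat) (dt : R) (Ih : (R -> R) -> (R -> R)) (u0 : R -> R)
    (n : nat) : R -> R :=
  match n with
  | 0 => Ih u0
  | n'.+1 => Ih (SA s dt (SD dt (scheme s dt Ih u0 n')))
  end.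

(* h ranges over the possible mesh sizes, Nt over the possible numbers of time
   steps. *)
Definition propD1 (s : nat) :=
  forall (Nt : nat), (0 < Nt)%N ->
  let dt := time_step Nt in
  [/\ forall v, L2T v -> (norm2T (SD dt v) <= norm2T v)%E,
      forall v, HT s v -> (norm_star s (SD dt v) <= norm_star s v)%E &
      forall h v, 0 < h <= 1 -> HT s v ->
        (norm_Delta s h dt (SD dt v) <= norm_Delta s h dt v)%E].

Definition propD2 (s : nat) (C : R) :=
  forall (Nt : nat), (0 < Nt)%N -> forall v, WT s.+1 +oo v ->
    (normT s.+1 +oo (SD (time_step Nt) v) <= C%:E * normT s.+1 +oo v)%E.

Definition propD3 (s : nat) (r K : R) u :=
  forall (Nt n : nat), (1 <= n <= Nt)%N ->
    (norm_star s (consistency_error u Nt n) <= (K * time_step Nt `^ r)%:E)%E.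

(* The first Nt steps can be performed: the step condition holds, so does the
   existence and uniqueness of the function denoted by [SA], and the iterates
   stay in H^s(T). *)
Definition scheme_well_defined (s Nt : nat) (Ih : (R -> R) -> (R -> R))
    (u0 : R -> R) :=
  let dt := time_step Nt in
  let uh := scheme s dt Ih u0 in
  (forall n, (n <= Nt)%N -> HT s (uh n)) /\
  (forall n, (1 <= n <= Nt)%N ->
     step_condition dt (SD dt (uh n.-1)) /\
     exists! w, SA_solution s dt (SD dt (uh n.-1)) w).

End Operators.

(* Main.v *)
Require Import Defs.
From HB Require Import structures.
From mathcomp Require Import all_boot all_order all_algebra.
From mathcomp Require Import finmap.
From mathcomp Require Import all_classical all_reals all_analysis.
From mathcomp Require Import measurable_realfun ess_sup_inf.
From mathcomp Require Import ring lra zify.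

(** The proof is an energy estimate for the error e^n = u^n - u_h^n in
    E(v) = |v|_{0,2}^2 + th |v|_{s,2}^2, where the weight th = 1 + 4 CDelta Cs^2
    is fixed once and for all.  A time step is an evolution followed by an
    interpolation, and both are almost contractions for E.

    Evolution.  The function b = u^n satisfies b = v o X_b + dt tau, with
    v = S^D u^(n-1), X_b(x) = x - f(b(x)) dt and tau the consistency error; the
    function a = S^A w with w = S^D u_h^(n-1) satisfies a = w o X_a.  Hence
      b - a = (v - w) o X_a + (v o X_b - v o X_a) + dt tau.
    Composition with the flow X_a multiplies E by at most 1 + O(dt)
    ([wenergy_comp_flow]); the second term is O(dt) times b - a because v is of
    class C^(s,1) ([HB_comp_diff]); the third is controlled by [propD3];
    and E(v - w) <= E(e^(n-1)) by [propD1], because th is one of the values that the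
    quotient h^(2s)/dt may take there ([SD_wenergy]).  This gives
    E(b - a) <= (1 + C dt) (E(e^(n-1)) + C dt^(1+2r)), as long as
    E(e^(n-1)) <= 1, which keeps w bounded in H^s ([step_estimate]).

    Interpolation.  In e^n = (b - Ih b) + Ih (b - a) the two terms are
    orthogonal for the H^s scalar product by [propP1].  The L^2 error of I - Ih on
    b - a is at most Cs h^s times the part of |b - a|_s that Ih removes, and
    since h^(2s) <= CDelta dt, the choice of th lets the drop of the seminorm pay
    for this error; what is left is 2 th |b - Ih b|_s^2 = O(h^(2(q-s))) ([interpolation_step]).

    Discrete Gronwall gives E(e^n) <= C (dt^(2r) + h^(2(q-s))/dt).  The second
    condition on the mesh makes the right-hand side at most 1 for small dt, so
    that the induction closes.

    Two points need preparation.  First, membership in H^s of compositions and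
    of solutions of implicit equations is awkward to check with weak
    derivatives.  Instead, an H^1 function on the circle is described by an
    inequality between increments, (f b - f a)^2 <= (b - a) (A b - A a) with A
    the distribution function of a measure ([H1]); sums, products and
    compositions are then elementary, and the classes [HB] built on it carry
    all the estimates of the evolution.  The lemmas [HT_elim] and [HT_intro]
    identify this description with H^s: one direction is the regularity of
    functions with weak derivatives ([weak_regular]), the other produces an L^2
    density by minimising the L^2 norm among approximate derivatives ([riesz]).

    Second, the bounds on u hold for almost every t only, whereas the scheme
    samples u at the points n dt; they extend to every t because C^(s,1) balls
    are closed under uniform convergence ([CL_limit],
    [exact_solution_regular]). *)

Set Implicit Arguments.
Unset Strict Implicit.
Unset Printing Implicit Defensive.

Import Order.TTheory GRing.Theory Num.Theory.
Import numFieldNormedType.Exports.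

Local Open Scope classical_set_scope.
Local Open Scope ring_scope.

Local Notation "f ^` ()" := (derive1 f) : ring_scope.

(** * Functions with square integrable derivative, through increments *)

Section H1.
Variable R : realType.
Implicit Types (f g h A : R -> R) (D : R -> R -> R) (M N P : R).

(** The increments [D a b] are controlled by a measure of mass [M ^+ 2] on the
    circle, given by its distribution function [A].  Keeping [D] general allows
    domination arguments with several functions at once. *)
Definition energy M D := exists A, (forall x, A (x + 1) = A x + M ^+ 2) /\
  forall a b, a <= b -> D a b ^+ 2 <= (b - a) * (A b - A a).

(** This is the H^1 seminorm bound over one period: for an absolutely continuous
    [f], take for [A] a primitive of the square of [f^`()]. *)
Definition H1 M f := energy M (fun a b => f b - f a).

Definition lip M f := forall x y, `|f x - f y| <= M * `|x - y|.

Lemma energy_nondecreasing D A :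
  (forall a b, a <= b -> D a b ^+ 2 <= (b - a) * (A b - A a)) ->
  forall a b, a <= b -> A a <= A b.
Proof.
move=> fA a b; rewrite le_eqVlt => /predU1P[->//|ab].
have := le_trans (sqr_ge0 _) (fA a b (ltW ab)).
by rewrite pmulr_rge0 ?subr_gt0// subr_ge0.
Qed.

Lemma energy_shiftn A c : (forall x, A (x + 1) = A x + c) ->
  forall n x, A (x + n%:R) = A x + n%:R * c.
Proof.
move=> A1; elim=> [|n IH] x; first by rewrite addr0 mul0r addr0.
by rewrite -(@natr1 _ n) addrA A1 IH; ring.
Qed.

(** The distribution function of a measure of mass zero is nondecreasing and
    periodic, hence constant. *)
Lemma energy0 D a b : energy 0 D -> a <= b -> D a b = 0.
Proof.
move=> [A [A1 fA]] ab.
have Ant := energy_nondecreasing fA.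
have [n bn] : exists n : nat, b <= a + n%:R.
  exists (Num.truncn `|b - a|).+1.
  have := truncnS_gt `|b - a|; have := ler_norm (b - a); lra.
have Aab : A b - A a <= 0.
  have := Ant _ _ bn; rewrite (energy_shiftn A1) expr0n/= mulr0 addr0; lra.
have le0 : D a b ^+ 2 <= 0.
  by apply: le_trans (fA _ _ ab) _; rewrite mulr_ge0_le0// subr_ge0.
by apply/eqP; rewrite -sqrf_eq0 eq_le le0 sqr_ge0.
Qed.

Lemma energy_mono M N D : 0 <= M <= N -> energy M D -> energy N D.
Proof.
move=> /andP[M0 MN] [A [A1 fA]].
exists (fun x => A x + (N ^+ 2 - M ^+ 2) * x); split=> [x|a b ab].
  by rewrite A1; ring.
have ? : 0 <= N ^+ 2 - M ^+ 2 by rewrite subr_ge0 ler_sqr ?nnegrE//; lra.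
have : 0 <= (b - a) * ((N ^+ 2 - M ^+ 2) * (b - a)).
  by apply: mulr_ge0; [|apply: mulr_ge0 => //]; rewrite subr_ge0.
have -> : (b - a) * (A b + (N ^+ 2 - M ^+ 2) * b - (A a + (N ^+ 2 - M ^+ 2) * a))
   = (b - a) * (A b - A a) + (b - a) * ((N ^+ 2 - M ^+ 2) * (b - a)) by ring.
by move=> ?; apply: ler_wpDr => //; exact: fA.
Qed.

Lemma energy_dom1 c M D D1 : 0 <= c ->
  (forall a b, a <= b -> `|D a b| <= c * `|D1 a b|) ->
  energy M D1 -> energy (c * M) D.
Proof.
move=> c0 uv [A [A1 vA]]; exists (fun x => c ^+ 2 * A x); split=> [x|a b ab].
  by rewrite A1; ring.
rewrite -real_normK ?num_real//.
apply: (@le_trans _ _ (c ^+ 2 * (D1 a b) ^+ 2)).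
  rewrite -(real_normK (num_real (D1 a b))) -exprMn.
  by rewrite ler_sqr ?nnegrE ?mulr_ge0// uv.
have -> : (b - a) * (c ^+ 2 * A b - c ^+ 2 * A a) =
  c ^+ 2 * ((b - a) * (A b - A a)) by ring.
by rewrite ler_wpM2l ?sqr_ge0//; exact: vA.
Qed.

(** The seminorms add as in the triangle inequality: in Young's inequality for
    the square of the right-hand side, the ratio of the two seminorms is the
    parameter that turns the sum of the masses into a perfect square. *)
Lemma energy_dom c1 c2 M N D D1 D2 : 0 <= c1 -> 0 <= c2 -> 0 <= M -> 0 <= N ->
  (forall a b, a <= b -> `|D a b| <= c1 * `|D1 a b| + c2 * `|D2 a b|) ->
  energy M D1 -> energy N D2 -> energy (c1 * M + c2 * N) D.
Proof.
move=> c10 c20 M0 N0 fgh Hg Hh.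
have [P0|P0] := eqVneq (c1 * M) 0.
  rewrite P0 add0r; apply: (energy_dom1 _ _ Hh) => // a b ab.
  have := fgh a b ab.
  move/eqP: P0; rewrite mulf_eq0 => /orP[] /eqP P0; rewrite P0 in Hg fgh *.
    by rewrite mul0r add0r.
  by rewrite (energy0 Hg ab) normr0 mulr0 add0r.
have [Q0|Q0] := eqVneq (c2 * N) 0.
  rewrite Q0 addr0; apply: (energy_dom1 _ _ Hg) => // a b ab.
  have := fgh a b ab.
  move/eqP: Q0; rewrite mulf_eq0 => /orP[] /eqP Q0; rewrite Q0 in Hh fgh *.
    by rewrite mul0r addr0.
  by rewrite (energy0 Hh ab) normr0 mulr0 addr0.
have {P0}P0 : 0 < c1 * M by rewrite lt_neqAle eq_sym P0 mulr_ge0.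
have {Q0}Q0 : 0 < c2 * N by rewrite lt_neqAle eq_sym Q0 mulr_ge0.
case: Hg => A [A1 gA]; case: Hh => B [B1 hB].
(* the value of [t] for which Young's inequality is an equality for c1 M and c2 N *)
pose t := (c2 * N) / (c1 * M).
have t0 : 0 < t by rewrite divr_gt0.
exists (fun x => (1 + t) * (c1 ^+ 2 * A x) + (1 + t^-1) * (c2 ^+ 2 * B x)).
split=> [x|a b ab].
  rewrite A1 B1 /t.
  have ? : c1 != 0 by apply: contraTneq P0 => ->; rewrite mul0r ltxx.
  have ? : M != 0 by apply: contraTneq P0 => ->; rewrite mulr0 ltxx.
  have ? : c2 != 0 by apply: contraTneq Q0 => ->; rewrite mul0r ltxx.
  have ? : N != 0 by apply: contraTneq Q0 => ->; rewrite mulr0 ltxx.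
  by field; do ?[apply/andP; split].
have Ag := gA _ _ ab; have Bh := hB _ _ ab.
set x := c1 * `|D1 a b|; set y := c2 * `|D2 a b|.
have x2 : x ^+ 2 <= c1 ^+ 2 * ((b - a) * (A b - A a)).
  by rewrite exprMn real_normK ?num_real// ler_wpM2l ?sqr_ge0.
have y2 : y ^+ 2 <= c2 ^+ 2 * ((b - a) * (B b - B a)).
  by rewrite exprMn real_normK ?num_real// ler_wpM2l ?sqr_ge0.
have step1 : D a b ^+ 2 <= (x + y) ^+ 2.
  rewrite -(real_normK (num_real (D a b))) ler_sqr ?nnegrE//.
    exact: fgh.
  by rewrite addr_ge0// mulr_ge0.
have step2 : (x + y) ^+ 2 <= (1 + t) * x ^+ 2 + (1 + t^-1) * y ^+ 2.
  rewrite -subr_ge0.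
  have -> : (1 + t) * x ^+ 2 + (1 + t^-1) * y ^+ 2 - (x + y) ^+ 2 =
     t * (x - t^-1 * y) ^+ 2 by field; exact: lt0r_neq0.
  by rewrite mulr_ge0 ?sqr_ge0// ltW.
apply: le_trans step1 (le_trans step2 _).
have -> : (b - a) * ((1 + t) * (c1 ^+ 2 * A b) + (1 + t^-1) * (c2 ^+ 2 * B b) -
   ((1 + t) * (c1 ^+ 2 * A a) + (1 + t^-1) * (c2 ^+ 2 * B a))) =
  (1 + t) * (c1 ^+ 2 * ((b - a) * (A b - A a))) +
  (1 + t^-1) * (c2 ^+ 2 * ((b - a) * (B b - B a))) by ring.
apply: lerD; rewrite ler_wpM2l// addr_ge0// ?invr_ge0; exact: ltW.
Qed.

Lemma lip_H1 M f : lip M f -> H1 M f.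
Proof.
move=> fM; exists (fun x => M ^+ 2 * x); split=> [x|a b ab]; first by ring.
have := fM b a; rewrite (ger0_norm (_ : 0 <= b - a)) ?subr_ge0// => h.
rewrite -real_normK ?num_real//.
have -> : (b - a) * (M ^+ 2 * b - M ^+ 2 * a) = (M * (b - a)) ^+ 2 by ring.
rewrite ler_sqr ?nnegrE//; exact: le_trans h.
Qed.

End H1.

(** * Derivatives of functions on the line *)

Section calculus.
Variable R : realType.
Implicit Types (f g h : R -> R) (M N x l : R).

Lemma derivable_is_derive f (x : R) : derivable f x 1 -> is_derive x 1 f (f^`() x).
Proof. by move=> df; rewrite derive1E; exact/derivableP. Qed.

Lemma is_derive_derivable f (x l : R) :
  is_derive x 1 f l -> derivable f x 1 /\ f^`() x = l.
Proof. by move=> [df <-]; rewrite derive1E. Qed.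

Lemma derivable_cont f : (forall x, derivable f x 1) -> continuous f.
Proof.
by move=> df x; apply: differentiable_continuous; exact/derivable1_diffP.
Qed.

Lemma is_derive_fun f f' : (forall x, is_derive x 1 f (f' x)) ->
  (forall x, derivable f x 1) /\ f^`() = f'.
Proof.
by move=> df; split=> [x|]; [|apply/funext => x]; case: (is_derive_derivable (df x)).
Qed.

Lemma derive1D_fun f g :
  (forall x, derivable f x 1) -> (forall x, derivable g x 1) ->
  (forall x, derivable (fun x => f x + g x) x 1) /\
  (fun x => f x + g x)^`() = (fun x => f^`() x + g^`() x).
Proof.
move=> df dg; apply: is_derive_fun => x.
by apply: is_deriveD; exact: derivable_is_derive.
Qed.

Lemma derive1B_fun f g :
  (forall x, derivable f x 1) -> (forall x, derivable g x 1) ->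
  (forall x, derivable (fun x => f x - g x) x 1) /\
  (fun x => f x - g x)^`() = (fun x => f^`() x - g^`() x).
Proof.
move=> df dg; apply: is_derive_fun => x.
by apply: is_deriveB; exact: derivable_is_derive.
Qed.

Lemma derive1Z_fun c f : (forall x, derivable f x 1) ->
  (forall x, derivable (fun x => c * f x) x 1) /\
  (fun x => c * f x)^`() = (fun x => c * f^`() x).
Proof.
move=> df; apply: is_derive_fun => x.
by apply: (@is_deriveZ _ _ _ f c x 1 _ (derivable_is_derive (df x))).
Qed.

Lemma derive1M_fun f g :
  (forall x, derivable f x 1) -> (forall x, derivable g x 1) ->
  (forall x, derivable (fun x => f x * g x) x 1) /\
  (fun x => f x * g x)^`() = (fun x => f^`() x * g x + f x * g^`() x).
Proof.
move=> df dg; apply: is_derive_fun => x.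
have := @is_deriveM _ _ f g x 1 _ _ (derivable_is_derive (df x)) (derivable_is_derive (dg x)).
by move/is_derive_eq; apply; rewrite addrC; congr (_ + _); exact: mulrC.
Qed.

Lemma derive1_comp_fun f g :
  (forall x, derivable f x 1) -> (forall x, derivable g x 1) ->
  (forall x, derivable (fun x => f (g x)) x 1) /\
  (fun x => f (g x))^`() = (fun x => f^`() (g x) * g^`() x).
Proof.
move=> df dg; apply: is_derive_fun => x.
have := @is_derive1_comp R f g x _ _ (derivable_is_derive (df (g x))) (derivable_is_derive (dg x)).
by [].
Qed.

Lemma derive1V_fun f : (forall x, derivable f x 1) -> (forall x, f x != 0) ->
  (forall x, derivable (fun x => (f x)^-1) x 1) /\
  (fun x => (f x)^-1)^`() = (fun x => - (f^`() x * ((f x)^-1 * (f x)^-1))).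
Proof.
move=> df f0; apply: is_derive_fun => x.
have := is_deriveV (f0 x) (derivable_is_derive (df x)).
move/is_derive_eq; apply.
by rewrite scaleNr /GRing.scale/= mulrC -exprVn expr2.
Qed.

Lemma MVT_derive1 f (a b : R) : (forall x, derivable f x 1) -> a <= b ->
  exists2 c, a <= c <= b & f b - f a = f^`() c * (b - a).
Proof.
move=> df ab; have [c] : exists2 c, c \in `[a, b] & f b - f a = f^`() c * (b - a).
  apply: MVT_segment => // [z _|]; first exact: derivable_is_derive.
  by apply: continuous_subspaceT; exact: derivable_cont.
by rewrite in_itv/= => ? ?; exists c.
Qed.

Lemma MVT_le f M : (forall x, derivable f x 1) -> (forall x, `|f^`() x| <= M) ->
  lip M f.
Proof.
move=> df fM x y.
wlog xy : x y / x <= y.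
  move=> W; have [/W//|/ltW/W] := leP x y.
  by rewrite (distrC (f x)) (distrC x).
have [c _ E] := MVT_derive1 df xy.
by rewrite distrC E normrM distrC ler_wpM2r.
Qed.

End calculus.

(** * The classes HB and CL *)

Section classes.
Variable R : realType.
Implicit Types (f g h p q G X F : R -> R) (M N K L C dt : R) (m j k : nat).

Definition bnd M f := forall x, `|f x| <= M.

(** Homogeneous part of [HB]: derivatives of orders 1 to [m] are bounded by [M]
    and the one of order [m] has H^1 seminorm at most [M]; nothing is said about
    the size of [f] itself, so that the identity qualifies. *)
Fixpoint Hd m f M := match m with
  | 0 => H1 M f
  | m'.+1 => [/\ (forall x, derivable f x 1), bnd M f^`() & Hd m' f^`() M]
  end.

(** On periodic functions this is a ball of H^(m+1). *)
Definition HB m f M := bnd M f /\ Hd m f M.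

(** Balls of C^(m,1). *)
Fixpoint CL m f M := match m with
  | 0 => bnd M f /\ lip M f
  | m'.+1 => [/\ bnd M f, (forall x, derivable f x 1) & CL m' f^`() M]
  end.

Lemma bnd_ge0 M f : bnd M f -> 0 <= M.
Proof. by move=> /(_ 0); exact: le_trans. Qed.

Lemma HB_ge0 m M f : HB m f M -> 0 <= M.
Proof. by move=> [/bnd_ge0]. Qed.

Lemma bnd_mono M N f : M <= N -> bnd M f -> bnd N f.
Proof. by move=> MN fM x; exact: le_trans (fM x) MN. Qed.

Lemma lip_mono M N f : M <= N -> lip M f -> lip N f.
Proof. by move=> MN fM x y; apply: le_trans (fM x y) _; rewrite ler_wpM2r. Qed.

Lemma HBS m f M : HB m.+1 f M <->
  [/\ bnd M f, (forall x, derivable f x 1) & HB m f^`() M].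
Proof. by split=> [[? []]//|[? ? []]]. Qed.

Lemma Hd_mono m : forall f M N, 0 <= M <= N -> Hd m f M -> Hd m f N.
Proof.
elim: m => [|m IH] f M N MN /=; first exact: energy_mono.
move=> [df bf Hf]; split => //; last exact: IH Hf.
by apply: bnd_mono bf; case/andP: MN.
Qed.

Lemma HB_mono m f M N : M <= N -> HB m f M -> HB m f N.
Proof.
move=> MN Hf; have M0 := HB_ge0 Hf; move: Hf => [bf Hf].
by split; [exact: bnd_mono bf|apply: Hd_mono Hf; rewrite M0].
Qed.

Lemma CL_bnd m f M : CL m f M -> bnd M f.
Proof. by case: m => [[]|m []]. Qed.

Lemma CL_mono m : forall f M N, M <= N -> CL m f M -> CL m f N.
Proof.
elim: m => [|m IH] f M N MN /=.
  by move=> [bf lf]; split; [exact: bnd_mono bf|exact: lip_mono lf].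
by move=> [bf df Cf]; split => //; [exact: bnd_mono bf|exact: IH Cf].
Qed.

Lemma CL_lip m f M : CL m f M -> lip M f.
Proof.
case: m => [[]//|m [_ df /CL_bnd]]; exact: MVT_le.
Qed.

Lemma CL_S m : forall f M, CL m.+1 f M -> CL m f M.
Proof.
elim: m => [|m IH] f M [bf df Cf]; last by split => //; exact: IH.
by split => //; apply: MVT_le => //; case: Cf.
Qed.

Lemma CL_HB m : forall f M, CL m f M -> HB m f M.
Proof.
elim: m => [|m IH] f M /=; first by move=> [bf /lip_H1].
by move=> [bf df /IH Hf]; apply/HBS.
Qed.

Lemma Hd_S m : forall f M, Hd m.+1 f M -> Hd m f M.
Proof.
elim: m => [|m IH] f M [df bf Hf].
  by apply: lip_H1; exact: MVT_le.
by split => //; exact: IH.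
Qed.

Lemma HB_S m f M : HB m.+1 f M -> HB m f M.
Proof. by move=> [? /Hd_S]. Qed.

Lemma HB_lip m f M : HB m.+1 f M -> lip M f.
Proof. by move=> [_ [df bf _]]; exact: MVT_le. Qed.

Lemma HB_leq m k f M : (k <= m)%N -> HB m f M -> HB k f M.
Proof.
by move=> /subnK <-; elim: (m - k)%N => // n IH /HB_S /IH.
Qed.

Lemma H1D M N f g : 0 <= M -> 0 <= N -> H1 M f -> H1 N g ->
  H1 (M + N) (fun x => f x + g x).
Proof.
move=> M0 N0 Hf Hg; rewrite -[M]mul1r -[N]mul1r.
apply: energy_dom Hf Hg => // a b ab; rewrite !mul1r.
by rewrite opprD addrACA ler_normD.
Qed.

Lemma H1Z c M f : 0 <= M -> H1 M f -> H1 (`|c| * M) (fun x => c * f x).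
Proof.
by move=> M0; apply: energy_dom1 => // a b ab; rewrite -mulrBr normrM.
Qed.

(** Increments are multiplied by at most the Lipschitz constant; this is the base
    case of all composition estimates. *)
Lemma H1_lip_comp K M G f : 0 <= K -> 0 <= M -> lip K G -> H1 M f ->
  H1 (K * M) (fun x => G (f x)).
Proof.
by move=> K0 M0 GK; apply: energy_dom1 => //.
Qed.

Lemma H1M M N P Q f g : bnd P f -> bnd Q g -> 0 <= M -> 0 <= N ->
  H1 M f -> H1 N g -> H1 (Q * M + P * N) (fun x => f x * g x).
Proof.
move=> bf bg M0 N0 Hf Hg.
apply: energy_dom Hf Hg => //; [exact: bnd_ge0 bg|exact: bnd_ge0 bf|].
move=> a b ab.
have -> : f b * g b - f a * g a = g b * (f b - f a) + f a * (g b - g a) by ring.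
apply: (le_trans (ler_normD _ _)); rewrite !normrM.
by apply: lerD; rewrite ler_wpM2r.
Qed.

Lemma bndD M N f g : bnd M f -> bnd N g -> bnd (M + N) (fun x => f x + g x).
Proof. by move=> bf bg x; apply: (le_trans (ler_normD _ _)); exact: lerD. Qed.

Lemma bndZ c M f : bnd M f -> bnd (`|c| * M) (fun x => c * f x).
Proof. by move=> bf x; rewrite normrM ler_wpM2l. Qed.

Lemma HdD m : forall f g M N, 0 <= M -> 0 <= N -> Hd m f M -> Hd m g N ->
  Hd m (fun x => f x + g x) (M + N).
Proof.
elim: m => [|m IH] f g M N M0 N0; first exact: H1D.
move=> [df bf Hf] [dg bg Hg]; have [dfg fgE] := derive1D_fun df dg.
by split => //; rewrite fgE; [exact: bndD|exact: IH].
Qed.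

Lemma HdZ m : forall f c M, 0 <= M -> Hd m f M -> Hd m (fun x => c * f x) (`|c| * M).
Proof.
elim: m => [|m IH] f c M M0; first exact: H1Z.
move=> [df bf Hf]; have [dcf cfE] := derive1Z_fun c df.
by split => //; rewrite cfE; [exact: bndZ|exact: IH].
Qed.

Lemma HBD m f g M N : HB m f M -> HB m g N -> HB m (fun x => f x + g x) (M + N).
Proof.
move=> [bf Hf] [bg Hg]; split; first exact: bndD.
by apply: HdD => //; [exact: bnd_ge0 bf|exact: bnd_ge0 bg].
Qed.

Lemma HBZ m f c M : HB m f M -> HB m (fun x => c * f x) (`|c| * M).
Proof.
move=> [bf Hf]; split; first exact: bndZ.
by apply: HdZ => //; exact: bnd_ge0 bf.
Qed.

Lemma HBB m f g M N : HB m f M -> HB m g N ->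
  HB m (fun x => f x - g x) (M + N).
Proof.
move=> Hf /(HBZ (-1)); rewrite normrN normr1 mul1r => /(HBD Hf).
by under eq_fun do rewrite mulN1r.
Qed.

(** Crude Banach algebra property, by the Leibniz rule; only the form of the
    constant matters, a multiple of the product of the bounds. *)
Lemma HBM m : forall f g M N, HB m f M -> HB m g N ->
  HB m (fun x => f x * g x) (2 ^+ m.+1 * (M * N)).
Proof.
elim: m => [|m IH] f g M N Hf Hg; have M0 := HB_ge0 Hf; have N0 := HB_ge0 Hg.
  have MN0 : 0 <= M * N by exact: mulr_ge0.
  case: Hf Hg => bf Hf [bg Hg]; split.
    move=> x; rewrite normrM; apply: (@le_trans _ _ (M * N)); first exact: ler_pM.
    by rewrite expr1; lra.
  by rewrite expr1 (_ : 2 * _ = N * M + M * N); [exact: H1M|ring].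
have Hf1 := HB_S Hf; have Hg1 := HB_S Hg.
move/HBS: Hf Hg => [bf df Hf] /HBS[bg dg Hg].
have [dfg fgE] := derive1M_fun df dg; apply/HBS; split => //.
  move=> x; rewrite normrM; apply: (@le_trans _ _ (M * N)); first exact: ler_pM.
  by rewrite ler_peMl ?mulr_ge0// exprn_ege1// ler1n.
rewrite fgE (_ : 2 ^+ m.+2 * _ = 2 ^+ m.+1 * (M * N) + 2 ^+ m.+1 * (M * N)).
  by apply: HBD; exact: IH.
by rewrite [in LHS]exprS; ring.
Qed.

Lemma HB_cst m c : HB m (fun=> c) `|c|.
Proof.
elim: m c => [|m IH] c.
  split=> //; rewrite /Hd; apply: lip_H1 => x y; by rewrite subrr normr0 mulr_ge0.
have dE : (fun=> c : R)^`() = (fun=> 0 : R).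
  by apply/funext => x; rewrite derive1_cst.
apply/HBS; split => //; rewrite dE; apply: HB_mono (IH 0); by rewrite normr0.
Qed.

(** Chain rule and induction: a derivative falls on [G] at the price of one
    order of regularity of [G] and of [p]. *)
Lemma HB_comp_CL m : forall K M, 0 <= M -> exists2 C, 0 <= C &
  forall G p, CL m G K -> Hd m p M -> HB m (fun x => G (p x)) C.
Proof.
elim: m => [|m IH] K M M0.
  exists (`|K| + `|K| * M); first by rewrite addr_ge0// mulr_ge0.
  move=> G p [bG lG] Hp; have K0 := bnd_ge0 bG.
  rewrite ger0_norm//; split.
    by move=> x; apply: le_trans (bG _) _; rewrite lerDl mulr_ge0.
  apply: (@energy_mono _ (K * M)); last exact: H1_lip_comp.
  by rewrite mulr_ge0//= lerDr.
have [C C0 HC] := IH K M M0.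
exists (`|K| + 2 ^+ m.+1 * (C * M)).
  by rewrite addr_ge0// mulr_ge0 ?exprn_ge0// mulr_ge0.
move=> G p [bG dG CG] Hp; have Hp1 := Hd_S Hp; have K0 := bnd_ge0 bG.
case: Hp => dp bp Hp; rewrite ger0_norm//.
have [dGp GpE] := derive1_comp_fun dG dp; apply/HBS; split => //.
  move=> x; apply: le_trans (bG _) _.
  by rewrite lerDl mulr_ge0 ?exprn_ge0// mulr_ge0.
rewrite GpE; apply: HB_mono; last exact: (HBM (HC _ _ CG Hp1) (conj bp Hp)).
by rewrite lerDr.
Qed.

Lemma HB_inv m : forall M, 0 <= M -> exists2 C, 0 <= C &
  forall p, HB m p M -> (forall x, 2^-1 <= p x) -> HB m (fun x => (p x)^-1) C.
Proof.
elim: m => [|m IH] M M0.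
  exists (2 + 4 * M); first by rewrite addr_ge0// mulr_ge0.
  move=> p [bp Hp] p2.
  have p0 x : 0 < p x by apply: lt_le_trans (p2 x); rewrite invr_gt0.
  have ip x : (p x)^-1 <= 2.
    by rewrite -[leRHS]invrK lef_pV2 ?posrE ?invr_gt0.
  split.
    move=> x; rewrite ger0_norm ?invr_ge0 ?(ltW (p0 x))//.
    apply: le_trans (ip x) _.
    by rewrite lerDl mulr_ge0.
  apply: (@energy_mono _ (4 * M)); first by rewrite mulr_ge0//= lerDr.
  apply: energy_dom1 Hp => // a b ab.
  have -> : (p b)^-1 - (p a)^-1 = ((p b)^-1 * (p a)^-1) * - (p b - p a).
    by field; rewrite !lt0r_neq0.
  rewrite normrM normrN ler_wpM2r// normrM.
  have -> : 4 = 2 * 2 :> R by ring.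
  by apply: ler_pM => //; rewrite ger0_norm ?invr_ge0 ?(ltW (p0 _))// ip.
have [C C0 HC] := IH M M0.
pose D := 2 ^+ m.+1 * (M * (2 ^+ m.+1 * (C * C))).
have D0 : 0 <= D by rewrite !mulr_ge0// exprn_ge0.
exists (2 + D); first by rewrite addr_ge0.
move=> p Hp p2.
have p0 x : 0 < p x by apply: lt_le_trans (p2 x); rewrite invr_gt0.
have ip x : (p x)^-1 <= 2.
  by rewrite -[leRHS]invrK lef_pV2 ?posrE ?invr_gt0.
have Hip := HC _ (HB_S Hp) p2.
move/HBS : Hp => [bp dp Hp].
have [dip ipE] := derive1V_fun dp (fun x => lt0r_neq0 (p0 x)).
apply/HBS; split => //.
  move=> x; rewrite ger0_norm ?invr_ge0 ?(ltW (p0 x))//.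
    apply: le_trans (ip x) _.
  by rewrite lerDl.
rewrite ipE; apply: (@HB_mono _ _ D); first by rewrite lerDr.
have := HBZ (-1) (HBM Hp (HBM Hip Hip)).
by rewrite normrN normr1 mul1r; under eq_fun do rewrite mulN1r.
Qed.

End classes.

(** * Composition with the flow of a small field *)

Section flow.
Variable R : realType.
Implicit Types (f g h p q G X F : R -> R) (M N K L C dt : R) (m j k : nat).

Lemma X1E dt F : X1 dt F = (fun x => x - dt * F x).
Proof. by apply/funext => x; rewrite /X1 mulrC. Qed.

Lemma derive1_X1 dt F : (forall x, derivable F x 1) ->
  (forall x, derivable (X1 dt F) x 1) /\
  (X1 dt F)^`() = (fun x => 1 - dt * F^`() x).
Proof.
move=> dF; rewrite X1E.
have [dZ ZE] := derive1Z_fun dt dF.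
have [dB BE] := derive1B_fun (fun x => @derivable_id _ _ x 1) dZ.
split; first exact: dB.
by rewrite BE ZE; apply/funext => x; rewrite derive1_id.
Qed.

(** The smallness [dt * L <= 2^-1] makes the map x - dt F(x) increasing. *)
Definition small_field dt L F :=
  [/\ 0 <= dt <= 1, lip L F, dt * L <= 2^-1 & periodic1 F].

Lemma X1_lip dt L F : 0 <= dt -> lip L F -> forall a b, a <= b ->
  (1 - dt * L) * (b - a) <= X1 dt F b - X1 dt F a <= (1 + dt * L) * (b - a).
Proof.
move=> dt0 lF a b ab; rewrite /X1.
have := lF b a; rewrite (ger0_norm (_ : 0 <= b - a)) ?subr_ge0// ler_norml.
move=> /andP[l1 l2].
by apply/andP; split; nra.
Qed.

(** The change of variables only moves the measure that controls the increments,
    and stretches intervals by at most [1 + dt * L]. *)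
Lemma H1_comp_flow dt L F N g : small_field dt L F -> 0 <= L -> 0 <= N ->
  H1 N g -> H1 ((1 + dt * L) * N) (fun x => g (X1 dt F x)).
Proof.
move=> [/andP[dt0 dt1] lF dtL pF] L0 N0 [A [A1 gA]].
have dtL0 : 0 <= dt * L by exact: mulr_ge0.
exists (fun x => (1 + dt * L) ^+ 2 * A (X1 dt F x)); split.
  move=> x; have -> : X1 dt F (x + 1) = X1 dt F x + 1.
    by rewrite /X1 pF; ring.
  by rewrite A1; ring.
move=> a b ab.
have /andP[X0 XL] := X1_lip dt0 lF ab.
have Xab : X1 dt F a <= X1 dt F b.
  rewrite -subr_ge0; apply: le_trans X0; apply: mulr_ge0; last by rewrite subr_ge0.
  lra.
apply: (le_trans (gA _ _ Xab)).
have AX := energy_nondecreasing gA Xab.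
rewrite -mulrBr mulrA; apply: ler_wpM2r; first by rewrite subr_ge0.
apply: (le_trans XL); rewrite mulrC ler_wpM2l ?subr_ge0//.
by rewrite ler_eXnr// lerDl.
Qed.

Lemma HB_flow_factor m M F dt : 0 <= dt <= 1 -> HB m F M ->
  HB m (fun x => 1 - dt * F x) (1 + M).
Proof.
move=> /andP[dt0 dt1] HF; have M0 := HB_ge0 HF.
apply: HB_mono; last exact: HBB (HB_cst m 1) (HBZ dt HF).
by rewrite normr1 ger0_norm// lerD2l ler_piMl.
Qed.

Lemma HB_comp_flow m : forall M, 0 <= M -> exists2 C, 0 <= C &
  forall g F dt L N, small_field dt L F -> 0 <= L -> HB m F M -> HB m g N ->
  HB m (fun x => g (X1 dt F x)) (C * N).
Proof.
elim: m => [|m IH] M M0.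
  exists 2 => // g F dt L N sF L0 HF [bg Hg]; have N0 := bnd_ge0 bg; split.
    by move=> x; apply: le_trans (bg _) _; rewrite ler_peMl// ler1n.
  apply: energy_mono; last exact: H1_comp_flow sF L0 N0 Hg.
  case: sF => /andP[dt0 dt1] _ dtL _.
  rewrite mulr_ge0 ?addr_ge0 ?mulr_ge0//= ler_wpM2r//; lra.
have [C C0 HC] := IH M M0.
pose D := 2 ^+ m.+1 * (C * (1 + M)).
have D0 : 0 <= D by rewrite !mulr_ge0 ?exprn_ge0// addr_ge0.
exists (1 + D); first by rewrite addr_ge0.
move=> g F dt L N sF L0 HF Hg.
have Hg1 := HB_S Hg; have HF1 := HB_S HF; have N0 := HB_ge0 Hg.
move/HBS: Hg => [bg dg Hg]; move/HBS: HF => [bF dF HF].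
have [dX XE] := derive1_X1 dt dF.
have [dgX gXE] := derive1_comp_fun dg dX; apply/HBS; split => //.
  move=> x; apply: le_trans (bg _) _; rewrite mulrDl mul1r lerDl.
  exact: mulr_ge0.
rewrite gXE XE; apply: HB_mono; last first.
  apply: HBM; first exact: HC sF L0 HF1 Hg.
  by apply: HB_flow_factor => //; [case: sF|exact: HF].
rewrite (_ : 2 ^+ m.+1 * _ = D * N); last by rewrite /D; ring.
by rewrite ler_wpM2r// lerDr.
Qed.

Lemma HB_derive j : forall k f M, HB (j + k) f M -> HB k (derive1n j f) M.
Proof.
elim: j => [|j IH] k f M //; rewrite addSn => /HBS[_ _ /IH].
by rewrite -derive1Sn.
Qed.

Lemma HB_derivable j k f M : HB (j + k.+1) f M ->
  forall x, derivable (derive1n j f) x 1.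
Proof. by move=> /HB_derive /HBS[]. Qed.

(** Since the flow is the identity up to O(dt), differentiating [j] times and
    composing commute up to O(dt).  The factor [dt] is what turns the H^s norm of
    a composition into [1 + O(dt)] times the norm, instead of a constant times
    it.  In the induction the loss of one order is compensated by taking the
    commutator of order [j] in the class of order [k.+1]. *)
Lemma HB_comp_flow_commutator j : forall k M, 0 <= M -> exists2 C, 0 <= C &
  forall g F dt L N, small_field dt L F -> 0 <= L ->
    HB (j + k) F M -> HB (j + k) g N ->
  HB k (fun x => derive1n j (fun y => g (X1 dt F y)) x - derive1n j g (X1 dt F x))
    (C * (dt * N)).
Proof.
elim: j => [|j IH] k M M0.
  exists 0 => // g F dt L N _ _ _ _; rewrite mul0r.
  have := @HB_cst R k 0; rewrite normr0 => H.
  by congr (HB _ _ _) : H; apply/funext => x /=; rewrite subrr.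
have [C C0 HC] := IH k.+1 M M0.
have [D D0 HD] := @HB_comp_flow k M M0.
have [E E0 HE] := @HB_comp_flow (j + k.+1) M M0.
exists (C + 2 ^+ k.+1 * (D * M)).
  by rewrite addr_ge0// !mulr_ge0// exprn_ge0.
move=> g F dt L N sF L0; rewrite addSnnS => HF Hg.
have /andP[dt0 dt1] : 0 <= dt <= 1 by case: sF.
have N0 := HB_ge0 Hg.
have Hc := HC _ _ _ _ _ sF L0 HF Hg.
have dgX := HB_derivable (HE _ _ _ _ _ sF L0 HF Hg).
have dg := HB_derivable Hg.
have HFk : HB k.+1 F M by apply: HB_leq HF; exact: leq_addl.
have /HBS[_ dF HF'] := HFk.
have Hgj : HB k (derive1n j.+1 g) N by have /HBS[] := HB_derive Hg.
have [dX XE] := derive1_X1 dt dF.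
have [dgjX gjXE] := derive1_comp_fun dg dX.
have [_ cE] := derive1B_fun dgX dgjX.
have /HBS[_ _ Hc'] := Hc.
have Hr := HBZ dt (HBM (HD _ _ _ _ _ sF L0 (HB_S HFk) Hgj) HF').
have := HBB Hc' Hr; rewrite cE gjXE XE ger0_norm// => H.
have -> : (C + 2 ^+ k.+1 * (D * M)) * (dt * N) =
  C * (dt * N) + dt * (2 ^+ k.+1 * (D * N * M)) by ring.
congr (HB _ _ _) : H; apply/funext => x; rewrite derive1nS /=; ring.
Qed.

(** Mean value theorem along the segment joining [q] to [p], applied to the
    difference of the values at [b] and at [a]. *)
Lemma comp_diff_increment G K p q N a b :
  bnd K G^`() -> lip K G^`() -> (forall x, derivable G x 1) ->
  (forall x, `|p x - q x| <= N) ->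
  `|(G (p b) - G (q b)) - (G (p a) - G (q a))| <=
  K * `|(p b - q b) - (p a - q a)| + K * N * (`|p b - p a| + `|q b - q a|).
Proof.
move=> bG lG dG pqN; have K0 := bnd_ge0 bG.
pose path x t := q x + t * (p x - q x).
have dpath x : (forall t, derivable (path x) t 1) /\
    (path x)^`() = (fun=> p x - q x).
  apply: is_derive_fun => t; rewrite /path.
  rewrite -[X in is_derive _ _ _ X]add0r; apply: is_deriveD.
  have := @is_deriveM _ _ id (fun=> p x - q x) t 1 _ _ (is_derive_id _ _) (is_derive_cst _ _ _).
  move/is_derive_eq; apply; rewrite scaler0 add0r; exact: mulr1.
pose phi t := G (path b t) - G (path a t).
have [dGb GbE] := derive1_comp_fun dG (dpath b).1.
have [dGa GaE] := derive1_comp_fun dG (dpath a).1.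
have [dphi phiE] := derive1B_fun dGb dGa.
have [t /andP[t0 t1] E] := MVT_derive1 dphi (@ler01 R).
have -> : G (p b) - G (q b) - (G (p a) - G (q a)) = phi 1 - phi 0.
  rewrite /phi /path !mul1r !mul0r !addr0 (addrC (q b)) subrK (addrC (q a)) subrK.
  ring.
rewrite E subr0 mulr1 phiE GbE GaE (dpath b).2 (dpath a).2.
set u := G^`() (path b t); set v := G^`() (path a t).
have -> : u * (p b - q b) - v * (p a - q a) =
  u * ((p b - q b) - (p a - q a)) + (u - v) * (p a - q a) by ring.
apply: (le_trans (ler_normD _ _)); rewrite !normrM; apply: lerD.
  by rewrite ler_wpM2r// bG.
rewrite mulrAC; apply: ler_pM => //.
apply: (le_trans (lG _ _)); rewrite ler_wpM2l//.
have -> : path b t - path a t = t * (p b - p a) + (1 - t) * (q b - q a).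
  by rewrite /path; ring.
apply: (le_trans (ler_normD _ _)); rewrite !normrM (ger0_norm t0).
rewrite (ger0_norm (_ : 0 <= 1 - t)) ?subr_ge0//.
by apply: lerD; rewrite ler_piMl//; lra.
Qed.

(** Composition with [G] is Lipschitz from H^(m+1) to itself as soon as [G] is
    one order smoother; the derivative of the difference splits into two
    products that the induction hypothesis and [HB_comp_CL] control. *)
Lemma HB_comp_diff m : forall K M, 0 <= M -> exists2 C, 0 <= C &
  forall G p q N, CL m.+1 G K -> Hd m p M -> Hd m q M ->
    HB m (fun x => p x - q x) N -> HB m (fun x => G (p x) - G (q x)) (C * N).
Proof.
elim: m => [|m IH] K M M0.
  exists (`|K| + `|K| * (2 * M)); first by rewrite addr_ge0// !mulr_ge0.
  move=> G p q N CG Hp Hq [bpq Hpq]; have lG := CL_lip CG.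
  have N0 := bnd_ge0 bpq.
  case: CG => _ dG [bG' lG']; have K0 := bnd_ge0 bG'; rewrite ger0_norm//.
  split.
    move=> x; apply: (le_trans (lG _ _)).
    apply: (@le_trans _ _ (K * N)); first by rewrite ler_wpM2l.
    by rewrite ler_wpM2r// lerDl !mulr_ge0.
  have Hpq2 : energy (1 * M + 1 * M) (fun a b => `|p b - p a| + `|q b - q a|).
    apply: energy_dom Hp Hq => // a b _.
    by rewrite ger0_norm ?addr_ge0// !mul1r.
  have -> : (K + K * (2 * M)) * N = K * N + (K * N) * (1 * M + 1 * M) by ring.
  apply: energy_dom Hpq Hpq2 => //; rewrite ?mulr_ge0 ?addr_ge0 ?mulr_ge0//.
  move=> a b ab; rewrite [X in _ + _ * X]ger0_norm ?addr_ge0//.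
  exact: comp_diff_increment.
have [C C0 HC] := IH K M M0.
have [D D0 HD] := @HB_comp_CL _ m K M M0.
pose E := 2 ^+ m.+1 * (C * M) + 2 ^+ m.+1 * D.
have E0 : 0 <= E by rewrite addr_ge0// !mulr_ge0 ?exprn_ge0.
exists (`|K| + E); first by rewrite addr_ge0.
move=> G p q N CG Hp Hq Hpq; have lG := CL_lip CG.
have Hp1 := Hd_S Hp; have Hq1 := Hd_S Hq; have Hpq1 := HB_S Hpq.
have N0 := HB_ge0 Hpq.
case: CG => bG dG CG; have K0 := bnd_ge0 bG; rewrite ger0_norm//.
case: Hp => dp bp Hp; case: Hq => dq bq Hq; case/HBS: Hpq => bpq dpq.
rewrite (derive1B_fun dp dq).2 => Hpq.
have [dGp GpE] := derive1_comp_fun dG dp.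
have [dGq GqE] := derive1_comp_fun dG dq.
have [dGpq GpqE] := derive1B_fun dGp dGq; apply/HBS; split => //.
  move=> x; apply: (le_trans (lG _ _)).
  apply: (@le_trans _ _ (K * N)); first by rewrite ler_wpM2l.
  by rewrite ler_wpM2r// lerDl.
have CG' := CL_S CG.
have := HBD (HBM (HC _ _ _ _ CG Hp1 Hq1 Hpq1) (conj bp Hp)) (HBM (HD _ _ CG' Hq1) Hpq).
rewrite GpqE GpE GqE => H.
have H2 : HB m (fun x => G^`() (p x) * p^`() x - G^`() (q x) * q^`() x) (E * N).
  have -> : E * N = 2 ^+ m.+1 * (C * N * M) + 2 ^+ m.+1 * (D * N).
    by rewrite /E; ring.
  by congr (HB _ _ _) : H; apply/funext => x; ring.
by apply: HB_mono H2; rewrite ler_wpM2r// lerDr.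
Qed.

End flow.

(** * Periodic functions *)

Section periodic.
Variable R : realType.
Implicit Types (f g : R -> R) (P : R).

Lemma periodic_shiftn f : periodic1 f -> forall n x, f (x + n%:R) = f x.
Proof.
move=> pf; elim=> [|n IH] x; first by rewrite addr0.
by rewrite -(@natr1 _ n) addrA pf IH.
Qed.

(** Translating by an integer reduces to points at distance at most 1, between
    which the controlling measure has mass at most [P ^+ 2]. *)
Lemma periodic_osc f P : periodic1 f -> 0 <= P -> H1 P f ->
  forall x y, `|f x - f y| <= P.
Proof.
move=> pf P0 [A [A1 fA]] x y.
wlog xy : x y / x <= y.
  by move=> W; have [/W//|/ltW/W] := leP x y; rewrite distrC.
pose n := Num.truncn (y - x).
have nle : n%:R <= y - x by rewrite truncn_le// subr_ge0.
have nlt := truncnS_gt (y - x).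
pose z := y - n%:R.
have -> : f y = f z by rewrite -(periodic_shiftn pf n z) /z subrK.
have xz : x <= z by rewrite /z; lra.
have z1 : z <= x + 1 by move: nlt; rewrite -natr1 /z -/n; lra.
rewrite distrC -ler_sqr ?nnegrE// real_normK ?num_real//.
apply: (le_trans (fA _ _ xz)).
have Ant := energy_nondecreasing fA.
have := Ant _ _ z1; have := Ant _ _ xz; rewrite A1 => h1 h2.
apply: (@le_trans _ _ (1 * (P ^+ 2))); last by rewrite mul1r.
by apply: ler_pM; rewrite ?subr_ge0//; lra.
Qed.

Lemma periodic_derive1 f : periodic1 f -> periodic1 f^`().
Proof.
move=> pf x; rewrite /derive1.
have -> // : (fun h => h^-1 *: (f (h + (x + 1)) - f (x + 1))) =
  (fun h => h^-1 *: (f (h + x) - f x)).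
by apply/funext => h; rewrite addrA !pf.
Qed.

Lemma periodic_derive1_zero f : periodic1 f -> (forall x, derivable f x 1) ->
  exists c, f^`() c = 0.
Proof.
move=> pf df.
have [c _ E] := MVT_derive1 df (@ler01 R).
by exists c; move: E; rewrite -{1}[1]add0r pf subrr subr0 mulr1.
Qed.

(** A periodic derivative vanishes somewhere, so it is bounded by its
    oscillation: the seminorm of highest order controls all intermediate ones. *)
Lemma periodic_Hd m : forall f P, periodic1 f -> 0 <= P ->
  (forall k, (k < m)%N -> forall x, derivable (derive1n k f) x 1) ->
  H1 P (derive1n m f) -> Hd m f P /\ H1 P f.
Proof.
elim: m => [|m IH] f P pf P0 df Hf //.
have df0 : forall x, derivable f x 1 by exact: (df 0%N).
have [||Hf' Hf1] := IH f^`() P (periodic_derive1 pf) P0.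
- by move=> k km; rewrite -derive1Sn; exact: df.
- by rewrite -derive1Sn.
have bf' : bnd P f^`().
  move=> x; have [c c0] := periodic_derive1_zero pf df0.
  have := periodic_osc (periodic_derive1 pf) P0 Hf1 x c.
  by rewrite c0 subr0.
split => //; apply: lip_H1; exact: MVT_le.
Qed.

End periodic.

(** * The implicit transport equation *)

Section implicit_step.
Variable R : realType.
Implicit Types (f w a : R -> R) (M N K L C dt : R) (m j k : nat).

Lemma CL_leq m k f M : (k <= m)%N -> CL m f M -> CL k f M.
Proof.
by move=> /subnK <-; elim: (m - k)%N => // n IH /CL_S /IH.
Qed.

Lemma lip_continuous M f : lip M f -> continuous f.
Proof.
move=> lf x; apply/cvgrPdist_le => e e0.
have M1 : 0 < `|M| + 1 by rewrite ltr_wpDl.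
near=> y; apply: le_trans (lf _ _) _.
apply: (@le_trans _ _ ((`|M| + 1) * `|x - y|)).
  by rewrite ler_wpM2r// (le_trans (ler_norm _))// lerDl.
rewrite -ler_pdivlMl// mulrC; near: y.
have d0 : 0 < e / (`|M| + 1) by rewrite divr_gt0.
exact: cvgr_dist_le d0.
Unshelve. all: by end_near. Qed.

(** The right-hand side is a contraction of the unknown value. *)
Lemma implicit_unique dt K N f w x y1 y2 : 0 <= dt -> 0 <= N ->
  lip K f -> lip N w -> dt * (K * N) <= 4^-1 ->
  y1 = w (x - f y1 * dt) -> y2 = w (x - f y2 * dt) -> y1 = y2.
Proof.
move=> dt0 N0 lf lw small E1 E2.
have h : `|y1 - y2| <= 4^-1 * `|y1 - y2|.
  rewrite {1}E1 {1}E2; apply: le_trans (lw _ _) _.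
  have -> : x - f y1 * dt - (x - f y2 * dt) = - (dt * (f y1 - f y2)) by ring.
  rewrite normrN normrM (ger0_norm dt0).
  apply: (@le_trans _ _ (dt * (K * N) * `|y1 - y2|)); last by rewrite ler_wpM2r.
  have -> : dt * (K * N) * `|y1 - y2| = N * (dt * (K * `|y1 - y2|)) by ring.
  by rewrite !ler_wpM2l.
have : `|y1 - y2| = 0 by apply/eqP; rewrite eq_le normr_ge0 andbT; lra.
by move/eqP; rewrite normr_eq0 subr_eq0 => /eqP.
Qed.

(** The intermediate value theorem gives a value at each point separately;
    regularity of the resulting function is proved afterwards. *)
Lemma implicit_exists dt f w K N : lip K f -> lip N w -> bnd N w ->
  exists a : R -> R, forall x, a x = w (x - f (a x) * dt).
Proof.
move=> lf lw bw.
suff H x : exists y, y = w (x - f y * dt) by have [a aE] := boolp.choice H; exists a.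
pose g y := y - w (x - f y * dt).
have N0 := bnd_ge0 bw.
have cg : continuous g.
  move=> y; apply: cvgB; first exact: cvg_id.
  apply: continuous_comp; last exact: lip_continuous lw _.
  apply: cvgB; first exact: cvg_cst.
  apply: cvgM; last exact: cvg_cst.
  exact: lip_continuous lf _.
have [c _ gc] : exists2 c, c \in `[- N, N]%R & g c = 0.
  apply: IVT; first lra.
    exact: continuous_subspaceT.
  have g1 : g (- N) <= 0.
    by rewrite /g; have := bw (x - f (- N) * dt); rewrite ler_norml; lra.
  have g2 : 0 <= g N.
    by rewrite /g; have := bw (x - f N * dt); rewrite ler_norml; lra.
  rewrite minEle maxEle (le_trans g1 g2); exact/andP.
by exists c; move/eqP: gc; rewrite subr_eq0 => /eqP.
Qed.

(** The equation of [SA_solution], written pointwise. *)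
Definition implicit_step dt f w a := forall x, a x = w (X1 dt (f \o a) x).

Lemma implicit_step_lip dt K N f w a : 0 <= dt -> 0 <= N ->
  lip K f -> lip N w -> dt * (K * N) <= 4^-1 -> implicit_step dt f w a ->
  lip (2 * N) a.
Proof.
move=> dt0 N0 lf lw small E x y.
have : `|a x - a y| <= N * `|x - y| + 4^-1 * `|a x - a y|.
  rewrite {1}E {1}E; apply: le_trans (lw _ _) _; rewrite /X1 /=.
  have -> : x - f (a x) * dt - (y - f (a y) * dt) =
    (x - y) - dt * (f (a x) - f (a y)) by ring.
  apply: (@le_trans _ _ (N * (`|x - y| + dt * (K * `|a x - a y|)))).
    rewrite ler_wpM2l//; apply: (le_trans (ler_normB _ _)).
    by rewrite lerD2l normrM (ger0_norm dt0) ler_wpM2l.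
  rewrite mulrDr lerD2l.
  have -> : N * (dt * (K * `|a x - a y|)) = dt * (K * N) * `|a x - a y| by ring.
  by rewrite ler_wpM2r.
have := normr_ge0 (a x - a y).
have : 0 <= N * `|x - y| by rewrite mulr_ge0.
rewrite -mulrA; lra.
Qed.

Lemma implicit_step_periodic dt K N f w a : 0 <= dt -> 0 <= N ->
  lip K f -> lip N w -> dt * (K * N) <= 4^-1 -> implicit_step dt f w a ->
  periodic1 w -> periodic1 a.
Proof.
move=> dt0 N0 lf lw small E pw x.
apply: (@implicit_unique dt K N f w x _ _ dt0 N0 lf lw small _ (E x)).
by rewrite {1}E /X1/= -[RHS]pw; congr w; ring.
Qed.

Lemma caratheodory_slope N f x : (forall y, derivable f y 1) -> bnd N f^`() ->
  exists g, [/\ forall y, f y - f x = g y * (y - x), {for x, continuous g},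
    g x = f^`() x & bnd N g].
Proof.
move=> df bf; have lf := MVT_le df bf.
have /is_derive1_caratheodory [g [fg cg gx]] := derivable_is_derive (df x).
exists g; split => // y.
have [->|yx] := eqVneq y x; first by rewrite gx.
have yx0 : 0 < `|y - x| by rewrite normr_gt0 subr_eq0.
by rewrite -(ler_pM2r yx0) -normrM -fg.
Qed.

(** Implicit differentiation.  With Caratheodory slopes [W] of [w] and [F] of [f],
    the equation gives the exact slope of [a], namely [W / (1 + dt F W)], whose
    continuity is the differentiability of [a]. *)
Lemma implicit_step_derive dt K N f w a : 0 <= dt -> 0 <= N ->
  (forall y, derivable f y 1) -> bnd K f^`() ->
  (forall y, derivable w y 1) -> bnd N w^`() -> dt * (K * N) <= 4^-1 ->
  implicit_step dt f w a ->
  (forall x, 2^-1 <= 1 + dt * (f^`() (a x) * w^`() (X1 dt (f \o a) x))) /\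
  (forall x, derivable a x 1) /\
  a^`() = (fun x => w^`() (X1 dt (f \o a) x) *
      (1 + dt * (f^`() (a x) * w^`() (X1 dt (f \o a) x)))^-1).
Proof.
move=> dt0 N0 df bf dw bw small E.
have K0 := bnd_ge0 bf.
have lf := MVT_le df bf; have lw := MVT_le dw bw.
have ca := lip_continuous (implicit_step_lip dt0 N0 lf lw small E).
have cX : continuous (X1 dt (f \o a)).
  move=> x; apply: cvgB; first exact: cvg_id.
  apply: cvgM; last exact: cvg_cst.
  by apply: continuous_comp; [exact: ca|exact: (lip_continuous lf)].
have den u v : `|u| <= K -> `|v| <= N -> 2^-1 <= 1 + dt * (u * v).
  move=> uK vN.
  have : `|dt * (u * v)| <= 4^-1.
    rewrite normrM (ger0_norm dt0); apply: le_trans small.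
    by rewrite ler_wpM2l// normrM ler_pM.
  rewrite ler_norml; lra.
split; first by move=> x; exact: den.
apply: is_derive_fun => x.
have [W [wE cW Wx bW]] := caratheodory_slope (X1 dt (f \o a) x) dw bw.
have [F [fE cF Fx bF]] := caratheodory_slope (a x) df bf.
pose d z := 1 + dt * (F (a z) * W (X1 dt (f \o a) z)).
have d2 z : 2^-1 <= d z by exact: den.
have d0 z : d z != 0 by apply: lt0r_neq0; apply: lt_le_trans (d2 z).
apply/is_derive1_caratheodory.
exists (fun z => W (X1 dt (f \o a) z) * (d z)^-1); split.
- move=> z.
  have h : a z - a x = W (X1 dt (f \o a) z) * (z - x - dt * (F (a z) * (a z - a x))).
    rewrite {1}E {1}(E x) wE -fE /X1/=; congr (_ * _); ring.
  have h2 : (a z - a x) * d z = W (X1 dt (f \o a) z) * (z - x).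
    by rewrite /d mulrDr mulr1 {1}h; ring.
  by rewrite mulrAC -h2 mulfK.
- have cWX : {for x, continuous (fun z => W (X1 dt (f \o a) z))}.
    by apply: continuous_comp => //; exact: cX.
  apply: continuousM => //; apply: continuousV; first exact: d0.
  apply: cvgD; first exact: cvg_cst.
  apply: cvgM; first exact: cvg_cst.
  apply: continuousM => //.
  by apply: continuous_comp => //; exact: ca.
- by rewrite /d Wx Fx.
Qed.

(** Bootstrap: the formula for the derivative of [a] involves [a] only through
    compositions, so one more derivative of [a] is bounded at each round. *)
Lemma implicit_step_HB m K N : 0 <= K -> 0 <= N -> forall j, (j <= m.+1)%N ->
  exists2 C, 0 <= C & forall f w a dt, 0 <= dt <= 1 -> CL m.+2 f K ->
    HB m.+1 w N -> periodic1 w -> dt * (K * N) <= 4^-1 ->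
    implicit_step dt f w a -> HB j a C.
Proof.
move=> K0 N0; elim=> [_|j IH jm].
  exists (2 * N); first by rewrite mulr_ge0.
  move=> f w a dt /andP[dt0 dt1] Cf Hw pw small E.
  have lf := CL_lip Cf; have lw := HB_lip Hw.
  split; last by apply/lip_H1/(implicit_step_lip dt0 N0 lf lw small E).
  by move=> x; rewrite E; apply: le_trans (Hw.1 _) _; rewrite ler_peMl// ler1n.
have [C C0 HC] := IH (ltnW jm).
have [D D0 HD] := @HB_comp_CL R j K C C0.
have [B B0 HB_] := @HB_comp_flow R j D D0.
pose Q := 2 ^+ j.+1 * (D * (B * N)).
have Q0 : 0 <= Q by rewrite !mulr_ge0 ?exprn_ge0.
have [I I0 HI] := @HB_inv R j (1 + Q) (addr_ge0 ler01 Q0).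
pose S := 2 ^+ j.+1 * (B * N * I).
exists (N + S); first by rewrite addr_ge0// !mulr_ge0 ?exprn_ge0.
move=> f w a dt dt01 Cf Hw pw small E.
have /andP[dt0 dt1] := dt01.
have lf := CL_lip Cf; have lw := HB_lip Hw.
have Ha := HC _ _ _ _ dt01 Cf Hw pw small E.
have HF : HB j (fun x => f (a x)) D.
  by apply: HD; [apply: CL_leq Cf; lia|exact: Ha.2].
have la := implicit_step_lip dt0 N0 lf lw small E.
have pa := implicit_step_periodic dt0 N0 lf lw small E pw.
have sF : small_field dt (K * (2 * N)) (f \o a).
  split=> //; last by move=> x; rewrite /= pa.
    by move=> x y; apply: le_trans (lf _ _) _; rewrite -mulrA ler_wpM2l.
  by rewrite (_ : _ * _ = 2 * (dt * (K * N))); [lra|ring].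
have L0 : 0 <= K * (2 * N) by rewrite !mulr_ge0.
have [_ df _] := Cf; have Cf' : CL m.+1 f^`() K by case: Cf.
have bf' := CL_bnd Cf'.
move/HBS: (Hw) => [bw dw Hw']; have bw' := Hw'.1.
have [den [da aE]] := implicit_step_derive dt0 N0 df bf' dw bw' small E.
have Hw1 : HB j (fun x => w^`() (X1 dt (f \o a) x)) (B * N).
  apply: HB_ sF L0 HF _; apply: HB_leq Hw'; lia.
have Hf1 : HB j (fun x => f^`() (a x)) D.
  by apply: HD; [apply: CL_leq Cf'; lia|exact: Ha.2].
have Hden : HB j (fun x => 1 + dt * (f^`() (a x) * w^`() (X1 dt (f \o a) x))) (1 + Q).
  apply: HB_mono; last exact: HBD (HB_cst j 1) (HBZ dt (HBM Hf1 Hw1)).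
  by rewrite normr1 lerD2l ger0_norm// ler_piMl.
have HS := HBM Hw1 (HI _ Hden den).
apply/HBS; split => //.
  move=> x; rewrite E; apply: le_trans (bw _) _.
  by rewrite lerDl !mulr_ge0 ?exprn_ge0.
by rewrite aE; apply: HB_mono HS; rewrite lerDr.
Qed.

End implicit_step.

(** * Uniform limits in C^(m,1) *)

Section uniform_limits.
Variable R : realType.
Implicit Types (f v : R -> R) (W : nat -> R -> R) (M : R) (m k n : nat).

Definition ucvg W v := forall e : R, 0 < e ->
  exists n0, forall n, (n0 <= n)%N -> forall x, `|W n x - v x| <= e.

(** An expansion with quadratic remainder passes to pointwise limits, contrary to
    the existence of a derivative; this is how limits are differentiated. *)
Lemma is_derive_quadratic v x l M :
  (forall h, `|v (x + h) - v x - h * l| <= M * h ^+ 2) -> is_derive x 1 v l.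
Proof.
move=> H.
have M0 : 0 <= M.
  by have := le_trans (normr_ge0 _) (H 1); rewrite expr1n mulr1.
suff cv : (fun h => h^-1 *: (v (h *: (1 : R) + x) - v x)) @ 0^' --> l.
  apply: DeriveDef; first by apply/cvg_ex; exists l.
  exact: cvg_lim cv.
apply/cvgrPdist_le => e e0.
have M1 : 0 < M + 1 by rewrite ltr_wpDl.
near=> h.
have h0 : h != 0 by near: h; exact: nbhs_dnbhs_neq.
have hn0 : 0 < `|h| by rewrite normr_gt0.
have hd : `|h| <= e / (M + 1).
  by near: h; apply: dnbhs0_le; rewrite divr_gt0.
rewrite -(ler_pM2l hn0) -normrM.
have -> : h * (l - h^-1 *: (v (h *: (1 : R) + x) - v x)) =
    - (v (x + h) - v x - h * l).
  rewrite /GRing.scale/= mulr1 (addrC h x) mulrBr mulrA divff// mul1r; ring.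
rewrite normrN; apply: le_trans (H h) _.
rewrite -[h ^+ 2]real_normK ?num_real// expr2 mulrA mulrC ler_wpM2l//.
apply: (@le_trans _ _ ((M + 1) * `|h|)).
  by rewrite ler_wpM2r// lerDl.
by rewrite mulrC -ler_pdivlMr.
Unshelve. all: by end_near. Qed.

Lemma lip_derive_quadratic f M x h : (forall y, derivable f y 1) ->
  lip M f^`() -> `|f (x + h) - f x - h * f^`() x| <= M * h ^+ 2.
Proof.
move=> df lf.
have M0 : 0 <= M.
  by have := le_trans (normr_ge0 _) (lf 1 0); rewrite subr0 normr1 mulr1.
have [c ch E] : exists2 c, `|c - x| <= `|h| & f (x + h) - f x = f^`() c * h.
  have [h0|h0] := leP 0 h.
    have [|c /andP[c1 c2] E] := @MVT_derive1 R f x (x + h) df; first by rewrite lerDl.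
    exists c; last by rewrite E; congr (_ * _); ring.
    by rewrite !ger0_norm//; lra.
  have [|c /andP[c1 c2] E] := @MVT_derive1 R f (x + h) x df; first lra.
  exists c; first by rewrite (ltr0_norm h0) ler0_norm//; lra.
  by rewrite -opprB E; ring.
rewrite E; have -> : f^`() c * h - h * f^`() x = h * (f^`() c - f^`() x) by ring.
rewrite normrM -[h ^+ 2]real_normK ?num_real// expr2.
apply: (@le_trans _ _ (`|h| * (M * `|c - x|))); first by rewrite ler_wpM2l.
by rewrite mulrCA ler_wpM2l// ler_wpM2l.
Qed.

(** Landau's interpolation inequality between the sup norms of a function and of
    its second derivative. *)
Lemma small_derivative f M e d : (forall y, derivable f y 1) ->
  lip M f^`() -> 0 < d -> bnd e f -> forall x, `|f^`() x| <= 2 * e / d + M * d.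
Proof.
move=> df lf d0 bf x.
rewrite -(ler_pM2r d0).
have -> : (2 * e / d + M * d) * d = 2 * e + M * d ^+ 2.
  by field; exact: lt0r_neq0.
have -> : `|f^`() x| * d = `|d * f^`() x| by rewrite normrM gtr0_norm// mulrC.
have := lip_derive_quadratic x d df lf.
have := bf x; have := bf (x + d).
rewrite !ler_norml; lra.
Qed.

(** By [small_derivative] the derivatives form a uniform Cauchy sequence, and
    their limit is the derivative of the limit by [is_derive_quadratic]. *)
Lemma CL_limit m : forall M W v, (forall n, CL m (W n) M) -> ucvg W v ->
  CL m v M /\ forall k, (k <= m)%N ->
    ucvg (fun n => derive1n k (W n)) (derive1n k v).
Proof.
have lim_bnd M W v : (forall n, bnd M (W n)) -> ucvg W v -> bnd M v.
  move=> bW Wv x; apply/ler_addgt0Pr => e e0.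
  have [n /(_ _ (leqnn n) x) h] := Wv e e0; have := bW n x; move: h.
  rewrite !ler_norml; lra.
elim: m => [|m IH] M W v CW Wv.
  split; last by case.
  split; first by apply: lim_bnd Wv => n; case: (CW n).
  move=> x y; apply/ler_addgt0Pr => e e0.
  have [|n /(_ _ (leqnn n)) h] := Wv (e / 2); first by rewrite divr_gt0.
  have [_ /(_ x y)] := CW n; have := h x; have := h y.
  rewrite !ler_norml; lra.
have bW n : bnd M (W n) by exact: CL_bnd (CW n).
have dW n : forall x, derivable (W n) x 1 by case: (CW n).
have CW' n : CL m (W n)^`() M by case: (CW n).
have M0 : 0 <= M := bnd_ge0 (bW 0%N).
have unif : forall e : R, 0 < e -> exists n0, forall n p, (n0 <= n)%N -> (n0 <= p)%N ->
    forall x, `|(W n)^`() x - (W p)^`() x| <= e.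
  move=> e e0.
  (* the increment [d] balances the two terms of [small_derivative] *)
  pose d := e / (4 * (M + 1)).
  have M1 : 0 < M + 1 by rewrite ltr_wpDl.
  have d0 : 0 < d by rewrite divr_gt0// mulr_gt0.
  have [|n0 Hn] := Wv (e * d / 8); first by rewrite divr_gt0// mulr_gt0.
  exists n0 => n p n0n n0p x.
  have [dB BE] := derive1B_fun (dW n) (dW p).
  have lB : lip (2 * M) (fun x => W n x - W p x)^`().
    rewrite BE => y z.
    have := CL_lip (CW' n) y z; have := CL_lip (CW' p) y z.
    rewrite !ler_norml -!mulrA; lra.
  have bB : bnd (e * d / 4) (fun x => W n x - W p x).
    move=> y; have := Hn n n0n y; have := Hn p n0p y.
    rewrite !ler_norml; lra.
  have := small_derivative dB lB d0 bB x; rewrite BE => /le_trans; apply.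
  have -> : 2 * (e * d / 4) / d = e / 2 by field; exact: lt0r_neq0.
  have : 2 * M * d <= e / 2.
    rewrite /d (_ : 2 * M * _ = (e / 2) * (M / (M + 1))); last first.
      by field; exact: lt0r_neq0.
    rewrite ler_piMr//; first by rewrite divr_ge0// ltW.
    by rewrite ler_pdivrMr// mul1r lerDl.
  lra.
have cW x : cvgn (fun n => (W n)^`() x).
  apply/cauchy_cvgP/cauchy_exP => e e0.
  have [|n0 Hn] := unif (e / 2); first by rewrite divr_gt0.
  exists ((W n0)^`() x); exists n0 => // n /= n0n; rewrite /ball/=.
  by apply: le_lt_trans (Hn _ _ (leqnn n0) n0n x) _; lra.
pose v1 x := limn (fun n => (W n)^`() x).
have W'v1 : ucvg (fun n => (W n)^`()) v1.
  move=> e e0; have [n0 Hn] := unif e e0; exists n0 => n n0n x.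
  have cv : (fun p => `|(W n)^`() x - (W p)^`() x|) @ \oo --> `|(W n)^`() x - v1 x|.
    by apply: cvg_norm; apply: cvgB; [exact: cvg_cst|exact: cW].
  rewrite -(cvg_lim _ cv)//; apply: limr_le; first by apply/cvg_ex; eexists; exact: cv.
  by exists n0 => // p n0p; exact: Hn.
have [Cv1 cvk] := IH M _ v1 CW' W'v1.
have dv (x : R) : is_derive x 1 v (v1 x).
  apply: (@is_derive_quadratic v x (v1 x) M) => h.
  apply/ler_addgt0Pr => e e0.
  have e1 : 0 < e / (2 + `|h|) by rewrite divr_gt0// ltr_wpDr.
  have [n1 H1] := Wv _ e1; have [n2 H2] := W'v1 _ e1.
  pose n := maxn n1 n2.
  have := lip_derive_quadratic x h (dW n) (CL_lip (CW' n)).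
  have := H1 n (leq_maxl _ _) x; have := H1 n (leq_maxl _ _) (x + h).
  have := ler_wpM2l (normr_ge0 h) (H2 n (leq_maxr _ _) x).
  rewrite -normrM => a1 a2 a3 a4.
  have -> : v (x + h) - v x - h * v1 x = (W n (x + h) - W n x - h * (W n)^`() x)
      - (W n (x + h) - v (x + h)) + (W n x - v x) + h * ((W n)^`() x - v1 x).
    by ring.
  apply: (le_trans (ler_normD _ _)); apply: (le_trans (lerD (ler_normD _ _) (lexx _))).
  apply: (le_trans (lerD (lerD (ler_normB _ _) (lexx _)) (lexx _))).
  apply: (le_trans (lerD (lerD (lerD a4 a2) a3) a1)).
  rewrite -!addrA lerD2l.
  rewrite (_ : _ + _ = e)//; field; apply: lt0r_neq0; rewrite ltr_wpDr//.
have [dv1 v1E] := is_derive_fun dv.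
split.
  split => //; first exact: lim_bnd Wv.
  by rewrite v1E.
case=> [//|k km].
have := cvk k km; rewrite -v1E => H e e0.
have [n0 Hn] := H e e0; exists n0 => n n0n x.
by rewrite !derive1Sn; exact: Hn.
Qed.

End uniform_limits.

(** * Integrals over intervals and primitives *)

Section interval_integrals.
Variable R : realType.
Notation mu := (@lebesgue_measure R).
Implicit Types (f g F G : R -> R) (a b c x : R).

Definition locint g := locally_integrable [set: R] g.

Definition itg a b g := \int[mu]_(x in [set` `[a, b]%R]) g x.

Definition antider F f := forall a b, a <= b -> F b - F a = itg a b f.

Lemma locint_itv g a b : locint g ->
  mu.-integrable [set` `[a, b]%R] (EFin \o g).
Proof.
move=> [mg _ lg]; apply/integrableP; split.
  by apply/measurable_EFinP; exact: measurable_funS mg.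
apply: lg => //; exact: segment_compact.
Qed.

Lemma locint_measurable g : locint g -> measurable_fun setT g.
Proof. by case. Qed.

Lemma locint_continuous g : continuous g -> locint g.
Proof.
move=> cg; split => //; first exact: continuous_measurable_fun.
  exact: openT.
move=> K _ cK.
have /integrableP[] : mu.-integrable K (EFin \o g).
  by apply: continuous_compact_integrable => //; exact: continuous_subspaceT.
by [].
Qed.

Lemma locint_le f g : measurable_fun setT f -> (forall x, `|f x| <= `|g x|) ->
  locint g -> locint f.
Proof.
move=> mf fg [mg _ lg]; split => //; first exact: openT.
move=> K KT cK; apply: le_lt_trans (lg K KT cK).
have mK : measurable K by exact: compact_measurable.
apply: ge0_le_integral => //.
- by apply/measurable_EFinP; apply: measurableT_comp => //; exact: measurable_funS mf.
- by apply/measurable_EFinP; apply: measurableT_comp => //; exact: measurable_funS mg.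
- by move=> x _; rewrite lee_fin.
Qed.

Lemma locintD f g : locint f -> locint g -> locint (fun x => f x + g x).
Proof. exact: locally_integrableD. Qed.

Lemma locintB f g : locint f -> locint g -> locint (fun x => f x - g x).
Proof. exact: locally_integrableB. Qed.

Lemma locint_norm f : locint f -> locint (fun x => `|f x|).
Proof.
move=> lf; apply: (locint_le _ _ lf); last by move=> x; rewrite normr_id.
by apply: measurableT_comp => //; case: lf.
Qed.

Lemma locintM_continuous f g : locint f -> continuous g ->
  locint (fun x => f x * g x).
Proof.
move=> lf cg; split; last 2 first.
- exact: openT.
- move=> K KT cK.
  have mK : measurable K by exact: compact_measurable.
  have [M [Mr HM]] := compact_bounded (continuous_compact (continuous_subspaceT cg) cK).
  pose B := `|M| + 1.
  have gB x : K x -> `|g x| <= B.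
    move=> Kx; apply: (HM B) => //=; last by exists x.
    by rewrite /B (le_lt_trans (ler_norm M))// ltrDl.
  case: (lf) => mf _ /(_ K KT cK) lfK.
  apply: (@le_lt_trans _ _ (\int[mu]_(x in K) (B%:E * `|f x|%:E))%E).
    apply: ge0_le_integral => //.
    + apply/measurable_EFinP; apply: measurableT_comp => //.
      apply: measurable_funM; first exact: measurable_funS mf.
      exact: measurable_funS (continuous_measurable_fun cg).
    + apply/measurable_EFinP; apply: measurable_funM => //.
      by apply: measurableT_comp => //; exact: measurable_funS mf.
    + by move=> x Kx; rewrite -EFinM lee_fin normrM mulrC ler_wpM2r// gB.
  rewrite ge0_integralZl//; last first.
  + by rewrite lee_fin addr_ge0.
  + apply/measurable_EFinP; apply: measurableT_comp => //.
    exact: measurable_funS mf.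
  by rewrite lte_mul_pinfty// lee_fin addr_ge0.
- by apply: measurable_funM; [case: lf|exact: continuous_measurable_fun].
Qed.

Lemma locint_cst c : locint (fun=> c).
Proof. exact: (locint_continuous (@cst_continuous _ _ c)). Qed.

Lemma locintZ c f : locint f -> locint (fun x => c * f x).
Proof.
move=> lf; under eq_fun do rewrite mulrC.
by apply: locintM_continuous => // x; exact: cvg_cst.
Qed.

Lemma itg_split a b c f : locint f -> a <= b -> b <= c ->
  itg a c f = itg a b f + itg b c f.
Proof.
move=> lf ab bc; rewrite /itg.
have H := @Rintegral_itvB R f (BLeft a) (BRight c) b (locint_itv a c lf).
rewrite -(@Rintegral_itv_obnd_cbnd R b (BRight c) f); last first.
  apply: integrableS (locint_itv b c lf) => //.
  by move=> x /=; rewrite !in_itv/= => /andP[/ltW -> ->].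
by rewrite -H ?bnd_simp// addrC subrK.
Qed.

Lemma itg_ge0 a b f : (forall x, 0 <= f x) -> 0 <= itg a b f.
Proof. by move=> f0; apply: Rintegral_ge0 => x _. Qed.

Lemma itgD a b f g : locint f -> locint g ->
  itg a b (fun x => f x + g x) = itg a b f + itg a b g.
Proof. by move=> lf lg; apply: RintegralD => //; exact: locint_itv. Qed.

Lemma itgB a b f g : locint f -> locint g ->
  itg a b (fun x => f x - g x) = itg a b f - itg a b g.
Proof. by move=> lf lg; apply: RintegralB => //; exact: locint_itv. Qed.

Lemma itgZ a b c f : locint f -> itg a b (fun x => c * f x) = c * itg a b f.
Proof. by move=> lf; apply: RintegralZl => //; exact: locint_itv. Qed.

Lemma itg_cst a b c : a <= b -> itg a b (fun=> c) = c * (b - a).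
Proof.
move=> ab; rewrite /itg Rintegral_cst//= lebesgue_measure_itv/= lte_fin.
by case: ltgtP ab => // ->; rewrite subrr.
Qed.

Lemma eq_itg a b f g : (forall x, a <= x <= b -> f x = g x) ->
  itg a b f = itg a b g.
Proof.
move=> fg; apply: eq_Rintegral => x; rewrite inE/= in_itv/=; exact: fg.
Qed.

Lemma le_itg a b f g : locint f -> locint g ->
  (forall x, a <= x <= b -> f x <= g x) -> itg a b f <= itg a b g.
Proof.
by move=> lf lg fg; apply: le_Rintegral => //; exact: locint_itv.
Qed.

Lemma ler_norm_itg a b f : locint f -> `|itg a b f| <= itg a b (fun x => `|f x|).
Proof. by move=> lf; apply: le_normr_Rintegral => //; exact: locint_itv. Qed.

Lemma itgxx a f : itg a a f = 0.
Proof. by rewrite /itg set_itv1 Rintegral_set1. Qed.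

Lemma itg_gt a b f : b < a -> itg a b f = 0.
Proof.
by move=> ba; rewrite /itg set_itv_ge ?Rintegral_set0// bnd_simp -ltNge.
Qed.

(** Signed primitive vanishing at the origin: for each sign of [x] one of the
    two integrals is over an empty interval. *)
Definition prim f x := itg 0 x f - itg x 0 f.

Lemma prim_antider f : locint f -> antider (prim f) f.
Proof.
move=> lf a b ab; rewrite /prim.
have [a0|a0] := leP 0 a.
  have b0 := le_trans a0 ab.
  rewrite (itg_split lf a0 ab).
  have -> : itg b 0 f = 0.
    by move: b0; rewrite le_eqVlt => /predU1P[<-|/itg_gt->//]; rewrite itgxx.
  have -> : itg a 0 f = 0.
    by move: a0; rewrite le_eqVlt => /predU1P[<-|/itg_gt->//]; rewrite itgxx.
  ring.
rewrite (itg_gt _ a0); have [b0|b0] := leP 0 b.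
  rewrite (itg_split lf (ltW a0) b0).
  have -> : itg b 0 f = 0.
    by move: b0; rewrite le_eqVlt => /predU1P[<-|/itg_gt->//]; rewrite itgxx.
  ring.
rewrite (itg_gt _ b0) (itg_split lf ab (ltW b0)); ring.
Qed.

Lemma antider_cst F G f : antider F f -> antider G f ->
  forall x, F x - F 0 = G x - G 0.
Proof.
move=> Ff Gf x; have [x0|/ltW x0] := leP 0 x.
  by rewrite Ff// Gf.
by rewrite -opprB Ff// -(Gf _ _ x0); ring.
Qed.

Lemma antider_is_derive F f : continuous f -> antider F f ->
  forall x : R, is_derive x 1 F (f x).
Proof.
move=> cf Ff x.
have lf := locint_continuous cf.
have [||] := @continuous_FTC1_closed R f (x - 1) x (x + 1) _ (locint_itv _ _ lf) _ (cf x).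
- by rewrite ltrDl.
- by rewrite ltrBlDr ltrDl.
set G := (X in derivable X _ _) => dG G'.
have dG1 : is_derive x 1 G (f x) by rewrite -G'; exact: derivable_is_derive.
have dF1 : is_derive x 1 (fun y => G y + F (x - 1)) (f x).
  have := is_deriveD dG1 (is_derive_cst (F (x - 1)) x 1); by rewrite addr0.
apply: near_eq_is_derive dF1.
near=> y; rewrite /G.
have xy : x - 1 <= y.
  near: y; apply: (cvgr_ge x); [exact: cvg_id|lra].
by have := Ff _ _ xy; rewrite /itg => <-; rewrite subrK.
Unshelve. all: by end_near. Qed.

Lemma is_derive_antider F f : continuous f ->
  (forall x : R, is_derive x 1 F (f x)) -> antider F f.
Proof.
move=> cf dF a b ab.
have lf := locint_continuous cf.
have [->|neq_ab] := eqVneq a b; first by rewrite subrr itgxx.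
have {}ab : a < b by rewrite lt_neqAle neq_ab.
have [dF1 FE] := is_derive_fun dF.
rewrite /itg /Rintegral (@continuous_FTC2 R f F a b ab) //.
- exact: continuous_subspaceT.
- split => //; last 2 first.
  + by apply: cvg_at_right_filter; exact: derivable_cont.
  + by apply: cvg_at_left_filter; exact: derivable_cont.
- by move=> x _; rewrite FE.
Qed.

(** Cut the interval into [n] pieces of equal length: the increments of [H] add
    up to O(1/n). *)
Lemma quadratic_increment_cst (H A : R -> R) C : 0 <= C ->
  (forall a b, a <= b -> `|H b - H a| <= C * (b - a) * (A b - A a)) ->
  forall a b, a <= b -> H a = H b.
Proof.
move=> C0 HA a b ab.
have cut n : (0 < n)%N -> `|H b - H a| <= C * ((b - a) / n%:R) * (A b - A a).
  move=> n0; have n0r : 0 < n%:R :> R by rewrite ltr0n.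
  pose t i := a + i%:R * ((b - a) / n%:R).
  have tn : t n = b by rewrite /t mulrCA divff ?lt0r_neq0// mulr1 addrC subrK.
  have part i : `|H (t i) - H a| <= C * ((b - a) / n%:R) * (A (t i) - A a).
    elim: i => [|i IH].
      by rewrite /t mul0r addr0 !subrr normr0 mulr0.
    have -> : H (t i.+1) - H a = (H (t i) - H a) + (H (t i.+1) - H (t i)) by ring.
    apply: (le_trans (ler_normD _ _)).
    have -> : A (t i.+1) - A a = (A (t i) - A a) + (A (t i.+1) - A (t i)) by ring.
    rewrite mulrDr; apply: lerD => //.
    have dt : t i.+1 - t i = (b - a) / n%:R by rewrite /t -natr1; ring.
    rewrite -{1}dt; apply: HA; rewrite -subr_ge0 dt.
    by rewrite divr_ge0 ?subr_ge0// ltW.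
  by have := part n; rewrite tn.
have [//|neq] := eqVneq (H a) (H b).
have d0 : 0 < `|H b - H a| by rewrite normr_gt0 subr_eq0 eq_sym.
pose K := C * (b - a) * (A b - A a).
have [n nK] : exists n : nat, K < n.+1%:R * `|H b - H a|.
  exists (Num.truncn `|K / `|H b - H a| |).
  rewrite -ltr_pdivrMr//; apply: le_lt_trans (truncnS_gt _); exact: ler_norm.
have := cut n.+1 isT.
rewrite (_ : C * _ * _ = K / n.+1%:R); last by rewrite /K; ring.
by rewrite ler_pdivlMr ?ltr0n// mulrC leNgt nK.
Qed.

(** Product rule in integrated form, where [G] is merely absolutely continuous:
    the difference of the two sides has increments bounded by the product of the
    length of the interval and the mass of [g] on it, and
    [quadratic_increment_cst] applies. *)
Lemma antiderM G g F f M : locint g -> antider G g -> continuous G ->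
  (forall x : R, is_derive x 1 F (f x)) -> continuous f -> bnd M f ->
  antider (fun x => G x * F x) (fun x => G x * f x + g x * F x).
Proof.
move=> lg Gg cG dF cf bf.
have M0 := bnd_ge0 bf.
have cF : continuous F.
  by apply: derivable_cont => x; case: (is_derive_derivable (dF x)).
have Ff := is_derive_antider cf dF.
have lf := locint_continuous cf.
have ln := locint_norm lg.
pose k x := G x * f x + g x * F x.
have lk : locint k.
  apply: locintD; last exact: locintM_continuous.
  apply: locint_continuous => x; apply: cvgM; [exact: cG|exact: cf].
pose H x := G x * F x - prim k x.
pose A := prim (fun x => `|g x|).
have Ag := prim_antider ln.
have lipF : lip M F.
  have [dF1 FE] := is_derive_fun dF; by apply: MVT_le => //; rewrite FE.
have inc a b x : a <= x -> x <= b -> `|G b - G x| <= A b - A a.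
  move=> ax xb; rewrite Gg//; apply: (le_trans (ler_norm_itg _ _ lg)).
  rewrite (Ag _ _ (le_trans ax xb)) (itg_split ln ax xb) lerDr.
  exact: itg_ge0.
suff Hc : forall a b, a <= b -> H a = H b.
  move=> a b ab; have := Hc a b ab; rewrite /H => E.
  by rewrite -(prim_antider lk ab); lra.
apply: (@quadratic_increment_cst H A (2 * M)); first by rewrite mulr_ge0.
move=> a b ab; rewrite /H.
have -> : G b * F b - prim k b - (G a * F a - prim k a) =
    G b * (F b - F a) + F a * (G b - G a) - (prim k b - prim k a) by ring.
rewrite (prim_antider lk ab) (Ff _ _ ab) (Gg _ _ ab) -!itgZ//.
have lGf : locint (fun x => G b * f x).
  by apply: locint_continuous => x; apply: cvgM; [exact: cvg_cst|exact: cf].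
have lFg : locint (fun x => F a * g x) by by exact: locintZ.
rewrite -itgD// -itgB//; last exact: locintD.
have lI : locint (fun x => G b * f x + F a * g x - k x).
  by apply: locintB => //; exact: locintD.
apply: (le_trans (ler_norm_itg _ _ lI)).
have -> : 2 * M * (b - a) * (A b - A a) =
   (M * (A b - A a)) * (b - a) + (M * (b - a)) * itg a b (fun x => `|g x|).
  by rewrite (Ag _ _ ab); ring.
have lg2 : locint (fun x => M * (b - a) * `|g x|) by by exact: locintZ.
have lc : locint (fun=> M * (A b - A a)).
  exact: locint_cst.
rewrite -itgZ// -itg_cst// -itgD//.
apply: le_itg => //; [exact: locint_norm|exact: locintD|].
move=> x /andP[ax xb].
have -> : G b * f x + F a * g x - k x = (G b - G x) * f x - (F x - F a) * g x.
  by rewrite /k; ring.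
apply: (le_trans (ler_normB _ _)); rewrite !normrM; apply: lerD.
  by rewrite mulrC ler_pM// inc.
rewrite ler_wpM2r//; apply: (le_trans (lipF _ _)).
by rewrite ler_wpM2l// ger0_norm ?subr_ge0// lerD2r.
Qed.

End interval_integrals.

(** * Smooth step functions *)

Section smooth_functions.
Variable R : realType.
Implicit Types (f g : R -> R) (k n : nat) (c d x : R).

Fixpoint ndiff k f := match k with
  | 0 => True
  | k'.+1 => (forall x, derivable f x 1) /\ ndiff k' f^`()
  end.

Definition smooth f := forall k, ndiff k f.

Lemma smooth_derivable f : smooth f ->
  forall k x, derivable (derive1n k f) x 1.
Proof.
move=> sf k; move: f sf; elim: k => [|k IH] f sf x; first by case: (sf 1%N).
rewrite derive1Sn; apply: IH => j; by case: (sf j.+1).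
Qed.

Lemma ndiff_S k : forall f, ndiff k.+1 f -> ndiff k f.
Proof. by elim: k => [//|k IH] f [df dkf]; split => //; exact: IH. Qed.

Lemma ndiffD k : forall f g, ndiff k f -> ndiff k g -> ndiff k (fun x => f x + g x).
Proof.
elim: k => [//|k IH] f g [df Df] [dg Dg].
by have [dfg E] := derive1D_fun df dg; rewrite /= E; split => //; exact: IH.
Qed.

Lemma ndiffZ k : forall c f, ndiff k f -> ndiff k (fun x => c * f x).
Proof.
elim: k => [//|k IH] c f [df Df].
by have [dfg E] := derive1Z_fun c df; rewrite /= E; split => //; exact: IH.
Qed.

Lemma ndiffM k : forall f g, ndiff k f -> ndiff k g -> ndiff k (fun x => f x * g x).
Proof.
elim: k => [//|k IH] f g df dg; have df1 := ndiff_S df; have dg1 := ndiff_S dg.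
case: df dg => [df Df] [dg Dg].
have [dfg E] := derive1M_fun df dg; rewrite /= E; split => //.
by apply: ndiffD; exact: IH.
Qed.

Lemma derivable_affine c d x : derivable (fun x => c * x + d) x 1.
Proof.
apply: derivableD; last exact: derivable_cst.
by have [H _] := derive1Z_fun c (fun x => @derivable_id R _ x 1); exact: H.
Qed.

Lemma derive1_affine c d : (fun x => c * x + d)^`() = (fun=> c).
Proof.
have [dZ ZE] := derive1Z_fun c (fun x => @derivable_id R R^o x 1).
have [_ ->] := derive1D_fun dZ (fun x => @derivable_cst R R^o _ d x 1).
apply/funext => x; rewrite ZE derive1_cst derive1_id; ring.
Qed.

Lemma ndiff_affine k : forall c d f, ndiff k f -> ndiff k (fun x => f (c * x + d)).
Proof.
elim: k => [//|k IH] c d f [df Df].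
have [dfa E] := derive1_comp_fun df (@derivable_affine c d).
rewrite /= E; split => //.
rewrite derive1_affine; under eq_fun do rewrite mulrC.
by apply: ndiffZ; exact: IH.
Qed.

(** The family x^(-n) exp(-1/x) is stable under differentiation up to linear
    combinations, which gives smoothness of all its members at once. *)
Definition flat n x : R := if 0 < x then x^-1 ^+ n * expR (- x^-1) else 0.

Lemma flat_le n x : `|flat n x| <= n.+2`!%:R * x ^+ 2.
Proof.
rewrite /flat; case: ifPn => [x0|_]; last first.
  by rewrite normr0 mulr_ge0// ?ler0n// sqr_ge0.
have y0 : 0 < x^-1 by rewrite invr_gt0.
rewrite ger0_norm; last by rewrite mulr_ge0 ?expR_ge0// exprn_ge0// ltW.
rewrite expRN ler_pdivrMr ?expR_gt0//.
have := expR_ge1Dxn n.+1 (ltW y0).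
set e := expR _; set F := _%:R => h.
have F0 : 0 < F by rewrite ltr0n fact_gt0.
have h2 : x^-1 ^+ n.+2 <= F * e.
  rewrite mulrC -ler_pdivrMr//; apply: le_trans h.
  by rewrite lerDr.
have -> : x^-1 ^+ n = x ^+ 2 * x^-1 ^+ n.+2.
  by rewrite -[n.+2]addn2 exprD mulrCA -exprMn divff ?expr1n ?mulr1// lt0r_neq0.
have -> : F * x ^+ 2 * e = x ^+ 2 * (F * e) by ring.
by rewrite ler_wpM2l// sqr_ge0.
Qed.

Lemma is_derive_flat n x :
  is_derive x 1 (flat n) (flat n.+2 x - n%:R * flat n.+1 x).
Proof.
case: (ltrgt0P x) => x0.
- pose h (y : R) : R := y^-1 ^+ n * expR (- y^-1).
  have hE : \forall y \near x, h y = flat n y.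
    near=> y; rewrite /flat ifT//; near: y.
    exact: (cvgr_gt x).
  apply: near_eq_is_derive hE _.
  pose P (y : R) : R := y ^+ n * expR (- y).
  have dP (y : R) : is_derive y 1 P (n%:R * y ^+ n.-1 * expR (- y) - y ^+ n * expR (- y)).
    have d1 : is_derive y 1 (fun y : R => y ^+ n) (n%:R * y ^+ n.-1).
      apply: DeriveDef; first exact: exprn_derivable.
      by rewrite exp_derive; exact: mulr1.
    have d2 : is_derive y 1 (fun y : R => expR (- y)) (- expR (- y)).
      have := @is_derive1_comp R expR -%R y _ _ (is_derive_expR (- y)) (is_deriveN (is_derive_id y 1)).
      by move/is_derive_eq; apply; rewrite mulrN1.
    have := is_deriveM d1 d2; move/is_derive_eq; apply.
    by rewrite /GRing.scale/=; ring.
  have xn0 : x != 0 by exact: lt0r_neq0.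
  have dV := @is_deriveV R id x 1 1 xn0 (is_derive_id x 1).
  have := @is_derive1_comp R P (fun y => y^-1) x _ _ (dP x^-1) dV.
  move/is_derive_eq; apply.
  rewrite /flat x0 /GRing.scale/= mulr1 -exprVn.
  case: n {h P dP dV} => [|n]; first by rewrite mul0r !expr0; ring.
  by rewrite /= !exprS; ring.
- have hE : \forall y \near x, 0 = flat n y.
    near=> y; rewrite /flat ifF//; apply/negbTE; rewrite -leNgt.
    by near: y; apply: (cvgr_le x).
  rewrite {2 3}/flat (lt_gtF x0) mulr0 subr0.
  by apply: near_eq_is_derive hE _; exact: is_derive_cst.
- rewrite x0 {2 3}/flat ltxx mulr0 subr0.
  apply: (@is_derive_quadratic _ _ _ _ n.+2`!%:R) => h.
  rewrite add0r mulr0 subr0 {2}/flat ltxx subr0; exact: flat_le.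
Unshelve. all: by end_near. Qed.

Lemma smooth_flat n : smooth (flat n).
Proof.
move=> k; elim: k n => [//|k IH] n.
have [d E] := is_derive_fun (is_derive_flat n); rewrite /= E; split => //.
under eq_fun do rewrite -mulNr.
by apply: ndiffD => //; exact: ndiffZ.
Qed.

Lemma flat_ge0 n x : 0 <= flat n x.
Proof.
rewrite /flat; case: ifPn => // x0.
by rewrite mulr_ge0 ?expR_ge0// exprn_ge0// invr_ge0 ltW.
Qed.

Lemma smooth_continuous f : smooth f -> continuous f.
Proof. by move=> sf; apply: derivable_cont; case: (sf 1%N). Qed.

Lemma smooth_primitive f : smooth f ->
  exists F, [/\ smooth F, forall x : R, is_derive x 1 F (f x) & F 0 = 0].
Proof.
move=> sf; have cf := smooth_continuous sf.
have aF := prim_antider (locint_continuous cf).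
have dF := antider_is_derive cf aF.
have [dF1 FE] := is_derive_fun dF.
exists (prim f); split => //; last by rewrite /prim !itgxx subrr.
by case=> [//|k]; rewrite /= FE; split.
Qed.

(** The normalised primitive of a bump supported in the unit interval. *)
Lemma smooth_step : exists S : R -> R, [/\ smooth S,
  forall x, x <= 0 -> S x = 0, forall x, 1 <= x -> S x = 1 &
  forall x, 0 <= S x <= 1].
Proof.
pose rho x := flat 0 x * flat 0 (-1 * x + 1).
have srho : smooth rho.
  by move=> k; apply: ndiffM; [|apply: ndiff_affine]; exact: smooth_flat.
have rho_ge0 x : 0 <= rho x by rewrite mulr_ge0 ?flat_ge0.
have rho0 x : x <= 0 -> rho x = 0.
  by move=> x0; rewrite /rho {1}/flat ltNge x0 mul0r.
have rho1 x : 1 <= x -> rho x = 0.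
  move=> x1; rewrite /rho {2}/flat ifF ?mulr0//; apply/negbTE; rewrite -leNgt; lra.
have [F [sF dF F0]] := smooth_primitive srho.
have aF := is_derive_antider (smooth_continuous srho) dF.
have lrho := locint_continuous (smooth_continuous srho).
have Fnd a b : a <= b -> F a <= F b.
  by move=> ab; rewrite -subr_ge0 aF// itg_ge0.
have cst0 a b : a <= b -> (forall x, a <= x <= b -> rho x = 0) -> F b = F a.
  move=> ab H; apply/eqP; rewrite -subr_eq0 aF//.
  by rewrite (@eq_itg _ _ _ _ (fun=> 0)) // itg_cst// mul0r.
have Fpos : 0 < F 1.
  rewrite lt_neqAle -{2}F0 Fnd// andbT; apply/eqP => F1.
  have rhalf : 0 < rho (2^-1).
    have fl (y : R) : 0 < y -> 0 < flat 0 y.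
      by move=> y0; rewrite /flat y0 expr0 mul1r expR_gt0.
    rewrite /rho mulr_gt0 ?fl//; lra.
  have h0 : derivable F 2^-1 1 /\ F^`() 2^-1 = 0.
    apply: is_derive_derivable.
    have hE : \forall y \near (2^-1 : R), 0 = F y.
      near=> y.
      have y0 : 0 <= y by near: y; apply: (cvgr_ge 2^-1); [exact: cvg_id|lra].
      have y1 : y <= 1 by near: y; apply: (cvgr_le 2^-1); [exact: cvg_id|lra].
      have := Fnd _ _ y0; have := Fnd _ _ y1; rewrite F0 -F1 => ? ?.
      by apply/eqP; rewrite eq_le; apply/andP.
    by apply: near_eq_is_derive hE _; exact: is_derive_cst.
  have [_ E] := is_derive_derivable (dF 2^-1).
  by move: rhalf; rewrite -E h0.2 ltxx.
exists (fun x => (F 1)^-1 * F x).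
have Fle0 x : x <= 0 -> F x = 0.
  move=> x0; rewrite -F0; apply/esym/cst0 => // y /andP[_ y0]; exact: rho0.
have Fge1 x : 1 <= x -> F x = F 1.
  by move=> x1; apply: cst0 => // y /andP[y1 _]; exact: rho1.
split.
- by move=> k; apply: ndiffZ.
- by move=> x x0; rewrite (Fle0 x)// mulr0.
- by move=> x x1; rewrite (Fge1 x)// mulVf// lt0r_neq0.
- move=> x; rewrite mulrC divr_ge0 ?ler_pdivrMr ?mul1r//=; last 2 first.
  + have [x0|/ltW x0] := leP 0 x; last by rewrite (Fle0 x).
    by rewrite -F0 Fnd.
  + exact: ltW.
  have [x1|/ltW x1] := leP x 1; last by rewrite (Fge1 x).
  exact: Fnd.
Unshelve. all: by end_near. Qed.

End smooth_functions.

(** * Integration by parts against test functions *)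

Section test_functions.
Variable R : realType.
Notation mu := (@lebesgue_measure R).
Implicit Types (f g v phi p Q F G : R -> R) (a b c d x N : R) (k n : nat).

Definition supp phi N := forall x, N <= `|x| -> phi x = 0.

Lemma derivable_smooth f : (forall k x, derivable (derive1n k f) x 1) -> smooth f.
Proof.
move=> df k; elim: k f df => [//|k IH] f df; split; first exact: (df 0%N).
by apply: IH => j x; rewrite -derive1Sn; exact: df.
Qed.

Lemma smooth_derive1 f : smooth f -> smooth f^`().
Proof. by move=> sf k; case: (sf k.+1). Qed.

Lemma supp_derive1 phi N : supp phi N -> supp phi^`() (N + 1).
Proof.
move=> sp x Nx.
suff [_ //] : derivable phi x 1 /\ phi^`() x = 0.
apply: is_derive_derivable.
have hE : \forall y \near x, 0 = phi y.
  near=> y; rewrite sp//.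
  have : `|x - y| <= 1 by near: y; exact: cvgr_dist_le ltr01.
  have := ler_distD y x 0; rewrite !subr0; lra.
by apply: near_eq_is_derive hE _; exact: is_derive_cst.
Unshelve. all: by end_near. Qed.

Lemma test_functionP phi : test_function [set: R] phi <->
  smooth phi /\ exists N, supp phi N.
Proof.
split=> [[dphi [K [cK _ phiK]]]|[sphi [N sN]]].
  split; first exact: derivable_smooth.
  have [M [Mr HM]] := compact_bounded cK.
  exists (`|M| + 2) => x Mx; apply: phiK => Kx.
  have := HM (`|M| + 1); rewrite (le_lt_trans (ler_norm M)) ?ltrDl// => /(_ isT x Kx) /=.
  lra.
split; first exact: smooth_derivable.
exists [set` `[- N, N]%R]; split => //; first exact: segment_compact.
move=> x Nx; apply: sN; rewrite leNgt; apply/negP => xN; apply: Nx => /=.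
by move: xN; rewrite in_itv/= ltr_norml => /andP[/ltW -> /ltW ->].
Qed.

Lemma supp_bnd phi N : continuous phi -> supp phi N -> exists M, bnd M phi.
Proof.
move=> cphi sphi.
have [M [Mr HM]] := compact_bounded (continuous_compact (continuous_subspaceT cphi)
  (@segment_compact R (- N) N)).
exists (`|M| + 1) => x.
have [Nx|xN] := leP N `|x|; first by rewrite (sphi x Nx) normr0 addr_ge0.
apply: (HM (`|M| + 1)); first by rewrite (le_lt_trans (ler_norm M))// ltrDl.
exists x => //=.
by move: xN; rewrite in_itv/= ltr_norml => /andP[/ltW -> /ltW ->].
Qed.

Lemma Rintegral_supp f phi N : supp phi N ->
  \int[mu]_x (f x * phi x) = itg (- N) N (fun x => f x * phi x).
Proof.
move=> sphi; rewrite /itg [RHS]Rintegral_mkcond.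
apply: eq_Rintegral => x _; rewrite patchE; case: ifPn => // /negP xN.
rewrite sphi ?mulr0// leNgt; apply/negP => Nx; apply: xN; rewrite inE/= in_itv/=.
by move: Nx; rewrite ltr_norml => /andP[/ltW -> /ltW ->].
Qed.

Lemma supp_widen phi N N' : N <= N' -> supp phi N -> supp phi N'.
Proof. by move=> NN' sp x N'x; apply: sp; exact: le_trans N'x. Qed.

Lemma parts_test G g phi N : locint g -> antider G g -> continuous G ->
  smooth phi -> supp phi N ->
  \int[mu]_x (G x * phi^`() x) = - \int[mu]_x (g x * phi x).
Proof.
move=> lg Gg cG sphi sN.
pose L := `|N| + 1.
have sL : supp phi L.
  by apply: supp_widen sN; rewrite /L; have := ler_norm N; lra.
have sL' : supp phi^`() L.
  by apply: supp_widen (supp_derive1 sN); rewrite /L lerD2r ler_norm.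
have sphi' := smooth_derive1 sphi.
have cphi := smooth_continuous sphi; have cphi' := smooth_continuous sphi'.
have [M bM] := supp_bnd cphi' sL'.
have dphi (x : R) : is_derive x 1 phi (phi^`() x).
  by apply: derivable_is_derive; case: (sphi 1%N).
rewrite (Rintegral_supp _ sL) (Rintegral_supp _ sL').
have L0 : - L <= L by rewrite /L; have := normr_ge0 N; lra.
have := antiderM lg Gg cG dphi cphi' bM L0.
rewrite itgD; last 2 first.
- by apply: locintM_continuous => //; exact: locint_continuous.
- exact: locintM_continuous.
rewrite (sL L) ?ler_norm// (sL (- L)) ?normrN ?ler_norm// !mulr0 subrr => /eqP.
by rewrite eq_sym addr_eq0 => /eqP.
Qed.

Lemma prim_continuous g : locint g -> continuous (prim g).
Proof.
move=> lg x.
have xx : x - 1 <= x + 1 by lra.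
have h := @parameterized_integral_continuous R (x - 1) (x + 1) g xx (locint_itv _ _ lg).
have cx : {for x, continuous (fun y => itg (x - 1) y g)}.
  apply: (@within_continuous_continuous R R R (x - 1) (x + 1) _ x _ h).
    by lra.
  by rewrite in_itv/=; lra.
have : {for x, continuous (fun y => itg (x - 1) y g + prim g (x - 1))}.
  by apply: cvgD; [exact: cx|exact: cvg_cst].
move=> cc; rewrite /prop_for /continuous_at.
have E : \forall y \near x, itg (x - 1) y g + prim g (x - 1) = prim g y.
  near=> y.
  have xy : x - 1 <= y by near: y; apply: (cvgr_ge x); [exact: cvg_id|lra].
  by rewrite -(prim_antider lg xy) subrK.
have <- : itg (x - 1) x g + prim g (x - 1) = prim g x.
  by rewrite -(prim_antider lg) ?subrK//; lra.
apply: cvg_trans cc; exact: near_eq_cvg.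
Unshelve. all: by end_near. Qed.

Lemma antider_continuous G g : locint g -> antider G g -> continuous G.
Proof.
move=> lg Gg.
have -> : G = (fun x => prim g x + (G 0 - prim g 0)).
  apply/funext => x; have := antider_cst Gg (prim_antider lg) x; lra.
move=> x; apply: cvgD; [exact: prim_continuous|exact: cvg_cst].
Qed.

(** Smoothed indicator functions of half lines converge boundedly. *)
Lemma itg_step_limit S Q L U a : (forall x, x <= 0 -> S x = 0) ->
  (forall x, 1 <= x -> S x = 1) -> (forall x, 0 <= S x <= 1) -> smooth S ->
  locint Q -> L <= a -> a <= U ->
  itg L U (fun x => Q x * S (n.+1%:R * (x - a))) @[n --> \oo] --> itg a U Q.
Proof.
move=> S0 S1 S01 sS lQ La aU.
have cS := smooth_continuous sS.
pose fn n x := (Q x * S (n.+1%:R * (x - a)))%:E.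
pose g x := (Q x * \1_(`]a, U]%classic) x)%:E.
have mQ : measurable_fun [set` `[L, U]%R] Q.
  by apply: measurable_funS (locint_measurable lQ).
have cSn n : continuous (fun x => S (n.+1%:R * (x - a))).
  move=> x; apply: continuous_comp; last exact: cS.
  apply: cvgM; first exact: cvg_cst.
  by apply: cvgB; [exact: cvg_id|exact: cvg_cst].
have [|||||ig _ H] := @dominated_convergence _ _ R mu [set` `[L, U]%R]
    (measurable_itv _) fn g (fun x => `|Q x|%:E).
- move=> n; apply/measurable_EFinP; apply: measurable_funM => //.
  apply: measurable_funS (continuous_measurable_fun (cSn n)) => //.
- apply/measurable_EFinP; apply: measurable_funM => //.
- apply: aeW => x; rewrite /= in_itv/= => /andP[Lx xU].
  apply/cvg_EFin; first by apply: nearW => n.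
  rewrite /g /fn /= /comp /=.
  apply: cvgM; first exact: cvg_cst.
  rewrite indicE; have [xa|ax] := leP x a.
    rewrite memNset; last by rewrite /= in_itv/= ltNge xa.
    apply: cvg_near_cst; apply: nearW => n; apply: S0.
    by rewrite mulr_ge0_le0 ?ler0n// subr_le0.
  rewrite mem_set; last by rewrite /= in_itv/= ax.
  apply: cvg_near_cst.
  exists (Num.truncn (x - a)^-1) => // n /= nx; apply: S1.
  have xa0 : 0 < x - a by rewrite subr_gt0.
  rewrite -ler_pdivrMr// mul1r; apply: ltW; apply: lt_le_trans (truncnS_gt _) _.
  by rewrite ler_nat ltnS.
- by have := integrable_norm (locint_itv L U lQ).
- apply: aeW => x n _; rewrite /fn /= lee_fin normrM ler_piMr//.
  by have /andP[? ?] := S01 (n.+1%:R * (x - a)); rewrite ger0_norm.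
have -> : itg a U Q = fine (\int[mu]_(x in [set` `[L, U]%R]) g x)%E.
  rewrite /itg; rewrite -(@Rintegral_itv_obnd_cbnd R a (BRight U) Q); last first.
    apply: integrableS (locint_itv a U lQ) => //.
    by move=> x /=; rewrite !in_itv/= => /andP[/ltW -> ->].
  rewrite /Rintegral; congr fine.
  rewrite integral_mkcond [RHS]integral_mkcond; apply: eq_integral => x _.
  rewrite !patchE /g indicE.
  have [xaU|xaU] := boolP (x \in [set` `]a, U]%R]).
    rewrite ifT ?mulr1//; move: xaU; rewrite !inE/= !in_itv/= => /andP[ax ->].
    by rewrite (le_trans La (ltW ax)).
  by rewrite mulr0; case: ifP.
apply: fine_cvg; rewrite fineK; first exact: H.
by apply: integrable_fin_num => //; exact: ig.
Unshelve. all: by end_near. Qed.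

(** The lemma of du Bois-Reymond.  The test functions are smoothed trapezoids,
    whose derivatives approximate the difference of two normalised indicator
    functions. *)
Lemma weakly_constant_mean Q : locint Q ->
  (forall phi N, smooth phi -> supp phi N -> \int[mu]_x (Q x * phi^`() x) = 0) ->
  forall a b c d, a < b -> c < d ->
    itg a b Q / (b - a) = itg c d Q / (d - c).
Proof.
move=> lQ H a b c d ab cd.
have [S [sS S0 S1 S01]] := smooth_step R.
have [T [sT dT T0]] := smooth_primitive sS.
have aT := is_derive_antider (smooth_continuous sS) dT.
have Tle0 x : x <= 0 -> T x = 0.
  move=> x0; have := aT _ _ x0; rewrite T0 sub0r (@eq_itg _ _ _ _ (fun=> 0)).
    by rewrite itg_cst// mul0r => /eqP; rewrite oppr_eq0 => /eqP.
  by move=> y /andP[_ y0]; exact: S0.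
have Tge1 x : 1 <= x -> T x = T 1 + (x - 1).
  move=> x1; have := aT _ _ x1; rewrite (@eq_itg _ _ _ _ (fun=> 1)).
    by rewrite itg_cst// mul1r; lra.
  by move=> y /andP[y1 _]; exact: S1.
pose L := Num.min a c; pose U := Num.max b d + 1.
have La : L <= a by rewrite ge_min lexx.
have Lc : L <= c by rewrite ge_min lexx orbT.
have bU : b + 1 <= U by rewrite lerD2r le_max lexx.
have dU : d + 1 <= U by rewrite lerD2r le_max lexx orbT.
pose r n e x := n.+1%:R^-1 * T (n.+1%:R * (x - e)).
have dr n e (x : R) : is_derive x 1 (r n e) (S (n.+1%:R * (x - e))).
  have E : (fun x : R => n.+1%:R * (x - e)) = (fun x => n.+1%:R * x + (- (n.+1%:R * e))).
    by apply/funext => y; ring.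
  have dI : is_derive x 1 (fun x : R => n.+1%:R * (x - e)) n.+1%:R.
    rewrite E; have := derivable_is_derive (@derivable_affine R n.+1%:R (- (n.+1%:R * e)) x).
    by rewrite derive1_affine.
  have := is_deriveZ n.+1%:R^-1 (@is_derive1_comp R T _ x _ _ (dT (n.+1%:R * (x - e))) dI).
  by move/is_derive_eq; apply; rewrite /GRing.scale/= mulrCA mulVf ?mulr1// pnatr_eq0.
have sr n e : smooth (r n e).
  move=> k; apply: ndiffZ.
  have -> : (fun x => T (n.+1%:R * (x - e))) = (fun x => T (n.+1%:R * x + (- (n.+1%:R * e)))).
    by apply/funext => y; congr T; ring.
  by apply: ndiff_affine.
pose phi n x := (b - a)^-1 * r n a x + (- (b - a)^-1) * r n b x +
  ((- (d - c)^-1) * r n c x + (d - c)^-1 * r n d x).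
have sphi n : smooth (phi n).
  by move=> k; apply: ndiffD; apply: ndiffD; apply: ndiffZ; exact: sr.
have dphi n (x : R) : is_derive x 1 (phi n) ((b - a)^-1 * S (n.+1%:R * (x - a)) +
   (- (b - a)^-1) * S (n.+1%:R * (x - b)) + ((- (d - c)^-1) * S (n.+1%:R * (x - c)) +
   (d - c)^-1 * S (n.+1%:R * (x - d)))).
  have dZ (k e : R) : is_derive x 1 (fun x => k * r n e x) (k * S (n.+1%:R * (x - e))).
    exact: (is_deriveZ k (dr n e x)).
  exact: (is_deriveD (is_deriveD (dZ _ a) (dZ _ b)) (is_deriveD (dZ _ c) (dZ _ d))).
have phiE n := (is_derive_fun (dphi n)).2.
have n0 n : 0 < n.+1%:R :> R by rewrite ltr0n.
have n1 n : 1 <= n.+1%:R :> R by rewrite ler1n.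
have r0 n e x : x <= e -> r n e x = 0.
  move=> xe; rewrite /r Tle0 ?mulr0// mulr_ge0_le0 ?subr_le0// ltW//.
have r1 n e x : e + 1 <= x -> r n e x = n.+1%:R^-1 * (T 1 - 1) + (x - e).
  move=> xe; rewrite /r Tge1.
    by field; rewrite lt0r_neq0.
  have xe1 : 1 <= x - e by lra.
  apply: (le_trans xe1); rewrite ler_peMl//; exact: le_trans xe1.
have phi0 n x : x <= L \/ U <= x -> phi n x = 0.
  case=> [xL|Ux]; rewrite /phi.
    rewrite !r0 ?mulr0 ?addr0//.
    - by apply: le_trans xL _; lra.
    - by apply: le_trans xL _; lra.
    - by apply: le_trans xL _; lra.
    - by apply: le_trans xL _; lra.
  rewrite !r1; try (apply: le_trans Ux; lra).
  field; rewrite !subr_eq0 !gt_eqF//.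
have sN n : supp (phi n) (Num.max `|L| `|U|).
  move=> x; rewrite ge_max => /andP[Lx Ux]; apply: phi0.
  have [x0|x0] := leP 0 x.
    right; move: Ux; rewrite (ger0_norm x0); apply: le_trans; exact: ler_norm.
  left; move: Lx; rewrite (ltr0_norm x0); have := ler_norm (- L); rewrite normrN; lra.
pose I e n := itg L U (fun x => Q x * S (n.+1%:R * (x - e))).
have cSn n e : continuous (fun x => S (n.+1%:R * (x - e))).
  move=> x; apply: continuous_comp; last exact: smooth_continuous.
  apply: cvgM; first exact: cvg_cst.
  by apply: cvgB; [exact: cvg_id|exact: cvg_cst].
have lQS n e : locint (fun x => Q x * S (n.+1%:R * (x - e))).
  exact: locintM_continuous.
have key n : ((b - a)^-1 * I a n + (- (b - a)^-1) * I b n) +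
   ((- (d - c)^-1) * I c n + (d - c)^-1 * I d n) = 0.
  have lZ (e k : R) : locint (fun x => k * (Q x * S (n.+1%:R * (x - e)))) by exact: locintZ.
  rewrite /I -!itgZ// -!itgD//; try by apply: locintD.
  rewrite -[RHS](H _ _ (sphi n) (sN n)) phiE /itg Rintegral_mkcond.
  apply: eq_Rintegral => x _; rewrite patchE.
  case: ifPn => [_|/negP xLU]; first by ring.
  have mono e1 : 1 <= e1 -> 1 <= n.+1%:R * e1 :> R.
    by move=> h; apply: (le_trans h); rewrite ler_peMl//; exact: le_trans h.
  have [xL|Lx] := leP x L.
    have nx e : L <= e -> n.+1%:R * (x - e) <= 0.
      by move=> Le; rewrite mulr_ge0_le0 ?ler0n// subr_le0 (le_trans xL).
    have Lb : L <= b by exact: le_trans (ltW ab).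
    have Ld : L <= d by exact: le_trans (ltW cd).
    by rewrite !(S0 _ (nx _ _)) // !(mulr0, addr0).
  have xU : U < x.
    by rewrite ltNge; apply/negP => xU; apply: xLU; rewrite inE/= in_itv/= ltW.
  by rewrite !S1 ?mulr1 ?subrr ?addNr ?addr0 ?mulr0//; apply: mono; lra.
have lim e : L <= e -> e <= U -> I e n @[n --> \oo] --> itg e U Q.
  by move=> Le eU; exact: itg_step_limit.
have aU : a <= U by apply: le_trans bU; lra.
have cU : c <= U by apply: le_trans dU; lra.
have bU' : b <= U by apply: le_trans bU; lra.
have dU' : d <= U by apply: le_trans dU; lra.
have Lb : L <= b by apply: le_trans La _; exact: ltW.
have Ld : L <= d by apply: le_trans Lc _; exact: ltW.
have limZ (k e : R) : L <= e -> e <= U -> k * I e n @[n --> \oo] --> k * itg e U Q.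
  by move=> Le eU; apply: cvgM; [exact: cvg_cst|exact: lim].
have lim0 := cvgD (cvgD (limZ (b - a)^-1 a La aU) (limZ (- (b - a)^-1) b Lb bU'))
  (cvgD (limZ (- (d - c)^-1) c Lc cU) (limZ (d - c)^-1 d Ld dU')).
have E : 0 = (b - a)^-1 * itg a U Q + (- (b - a)^-1) * itg b U Q +
  ((- (d - c)^-1) * itg c U Q + (d - c)^-1 * itg d U Q).
  have E0 : (fun=> 0 : R) @ \oo --> (b - a)^-1 * itg a U Q + (- (b - a)^-1) * itg b U Q +
      ((- (d - c)^-1) * itg c U Q + (d - c)^-1 * itg d U Q).
    move: lim0; set h := (X in X @ _); have -> : h = (fun=> 0 : R) by exact: (funext key).
    by move=> H0; exact: H0.
  by rewrite -(cvg_lim _ E0)// lim_cst.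
move: E; rewrite (itg_split lQ (ltW ab) bU') (itg_split lQ (ltW cd) dU').
rewrite [itg a b Q / _]mulrC [itg c d Q / _]mulrC; lra.
Unshelve. all: by end_near. Qed.

End test_functions.

(** * Weak derivatives and classical derivatives *)

Section weak_derivatives.
Variable R : realType.
Notation mu := (@lebesgue_measure R).
Implicit Types (f g v w phi p Q F G : R -> R) (a b c d x N M : R) (j k m n : nat).

Lemma ae_mono (P S : R -> Prop) : (forall x, P x -> S x) ->
  {ae mu, forall x, P x} -> {ae mu, forall x, S x}.
Proof.
move=> PS; apply: filterS; first exact: (ae_filter_ringOfSetsType mu).
exact: PS.
Qed.

Lemma antider_eq_itg F f g : (forall a b, a <= b -> itg a b f = itg a b g) ->
  antider F f -> antider F g.
Proof. by move=> fg Ff a b ab; rewrite -fg// Ff. Qed.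

Lemma itg_eq_continuous f g : continuous f -> continuous g ->
  (forall a b, a <= b -> itg a b f = itg a b g) -> f = g.
Proof.
move=> cf cg fg; apply/funext => x.
have af := prim_antider (locint_continuous cf).
have [_ <-] := is_derive_derivable (antider_is_derive cf af x).
by have [_ <-] := is_derive_derivable (antider_is_derive cg (antider_eq_itg fg af) x).
Qed.

Lemma weakly_constant Q : locint Q ->
  (forall phi N, smooth phi -> supp phi N -> \int[mu]_x (Q x * phi^`() x) = 0) ->
  exists c, forall a b, a <= b -> itg a b Q = itg a b (fun=> c).
Proof.
move=> lQ H; exists (itg 0 1 Q) => a b.
rewrite le_eqVlt => /predU1P[->|ab]; first by rewrite !itgxx.
rewrite itg_cst; last exact: ltW.
have := weakly_constant_mean lQ H ab ltr01.
rewrite subr0 divr1 => <-; rewrite divfK// subr_eq0 gt_eqF//.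
Qed.

(** The weak derivative is compared with an honest primitive: their difference is
    weakly constant. *)
Lemma weak_primitive p g : locint p -> locint g ->
  (forall phi N, smooth phi -> supp phi N ->
     \int[mu]_x (p x * phi^`() x) = - \int[mu]_x (g x * phi x)) ->
  exists G, [/\ continuous G, antider G g &
    forall a b, a <= b -> itg a b p = itg a b G].
Proof.
move=> lp lg H.
have aG := prim_antider lg; have cG := antider_continuous lg aG.
have lG := locint_continuous cG.
have [|c Hc] := @weakly_constant (fun x => p x - prim g x) (locintB lp lG).
  move=> phi N sphi sN.
  have cphi' := smooth_continuous (smooth_derive1 sphi).
  have sN' := supp_derive1 sN.
  rewrite (Rintegral_supp _ sN').
  under eq_fun do rewrite mulrBl.
  rewrite itgB; last 2 first.
  - exact: locintM_continuous.
  - exact: locintM_continuous.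
  rewrite -!(Rintegral_supp _ sN') (H _ _ sphi sN) (parts_test lg aG cG sphi sN).
  by rewrite subrr.
have lc : locint (fun=> c : R) by exact: locint_cst.
exists (fun x => c + prim g x); split.
- by move=> x; apply: cvgD; [exact: cvg_cst|exact: cG].
- by move=> a b ab; rewrite -aG//; ring.
- move=> a b ab; have := Hc a b ab; rewrite itgB// => E.
  by rewrite itgD// -E subrK.
Qed.

(** The primitive of such a function is weakly constant, and continuous, hence
    constant. *)
Lemma weak_orthogonal Q : locint Q ->
  (forall phi N, smooth phi -> supp phi N -> \int[mu]_x (Q x * phi x) = 0) ->
  forall a b, a <= b -> itg a b Q = 0.
Proof.
move=> lQ H.
have aG := prim_antider lQ; have cG := antider_continuous lQ aG.
have [|c Hc] := @weakly_constant (prim Q) (locint_continuous cG).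
  move=> phi N sphi sN.
  by rewrite (parts_test lQ aG cG sphi sN) (H _ N)// oppr0.
have cc : continuous ((fun=> c) : R -> R) by move=> x; exact: cvg_cst.
have E := itg_eq_continuous cG cc Hc.
by move=> a b ab; rewrite -aG// E subrr.
Qed.

(** Lebesgue differentiation of the indefinite integral. *)
Lemma itg0_ae Q : locint Q -> (forall a b, a <= b -> itg a b Q = 0) ->
  {ae mu, forall x, Q x = 0}.
Proof.
move=> lQ Q0; have := lebesgue_differentiation lQ.
apply: ae_mono => x Lx.
have h : x - 1 < x by rewrite ltrBlDr ltrDl.
have xx1 : x < x + 1 by rewrite ltrDl.
have [_ <-] := @FTC1_lebesgue_pt R Q (BLeft (x - 1)) x (x + 1) xx1 (locint_itv _ _ lQ) h Lx.
rewrite (_ : (fun y => _) = (fun=> 0)) ?derive1_cst//.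
apply/funext => y; have [xy|yx] := leP (x - 1) y; first exact: Q0.
exact: itg_gt.
Qed.

Lemma weak_deriv_unique k v g1 g2 : is_weak_deriv k v g1 -> is_weak_deriv k v g2 ->
  {ae mu, forall x, g1 x = g2 x}.
Proof.
move=> [lv lg1 H1] [_ lg2 H2].
have lB := locintB lg1 lg2.
have : {ae mu, forall x, g1 x - g2 x = 0}.
  apply: (itg0_ae lB); apply: (weak_orthogonal lB) => phi N sphi sN.
  rewrite (Rintegral_supp _ sN).
  under eq_fun do rewrite mulrBl.
  have cphi := smooth_continuous sphi.
  rewrite itgB; last 2 first.
  - exact: locintM_continuous.
  - exact: locintM_continuous.
  rewrite -!(Rintegral_supp _ sN).
  have tphi : test_function setT phi by apply/test_functionP; split => //; exists N.
  have nz : (-1) ^+ k != 0 :> R by rewrite signr_eq0.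
  by have := H1 _ tphi; rewrite (H2 _ tphi) => /(mulfI nz) ->; rewrite subrr.
by apply: ae_mono => x /eqP; rewrite subr_eq0 => /eqP.
Qed.

Lemma weak_deriv_spec k v : (exists g, is_weak_deriv k v g) ->
  is_weak_deriv k v (weak_deriv k v).
Proof. by move=> [g Hg]; rewrite /weak_deriv; case: xgetP => [g' -> //|/(_ g)]. Qed.

Lemma weak_deriv_ae k v g : is_weak_deriv k v g ->
  {ae mu, forall x, weak_deriv k v x = g x}.
Proof.
by move=> Hg; apply: (weak_deriv_unique _ Hg); apply: weak_deriv_spec; exists g.
Qed.

Lemma weak_deriv_succ j v p g : is_weak_deriv j v p -> is_weak_deriv j.+1 v g ->
  forall phi N, smooth phi -> supp phi N ->
     \int[mu]_x (p x * phi^`() x) = - \int[mu]_x (g x * phi x).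
Proof.
move=> [_ lp Hp] [_ lg Hg] phi N sphi sN.
have t : test_function setT phi by apply/test_functionP; split => //; exists N.
have t' : test_function setT phi^`().
  apply/test_functionP; split; first exact: smooth_derive1.
  by exists (N + 1); exact: supp_derive1.
have := Hg _ t; rewrite derive1Sn (Hp _ t') exprS -mulrA mulN1r -mulrN.
by apply: mulfI; rewrite signr_eq0.
Qed.

Lemma is_weak_deriv0 v : locint v -> is_weak_deriv 0 v v.
Proof. by move=> lv; split => // phi _; rewrite expr0 mul1r. Qed.

(** Sobolev regularity in dimension one: weak derivatives of order up to [m] of a
    continuous function are classical, and the one of order [m.+1] is the
    density of the last classical one. *)
Lemma weak_regular m v : continuous v ->
  (forall j, (j <= m.+1)%N -> exists g, is_weak_deriv j v g) ->
  (forall k, (k < m)%N -> forall x, derivable (derive1n k v) x 1) /\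
  (forall g, is_weak_deriv m.+1 v g -> antider (derive1n m v) g).
Proof.
move=> cv; elim: m => [|m IH] H.
  split=> // g Hg; have lv := locint_continuous cv.
  have [G [cG aG E]] : exists G, [/\ continuous G, antider G g &
      forall a b, a <= b -> itg a b v = itg a b G].
    apply: weak_primitive => //; first by case: Hg.
    exact: weak_deriv_succ (is_weak_deriv0 lv) Hg.
  by rewrite derive1n0 (itg_eq_continuous cv cG E).
have [|dv av] := IH; first by move=> j jm; apply: H; exact: leqW.
have [p Hp] := H m.+1 (leqnSn _).
have ap := av p Hp.
have key g : is_weak_deriv m.+2 v g -> exists G, [/\ continuous G, antider G g &
    forall x : R, is_derive x 1 (derive1n m v) (G x)].
  move=> Hg.
  have [G [cG aG E]] : exists G, [/\ continuous G, antider G g &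
      forall a b, a <= b -> itg a b p = itg a b G].
    apply: weak_primitive; [by case: Hp|by case: Hg|].
    exact: weak_deriv_succ Hp Hg.
  exists G; split => //; apply: (antider_is_derive cG); exact: antider_eq_itg E ap.
split=> [k|g /key [G [cG aG dG]]]; last first.
  by rewrite derive1nS (is_derive_fun dG).2.
rewrite ltnS leq_eqVlt => /predU1P[->|]; last exact: dv.
have [g /key [G [_ _ dG]]] := H m.+2 (leqnn _).
exact: (is_derive_fun dG).1.
Qed.

Lemma is_weak_deriv_step j v g : (forall k, (k < j)%N -> forall x, derivable (derive1n k v) x 1) ->
  is_weak_deriv j v (derive1n j v) -> locint g -> antider (derive1n j v) g ->
  is_weak_deriv j.+1 v g.
Proof.
move=> dv [lv _ Hv] lg ag; split => // phi /test_functionP[sphi [N sN]].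
have t' : test_function setT phi^`().
  apply/test_functionP; split; first exact: smooth_derive1.
  by exists (N + 1); exact: supp_derive1.
rewrite derive1Sn (Hv _ t').
rewrite (parts_test lg ag (antider_continuous lg ag) sphi sN).
by rewrite exprS -mulrA mulN1r mulrN.
Qed.

(** Converse of [weak_regular]. *)
Lemma classical_weak_deriv m v g :
  (forall k, (k < m)%N -> forall x, derivable (derive1n k v) x 1) ->
  locint g -> antider (derive1n m v) g ->
  (forall j, (j <= m)%N -> is_weak_deriv j v (derive1n j v)) /\
  is_weak_deriv m.+1 v g.
Proof.
move=> dv lg ag.
have cv k : (k <= m)%N -> continuous (derive1n k v).
  rewrite leq_eqVlt => /predU1P[->|km]; first exact: antider_continuous ag.
  by apply: derivable_cont; exact: dv.
have av k : (k < m)%N -> antider (derive1n k v) (derive1n k.+1 v).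
  move=> km; apply: is_derive_antider; first exact: cv.
  by move=> x; rewrite derive1nS; apply: derivable_is_derive; exact: dv.
have wv j : (j <= m)%N -> is_weak_deriv j v (derive1n j v).
  elim: j => [_|j IH jm].
    by apply: is_weak_deriv0; apply: locint_continuous; exact: (cv 0%N).
  apply: is_weak_deriv_step.
  - by move=> k kj; apply: dv; exact: ltn_trans kj jm.
  - exact/IH/ltnW.
  - by apply: locint_continuous; exact: cv.
  - exact: av.
by split => //; apply: is_weak_deriv_step => //; exact: wv.
Qed.

End weak_derivatives.

(** * Approximate derivatives of least mean square *)

Section periodic_primitives.
Variable R : realType.
Notation mu := (@lebesgue_measure R).
Implicit Types (f g v w phi psi G A : R -> R) (a b c d x N M e : R) (j k m n : nat).

Lemma lebesgue_measure_shift c (A : set R) : measurable A ->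
  pushforward mu (fun x => x + c : measurableTypeR R) A = mu A.
Proof.
move=> mA; apply/esym/lebesgue_measure_unique => //=.
  apply: continuous_measurable_fun => x.
  by apply: cvgD; [exact: cvg_id|exact: cvg_cst].
move=> _ _ [[a b]] _ <-; rewrite /pushforward.
have -> : (fun x => x + c) @^-1` [set` `]a, b]%R] = [set` `](a - c), (b - c)]%R].
  by apply/seteqP; split => x /=; rewrite !in_itv/= ltrBlDr lerBrDr.
rewrite !lebesgue_measure_itv/= !lte_fin ltrD2r.
by case: ifP => // _; rewrite -!EFinB; congr (_%:E); ring.
Qed.

(** Invariance of Lebesgue measure gives the result for nonnegative functions; a
    general [f] is the difference of f + |f| and |f|, both nonnegative. *)
Lemma itg_shift c f a b : locint f ->
  itg (a + c) (b + c) f = itg a b (fun x => f (x + c)).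
Proof.
have ge0 g : locint g -> (forall x, 0 <= g x) ->
    itg (a + c) (b + c) g = itg a b (fun x => g (x + c)) /\
    locint (fun x => g (x + c)).
  move=> lg g0.
  have msh : measurable_fun setT (fun x : measurableTypeR R => x + c : measurableTypeR R).
    apply: continuous_measurable_fun => x.
    by apply: cvgD; [exact: cvg_id|exact: cvg_cst].
  have mg := locint_measurable lg.
  have E (u v : R) : (\int[mu]_(x in [set` `[(u + c), (v + c)]%R]) (g x)%:E =
      \int[mu]_(x in [set` `[u, v]%R]) (g (x + c))%:E)%E.
    transitivity (\int[pushforward mu (fun x => x + c : measurableTypeR R)%R]_(x in
        [set` `[(u + c), (v + c)]%R]) (g x)%:E)%E.
      by apply: eq_measure_integral => A mA _; exact/esym/lebesgue_measure_shift.
    rewrite ge0_integral_pushforward//=; last 2 first.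
    - by apply/measurable_EFinP; exact: measurable_funS mg.
    - by move=> y _; rewrite lee_fin.
    by congr (integral _ _ _); apply/seteqP; split => x /=; rewrite !in_itv/= !lerD2r.
  split; first by rewrite /itg /Rintegral E.
  have mgs : measurable_fun setT (fun x => g (x + c)) by exact: measurableT_comp mg msh.
  split => //; first exact: openT.
  move=> K _ cK; have mK : measurable K by exact: compact_measurable.
  have [M [Mr HM]] := compact_bounded cK.
  pose N := `|M| + 1.
  apply: (@le_lt_trans _ _ (\int[mu]_(x in [set` `[- N, N]%R]) (g (x + c))%:E)%E).
    under eq_integral do rewrite ger0_norm//.
    apply: ge0_subset_integral => //.
    - by apply/measurable_EFinP; exact: measurable_funS mgs.
    - by move=> x _; rewrite lee_fin.
    - move=> x Kx /=; have := HM N; rewrite /N (le_lt_trans (ler_norm M)) ?ltrDl//.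
      by move=> /(_ isT x Kx) /=; rewrite in_itv/= ler_norml.
  rewrite -E; have /integrableP[_] := locint_itv (- N + c) (N + c) lg.
  by under eq_integral do rewrite /= ger0_norm//.
move=> lf; have lN := locint_norm lf.
pose p x := f x + `|f x|.
have lp : locint p by exact: locintD.
have p0 x : 0 <= p x by rewrite /p -lerBlDl sub0r ler_normr lexx orbT.
have [Ep lps] := ge0 _ lp p0.
have [En lns] := ge0 _ lN (fun x => normr_ge0 (f x)).
have fE : f = fun x => p x - `|f x| by apply/funext => x; rewrite /p addrK.
transitivity (itg (a + c) (b + c) (fun x => p x - `|f x|)); first by rewrite -fE.
rewrite itgB// Ep En -itgB//; apply: eq_itg => x _; by rewrite /p addrK.
Qed.

Lemma continuous_sqr f : continuous f -> continuous (fun x => f x ^+ 2).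
Proof.
move=> cf; rewrite (_ : (fun x => _) = (fun x => f x * f x)).
  by move=> x; apply: cvgM; exact: cf.
by apply/funext => x; rewrite expr2.
Qed.

Lemma locint_sqr f : continuous f -> locint (fun x => f x ^+ 2).
Proof. by move=> cf; apply: locint_continuous; exact: continuous_sqr. Qed.

Lemma locint_of_itv f : measurable_fun setT f ->
  (forall N, mu.-integrable [set` `[- N, N]%R] (EFin \o f)) -> locint f.
Proof.
move=> mf H; split => //; first exact: openT.
move=> K _ cK; have [M [Mr HM]] := compact_bounded cK.
have mK : measurable K by exact: compact_measurable.
have : mu.-integrable K (EFin \o f).
  apply: integrableS (H (`|M| + 1)) => //.
  move=> x Kx /=; have := HM (`|M| + 1); rewrite (le_lt_trans (ler_norm M)) ?ltrDl//.
  by move=> /(_ isT x Kx) /=; rewrite in_itv/= ler_norml.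
by case/integrableP.
Qed.

Lemma nondecreasing_locint A : (forall a b, a <= b -> A a <= A b) -> locint A.
Proof.
move=> nd; have mA : measurable_fun setT A by exact: nondecreasing_measurable.
apply: locint_of_itv => // N.
apply: measurable_bounded_integrable => //.
- by rewrite /= lebesgue_measure_itv/=; case: ifP => // _; rewrite ltry.
- exact: measurable_funS mA.
- exists (Num.max `|A (- N)| `|A N|); split; first exact: num_real.
  move=> y yB x /=; rewrite in_itv/= => /andP[x1 x2].
  apply: le_trans (ltW yB); rewrite le_max.
  have h1 := nd _ _ x1; have h2 := nd _ _ x2.
  have [A0|A0] := leP 0 (A x).
    apply/orP; right; rewrite (ger0_norm A0); apply: (le_trans h2).
    exact: ler_norm.
  apply/orP; left; rewrite (ltr0_norm A0); apply: (@le_trans _ _ (- A (- N))).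
    by rewrite lerN2.
  by rewrite -normrN ler_norm.
Qed.

(** Over at most one period the controlling measure has mass at most [M ^+ 2]. *)
Lemma H1_close M f : 0 <= M -> H1 M f -> forall a b, a <= b <= a + 1 ->
  (f b - f a) ^+ 2 <= (b - a) * M ^+ 2.
Proof.
move=> M0 [A [A1 fA]] a b /andP[ab ba1]; apply: (le_trans (fA _ _ ab)).
rewrite ler_wpM2l ?subr_ge0//.
have := energy_nondecreasing fA ba1; rewrite A1; lra.
Qed.

Lemma H1_continuous M f : 0 <= M -> H1 M f -> continuous f.
Proof.
move=> M0 Hf x; apply/cvgrPdist_le => e e0.
have M1 : 0 < M ^+ 2 + 1 by rewrite ltr_wpDl// sqr_ge0.
have d0 : 0 < Num.min 1 (e ^+ 2 / (M ^+ 2 + 1)).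
  by rewrite lt_min ltr01 divr_gt0// exprn_gt0.
near=> y.
have xy : `|x - y| <= Num.min 1 (e ^+ 2 / (M ^+ 2 + 1)).
  by near: y; exact: cvgr_dist_le d0.
move: xy; rewrite le_min => /andP[xy1 xye].
rewrite -ler_sqr ?nnegrE ?(ltW e0)// real_normK ?num_real//.
have key : (f x - f y) ^+ 2 <= `|x - y| * M ^+ 2.
  have [h|/ltW h] := leP x y.
    rewrite -sqrrN opprB distrC ger0_norm ?subr_ge0//; apply: H1_close => //.
    by rewrite h/=; move: xy1; rewrite ler_norml; lra.
  rewrite ger0_norm ?subr_ge0//; apply: H1_close => //.
  by rewrite h/=; move: xy1; rewrite ler_norml; lra.
apply: (le_trans key).
apply: (@le_trans _ _ (`|x - y| * (M ^+ 2 + 1))).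
  by rewrite ler_wpM2l// lerDl.
by rewrite -ler_pdivlMr.
Unshelve. all: by end_near. Qed.

Definition sqn g := itg 0 1 (fun x => g x ^+ 2).

(** An approximate derivative of [phi]: a continuous periodic density of a
    function uniformly close to [phi], with the mean square expected of the
    derivative of [phi].  These densities form a convex set. *)
Definition rapprox phi M e g := exists psi, [/\ continuous g, antider psi g,
  periodic1 g, (forall x, `|psi x - phi x| <= e) & sqn g <= M ^+ 2].

Lemma rapprox_mono phi M e e' g : e <= e' -> rapprox phi M e g -> rapprox phi M e' g.
Proof.
move=> ee' [psi [cg ag pg pe Qg]]; exists psi; split => // x.
exact: le_trans (pe x) ee'.
Qed.

(** Difference quotients of [phi] do it: they are derivatives of the averages of
    [phi] over intervals of length [d], and integrating the bound on increments
    over one period bounds their mean square by [M ^+ 2], with no loss. *)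
Lemma rapprox_ex phi M e : periodic1 phi -> 0 <= M -> H1 M phi -> 0 < e ->
  exists g, rapprox phi M e g.
Proof.
move=> pphi M0 Hphi e0.
have M1 : 0 < M ^+ 2 + 1 by rewrite ltr_wpDl// sqr_ge0.
pose d := Num.min 1 (e ^+ 2 / (M ^+ 2 + 1)).
have d0 : 0 < d by rewrite lt_min ltr01 divr_gt0// exprn_gt0.
have d1 : d <= 1 by rewrite ge_min lexx.
have dM : d * M ^+ 2 <= e ^+ 2.
  apply: (@le_trans _ _ (d * (M ^+ 2 + 1))); first by rewrite ler_wpM2l ?lerDl// ltW.
  by rewrite -ler_pdivlMr// ge_min lexx orbT.
have cphi := H1_continuous M0 Hphi.
have lphi := locint_continuous cphi.
have ap := prim_antider lphi.
have dp := antider_is_derive cphi ap.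
pose g x := d^-1 * (phi (x + d) - phi x).
pose psi x := d^-1 * (prim phi (x + d) - prim phi x).
have cshift : continuous (fun x => phi (x + d)).
  move=> x; apply: (@continuous_comp _ _ _ (fun x => x + d) phi); last exact: cphi.
  by apply: cvgD; [exact: cvg_id|exact: cvg_cst].
have cg : continuous g.
  by move=> x; apply: cvgM; [exact: cvg_cst|apply: cvgB; [exact: cshift|exact: cphi]].
have dpsi (x : R) : is_derive x 1 psi (g x).
  have dsh : is_derive x 1 (fun x => prim phi (x + d)) (phi (x + d)).
    have dI : is_derive x 1 (fun x => x + d) 1.
      by have := is_deriveD (is_derive_id x 1) (is_derive_cst d x 1); rewrite addr0.
    have := @is_derive1_comp R (prim phi) (fun x => x + d) x _ _ (dp (x + d)) dI.
    by rewrite mulr1.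
  exact: (is_deriveZ d^-1 (is_deriveB dsh (dp x))).
exists g, psi; split => //.
- exact: is_derive_antider.
- by move=> x; rewrite /g pphi addrAC pphi.
- move=> x; have xd : x <= x + d by rewrite lerDl ltW.
  have -> : psi x - phi x = d^-1 * itg x (x + d) (fun y => phi y - phi x).
    have lc : locint (fun=> phi x) by exact: locint_cst.
    rewrite itgB// -(ap _ _ xd) itg_cst// /psi.
    by field; exact: lt0r_neq0.
  rewrite normrM gtr0_norm ?invr_gt0// mulrC ler_pdivrMr//.
  have lB : locint (fun y => phi y - phi x).
    by apply: locintB => //; exact: locint_cst.
  apply: (le_trans (ler_norm_itg _ _ lB)).
  have le : locint (fun=> e : R) by exact: locint_cst.
  have -> : e * d = itg x (x + d) (fun=> e) by rewrite itg_cst//; ring.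
  apply: le_itg => //; first exact: locint_norm.
  move=> y /andP[xy yd]; rewrite -ler_sqr ?nnegrE ?(ltW e0)// real_normK ?num_real//.
  apply: le_trans (H1_close M0 Hphi _) _; first by rewrite xy/=; lra.
  by apply: le_trans dM; rewrite ler_wpM2r ?sqr_ge0//; lra.
- case: Hphi => A [A1 fA].
  have nd := energy_nondecreasing fA.
  have lA := nondecreasing_locint nd.
  have lAd : locint (fun x => A (x + d)).
    by apply: nondecreasing_locint => a b ab; apply: nd; rewrite lerD2r.
  have lA1 : locint (fun x => A (x + 1)).
    by apply: nondecreasing_locint => a b ab; apply: nd; rewrite lerD2r.
  have lAB := locintB lAd lA.
  have lZ : locint (fun x => (A (x + d) - A x) * d^-1).
    by apply: locintM_continuous => // x; exact: cvg_cst.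
  apply: (@le_trans _ _ (itg 0 1 (fun x => (A (x + d) - A x) * d^-1))).
    apply: le_itg => //; first exact: locint_sqr.
    move=> x _; rewrite /g exprMn.
    have := fA x (x + d); rewrite lerDl ltW// => /(_ isT).
    rewrite (_ : x + d - x = d); last ring.
    move=> h; apply: (@le_trans _ _ (d^-1 ^+ 2 * (d * (A (x + d) - A x)))).
      by rewrite ler_wpM2l// sqr_ge0.
    by rewrite le_eqVlt; apply/orP; left; apply/eqP; field; exact: lt0r_neq0.
  under [X in itg _ _ X]eq_fun do rewrite mulrC.
  rewrite itgZ// itgB// -itg_shift// add0r.
  have s1 := itg_split lA (ltW d0) d1.
  have := @itg_split R d 1 (1 + d) A lA d1; rewrite lerDl ltW// => /(_ isT) s2.
  rewrite s1 s2.
  have -> : itg 1 (1 + d) A = itg 0 d A + M ^+ 2 * d.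
    have := @itg_shift 1 A 0 d lA; rewrite add0r (addrC d) => ->.
    under [X in itg _ _ X]eq_fun do rewrite A1.
    have lM : locint (fun=> M ^+ 2) by exact: locint_cst.
    by rewrite itgD// itg_cst ?subr0// ltW.
  rewrite le_eqVlt; apply/orP; left; apply/eqP; field; exact: lt0r_neq0.
Qed.

Lemma sqnB f g : continuous f -> continuous g ->
  sqn (fun x => f x - g x) + 4 * sqn (fun x => 2^-1 * (f x + g x)) =
  2 * sqn f + 2 * sqn g.
Proof.
move=> cf cg.
have cB : continuous (fun x => f x - g x).
  by move=> x; apply: cvgB; [exact: cf|exact: cg].
have cM : continuous (fun x => 2^-1 * (f x + g x)).
  move=> x; apply: cvgM; first exact: cvg_cst.
  by apply: cvgD; [exact: cf|exact: cg].
rewrite /sqn -!itgZ; try exact: locint_sqr.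
rewrite -!itgD; try apply: locintZ; try exact: locint_sqr.
by apply: eq_itg => x _; field.
Qed.

Lemma sqn_ge0 g : 0 <= sqn g.
Proof. by apply: itg_ge0 => x; exact: sqr_ge0. Qed.

Lemma rapprox_mid phi M e g1 g2 : rapprox phi M e g1 -> rapprox phi M e g2 ->
  rapprox phi M e (fun x => 2^-1 * (g1 x + g2 x)).
Proof.
move=> [p1 [cg1 ag1 pg1 pe1 Q1]] [p2 [cg2 ag2 pg2 pe2 Q2]].
exists (fun x => 2^-1 * (p1 x + p2 x)); split.
- move=> x; apply: cvgM; first exact: cvg_cst.
  by apply: cvgD; [exact: cg1|exact: cg2].
- have l1 := locint_continuous cg1; have l2 := locint_continuous cg2.
  move=> a b ab; rewrite itgZ ?itgD//; last exact: locintD.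
  by rewrite -ag1// -ag2//; ring.
- by move=> x; rewrite pg1 pg2.
- move=> x; have := pe1 x; have := pe2 x; rewrite !ler_norml; lra.
- have := sqnB cg1 cg2; have := sqn_ge0 (fun x => g1 x - g2 x); lra.
Qed.

(** Nearly minimising the mean square over the shrinking convex sets of
    approximate derivatives gives a Cauchy sequence, by the parallelogram
    identity [sqnB].  Taking the defect of minimality at rank [k] as 4^(-k) makes
    the increments summable in L^1, so that no extraction is needed to have
    convergence almost everywhere. *)
Lemma rapprox_minimizing phi M : periodic1 phi -> 0 <= M -> H1 M phi ->
  exists g : nat -> R -> R, forall k, rapprox phi M k.+1%:R^-1 (g k) /\
    itg 0 1 (fun x => `|g k x - g k.+1 x|) <= 5 * 2^-1 ^+ k.
Proof.
move=> pphi M0 Hphi.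
pose E n := [set sqn g | g in rapprox phi M n.+1%:R^-1].
have E0 n : E n !=set0.
  have [|g Hg] := @rapprox_ex phi M n.+1%:R^-1 pphi M0 Hphi; first by rewrite invr_gt0.
  by exists (sqn g), g.
have Elb n : has_lbound (E n) by exists 0 => _ [g _ <-]; exact: sqn_ge0.
have Einf n : has_inf (E n) by split.
(* the infima increase as the constraint gets stronger; [d] is their limit *)
pose D n := inf (E n).
have DM n : D n <= M ^+ 2.
  have [y [g Hg gy]] := E0 n; apply: le_trans (ge_inf (Elb n) _) _.
    by exists g; [exact: Hg|].
  by case: Hg => psi [].
have Dnd n p : (n <= p)%N -> D n <= D p.
  move=> np; apply: lb_le_inf; first exact: E0.
  move=> _ [g Hg <-]; apply: ge_inf => //; exists g => //.
  by apply: rapprox_mono Hg; rewrite lef_pV2 ?posrE// ler_nat ltnS.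
pose d := sup (range D).
have Dsup : has_sup (range D).
  split; first by exists (D 0%N), 0%N.
  by exists (M ^+ 2) => _ [n _ <-].
have Dd n : D n <= d by apply: sup_upper_bound => //; exists n.
have q0 k : 0 < 4^-1 ^+ k :> R by rewrite exprn_gt0.
have /boolp.choice [nk Hnk] : forall k, exists n, d - 4^-1 ^+ k < D n.
  by move=> k; have [_ [n _ <-] ?] := sup_adherent (q0 k) Dsup; exists n.
(* made nondecreasing, and at least [k] so that the uniform error tends to 0 *)
pose N k := (k + \max_(i < k.+1) nk i)%N.
have Nnk k : (nk k <= N k)%N.
  by apply: leq_trans (leq_addl _ _); exact: (@leq_bigmax _ _ (ord_max : 'I_k.+1)).
have NS k : (N k <= N k.+1)%N.
  rewrite /N leq_add//; apply/bigmax_leqP => i _.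
  by apply: (@leq_trans (nk (widen_ord (leqnSn _) i))) => //; exact: leq_bigmax.
have DN k p : (N k <= p)%N -> d - 4^-1 ^+ k <= D p.
  by move=> kp; apply: le_trans (ltW (Hnk k)) (Dnd _ _ (leq_trans (Nnk k) kp)).
have /boolp.choice [g Hg] : forall k, exists g,
    rapprox phi M (N k).+1%:R^-1 g /\ sqn g <= d + 4^-1 ^+ k.
  move=> k; have [_ [g Hg <-] lt] := inf_adherent (q0 k) (Einf (N k)).
  exists g; split => //; apply: ltW; apply: lt_le_trans lt _.
  by rewrite lerD2r; exact: Dd.
have cg k : continuous (g k) by case: (Hg k) => -[psi []].
exists g => k; split.
  apply: rapprox_mono (Hg k).1.
  by rewrite lef_pV2 ?posrE// ler_nat ltnS leq_addr.
have Hg1 : rapprox phi M (N k).+1%:R^-1 (g k.+1).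
  apply: rapprox_mono (Hg k.+1).1.
  by rewrite lef_pV2 ?posrE// ler_nat ltnS.
have Hmid := rapprox_mid (Hg k).1 Hg1.
have Qmid : d - 4^-1 ^+ k <= sqn (fun x => 2^-1 * (g k x + g k.+1 x)).
  apply: le_trans (DN k (N k) (leqnn _)) _; apply: ge_inf => //.
  by exists (fun x => 2^-1 * (g k x + g k.+1 x)).
have Q8 : sqn (fun x => g k x - g k.+1 x) <= 8 * 4^-1 ^+ k.
  have := sqnB (cg k) (cg k.+1).
  have := (Hg k).2; have := (Hg k.+1).2.
  have : 4^-1 ^+ k.+1 <= 4^-1 ^+ k :> R.
    by rewrite exprS ler_piMl ?exprn_ge0//; lra.
  lra.
pose t : R := 2^-1 ^+ k.
have t0 : 0 < t by rewrite exprn_gt0.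
have cB : continuous (fun x => g k x - g k.+1 x).
  by move=> x; apply: cvgB; exact: cg.
have lt : locint (fun=> t / 2) by exact: locint_cst.
have lB2 : locint (fun x => (g k x - g k.+1 x) ^+ 2) by exact: locint_sqr.
have lZ : locint (fun x => (2 * t)^-1 * (g k x - g k.+1 x) ^+ 2) by exact: locintZ.
apply: (@le_trans _ _ (itg 0 1 (fun x => t / 2 + (2 * t)^-1 * (g k x - g k.+1 x) ^+ 2))).
  apply: le_itg.
  - by apply: locint_norm; exact: locint_continuous.
  - exact: locintD.
  - move=> x _; set y := _ - _.
    rewrite -[y ^+ 2]real_normK ?num_real// -subr_ge0.
    have -> : t / 2 + (2 * t)^-1 * `|y| ^+ 2 - `|y| = (2 * t)^-1 * (t - `|y|) ^+ 2.
      by field; exact: lt0r_neq0.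
    by rewrite mulr_ge0 ?sqr_ge0// invr_ge0 mulr_ge0// ltW.
rewrite itgD// itg_cst// itgZ// subr0 mulr1.
have t4 : 4^-1 ^+ k = t * t by rewrite /t -exprMn -invfM -natrM.
have : (2 * t)^-1 * sqn (fun x => g k x - g k.+1 x) <= (2 * t)^-1 * (8 * (t * t)).
  by rewrite -t4 ler_wpM2l// invr_ge0 mulr_ge0// ltW.
have -> : (2 * t)^-1 * (8 * (t * t)) = 4 * t by field; exact: lt0r_neq0.
rewrite /sqn -/t; lra.
Qed.

End periodic_primitives.

(** * The L^2 derivative of an H^1 function *)

Section Riesz.
Variable R : realType.
Notation mu := (@lebesgue_measure R).
Implicit Types (f h phi psi G : R -> R) (g : nat -> R -> R) (a b c x N M e : R) (i j k m n : nat).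

Lemma itg_periodic f n x : locint f -> periodic1 f ->
  itg (- n%:R) (- n%:R + x) f = itg 0 x f.
Proof.
move=> lf pf; elim: n => [|n IH]; first by rewrite oppr0 add0r.
rewrite -IH -[RHS]/(itg _ _ f).
have -> : - n%:R = - n.+1%:R + 1 :> R by rewrite -natr1; ring.
have -> : - n.+1%:R + 1 + x = (- n.+1%:R + x) + 1 by ring.
rewrite itg_shift//; apply: eq_itg => y _; by rewrite pf.
Qed.

Lemma itg_periodic_nat f n : locint f -> periodic1 f ->
  itg 0 n%:R f = n%:R * itg 0 1 f.
Proof.
move=> lf pf; elim: n => [|n IH]; first by rewrite itgxx mul0r.
rewrite (itg_split lf (_ : 0 <= n%:R) (_ : n%:R <= n.+1%:R)) ?ler_nat//.
rewrite IH -natr1 mulrDl mul1r; congr (_ + _); elim: n {IH} => [|n IH].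
  by rewrite add0r.
by rewrite -IH -natr1 itg_shift//; apply: eq_itg => y _; rewrite pf.
Qed.

Lemma cvg_of_summable_increments (u : nat -> R) B :
  (forall n, \sum_(0 <= k < n) `|u k - u k.+1| <= B) -> cvgn u.
Proof.
move=> uB.
have c1 : cvgn (series (fun k => u k - u k.+1)).
  apply: normed_cvg; apply: nondecreasing_is_cvgn.
    by apply: nondecreasing_series => n _ _; exact: normr_ge0.
  by exists B => _ [n _ <-]; exact: uB.
have E : u = (fun n => u 0%N - series (fun k => u k - u k.+1) n).
  apply/funext => n; rewrite /series/=; elim: n => [|n IH].
    by rewrite big_geq// subr0.
  by rewrite big_nat_recr//= opprD addrA -IH; ring.
rewrite E; apply: is_cvgB => //; exact: is_cvg_cst.
Qed.

(** The set [D] where the increments are summable has full measure, and outside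
    it the terms are replaced by 0, so that convergence holds at every point. *)
Lemma L1_limit g C : (forall k, continuous (g k)) -> (forall k, periodic1 (g k)) ->
  (forall k, itg 0 1 (fun x => `|g k x - g k.+1 x|) <= C * 2^-1 ^+ k) ->
  exists (G : R -> R) (D : set R), [/\ locint G, measurable D,
    forall x, g k x * \1_D x @[k --> \oo] --> G x &
    forall a b, a <= b -> itg a b (g k) @[k --> \oo] --> itg a b G].
Proof.
move=> cg pg gC.
have cB k : continuous (fun x => g k x - g k.+1 x).
  by move=> x; apply: cvgB; exact: cg.
have lB k := locint_norm (locint_continuous (cB k)).
pose H x := (\sum_(k <oo) `|g k x - g k.+1 x|%:E)%E.
have mk k : measurable_fun setT (fun x => `|g k x - g k.+1 x|%:E).
  by apply/measurable_EFinP; exact: locint_measurable (lB k).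
have mH : measurable_fun setT H.
  by apply: ge0_emeasurable_sum => // k x _ _; rewrite lee_fin.
have H0 x : (0 <= H x)%E by apply: nneseries_ge0 => k _ _; rewrite lee_fin.
pose D := [set x | (H x < +oo)%E].
have mD : measurable D.
  have := @measurable_lte _ _ R setT measurableT _ (cst +oo%E) mH (measurable_cst _).
  by rewrite setTI.
have C0 : 0 <= C.
  by have := gC 0%N; rewrite expr0 mulr1; apply: le_trans; exact: itg_ge0.
have intH n : (\int[mu]_(x in [set` `[(- n%:R), n%:R]%R]) H x < +oo)%E.
  rewrite integral_nneseries//; last first.
    by move=> k; exact: measurable_funS (mk k).
  apply: (@le_lt_trans _ _ (2 * (n.*2%:R * C))%:E); last by rewrite ltry.
  apply: lime_le.
    by apply: is_cvg_nneseries => k _ _; apply: integral_ge0 => x _; rewrite lee_fin.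
  apply: nearW => p.
  have E k : (\int[mu]_(x in [set` `[(- n%:R), n%:R]%R]) `|g k x - g k.+1 x|%:E =
     (n.*2%:R * itg 0 1 (fun x => `|g k x - g k.+1 x|))%:E)%E.
    have fin : (\int[mu]_(x in [set` `[(- n%:R), n%:R]%R]) `|g k x - g k.+1 x|%:E)%E \is a fin_num.
      by apply: integrable_fin_num => //; exact: (locint_itv _ _ (lB k)).
    rewrite -(fineK fin); congr (_%:E).
    rewrite -(@itg_periodic_nat _ n.*2)//; last by move=> x; rewrite !pg.
    rewrite -(@itg_periodic _ n)//; last by move=> x; rewrite !pg.
    by rewrite /itg /Rintegral -addnn natrD addKr.
  rewrite (eq_bigr _ (fun k _ => E k)) sumEFin lee_fin -mulr_sumr.
  rewrite mulrCA ler_wpM2l ?ler0n//.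
  apply: (@le_trans _ _ (\sum_(0 <= k < p) C * 2^-1 ^+ k)).
    by apply: ler_sum => k _.
  rewrite -mulr_sumr mulrC ler_wpM2r//.
  have : \sum_(0 <= k < p) 2^-1 ^+ k = 2 - 2 * 2^-1 ^+ p :> R.
    elim: p => [|p IH]; first by rewrite big_geq// expr0; ring.
    by rewrite big_nat_recr//= IH exprS; field.
  move=> ->; rewrite gerBl mulr_ge0// exprn_ge0//.
have bnd_inc x : D x -> forall n, \sum_(0 <= k < n) `|g k x - g k.+1 x| <= fine (H x).
  move=> Dx n; rewrite -lee_fin fineK ?ge0_fin_numE// -sumEFin.
  by apply: nneseries_lim_ge => k _ _; rewrite lee_fin.
have cvx x : cvgn (fun k => g k x * \1_D x).
  rewrite indicE; have [xD|xD] := boolP (x \in D); last first.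
    by under eq_fun do rewrite mulr0; exact: is_cvg_cst.
  under eq_fun do rewrite mulr1.
  by apply: cvg_of_summable_increments; apply: bnd_inc; exact: set_mem.
pose G x := limn (fun k => g k x * \1_D x).
have cvG x : g k x * \1_D x @[k --> \oo] --> G x by exact: cvx.
have mgD k : measurable_fun setT (fun x => g k x * \1_D x).
  apply: measurable_funM; first exact: continuous_measurable_fun (cg k).
  by apply: measurable_indic.
have mG : measurable_fun setT G.
  by apply: (@measurable_fun_cvg _ _ R setT (fun k x => g k x * \1_D x)) => // x _.
have dom k x : (`|(g k x * \1_D x)%:E| <= `|g 0%N x|%:E + H x)%E.
  rewrite indicE; have [xD|xD] := boolP (x \in D); last first.
    by rewrite mulr0 /= normr0 adde_ge0// lee_fin.
  rewrite mulr1 /=; have Dx : D x by exact: set_mem.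
  rewrite -(@fineK _ (H x)) ?ge0_fin_numE// -EFinD lee_fin.
  have := bnd_inc x Dx k.
  have : `|g k x| <= `|g 0%N x| + \sum_(0 <= i < k) `|g i x - g i.+1 x|.
    elim: k => [|k IH]; first by rewrite big_geq// addr0.
    rewrite big_nat_recr//= addrA.
    apply: le_trans (lerD IH (lexx _)).
    have := ler_normB (g k x) (g k x - g k.+1 x).
    by rewrite opprB addrC subrK.
  lra.
have iH n : mu.-integrable [set` `[(- n%:R), n%:R]%R] H.
  apply/integrableP; split; first exact: measurable_funS mH.
  by under eq_integral do rewrite gee0_abs//.
have iHab a b : mu.-integrable [set` `[a, b]%R] H.
  pose n := (Num.truncn (`|a| + `|b|)).+1.
  have nab : `|a| + `|b| < n%:R by exact: truncnS_gt.
  apply: integrableS (iH n) => //.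
  move=> x /=; rewrite !in_itv/= => /andP[ax xb].
  have := ler_norm (- a); have := ler_norm b; rewrite normrN.
  have := normr_ge0 a; have := normr_ge0 b; lra.
have conv a b : mu.-integrable [set` `[a, b]%R] (EFin \o G) /\
    (itg a b (fun x => g k x * \1_D x) @[k --> \oo] --> itg a b G).
  have [|||||iG _ cvI] := @dominated_convergence _ _ R mu [set` `[a, b]%R]
    (measurable_itv _) (fun k x => (g k x * \1_D x)%:E) (EFin \o G)
    (fun x => `|g 0%N x|%:E + H x)%E.
  - by move=> k; apply/measurable_EFinP; exact: measurable_funS (mgD k).
  - by apply/measurable_EFinP; exact: measurable_funS mG.
  - by apply: aeW => x _; apply/cvg_EFin; [exact: nearW|exact: cvG].
  - apply: integrableD => //.
    exact: (locint_itv _ _ (locint_norm (locint_continuous (cg 0%N)))).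
  - by apply: aeW => x k _; exact: dom.
  split => //; apply: fine_cvg; rewrite fineK; first exact: cvI.
  by apply: integrable_fin_num => //; exact: iG.
have lG : locint G.
  by apply: locint_of_itv => // N; case: (conv (- N) N).
exists G, (D : set R); split; [exact: lG|exact: mD|exact: cvG|].
move=> a b ab.
have [_ cI] := conv a b.
suff E k : itg a b (g k) = itg a b (fun x => g k x * \1_D x).
  by under eq_fun do rewrite E.
rewrite /itg /Rintegral; congr fine; apply: ae_eq_integral => //.
- by apply/measurable_EFinP; exact: measurable_funS (continuous_measurable_fun (cg k)).
- by apply/measurable_EFinP; exact: measurable_funS (mgD k).
have aeH : {ae mu, forall x, [set` `[a, b]%R] x -> H x \is a fin_num}.
  by apply: integrable_ae => //; exact: iHab.
move: aeH; apply: ae_mono => x Hx Dx; rewrite indicE mem_set ?mulr1//.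
by have := Hx Dx; rewrite ge0_fin_numE.
Qed.

(** The limit of a minimising sequence of approximate derivatives is a
    derivative, and its mean square is bounded by Fatou's lemma. *)
Lemma riesz phi M : periodic1 phi -> 0 <= M -> H1 M phi ->
  exists G, [/\ locint G, antider phi G &
    (\int[mu]_(x in [set` `[0, 1]%R]) (G x ^+ 2)%:E <= (M ^+ 2)%:E)%E].
Proof.
move=> pphi M0 Hphi.
have [g Hg] := rapprox_minimizing pphi M0 Hphi.
have cg k : continuous (g k) by case: (Hg k) => -[psi []].
have pg k : periodic1 (g k) by case: (Hg k) => -[psi []].
have [G [D [lG mD cG cI]]] := L1_limit cg pg (fun k => (Hg k).2).
exists G; split => //.
- move=> a b ab; apply/eqP; rewrite -subr_eq0 -normr_eq0; apply/eqP.
  have lim : `|phi b - phi a - itg a b (g k)| @[k --> \oo] -->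
      `|phi b - phi a - itg a b G|.
    by apply: cvg_norm; apply: cvgB; [exact: cvg_cst|exact: cI].
  have lim0 : `|phi b - phi a - itg a b (g k)| @[k --> \oo] --> (0 : R).
    apply: (@squeeze_cvgr _ _ _ _ (cst 0) (fun k => 2 * k.+1%:R^-1)).
    + apply: nearW => k; rewrite /= normr_ge0/=.
      case: (Hg k) => -[psi [_ ap _ pe _]] _.
      rewrite -ap//; move: (pe a) (pe b); rewrite /=.
      set e := k.+1%:R^-1; rewrite !ler_norml => /andP[? ?] /andP[? ?].
      by apply/andP; split; lra.
    + exact: cvg_cst.
    + rewrite -[X in _ --> X](mulr0 2); apply: cvgM; first exact: cvg_cst.
      exact: cvg_harmonic.
  by rewrite -(cvg_lim _ lim)//; exact/cvg_lim.
- have Q k x : (g k x * \1_D x) ^+ 2 <= g k x ^+ 2.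
    by rewrite exprMn ler_piMr ?sqr_ge0.
  have E x : limn_einf (fun k => ((g k x * \1_D x) ^+ 2)%:E) = (G x ^+ 2)%:E.
    apply: (cvg_limn_einf_sup _).1; apply/cvg_EFin; first exact: nearW.
    rewrite (_ : _ \o _ = (fun k => (g k x * \1_D x) * (g k x * \1_D x))).
      by rewrite expr2; apply: cvgM; exact: cG.
    by apply/funext => k; rewrite /= expr2.
  under eq_integral do rewrite -E.
  have fin k : (\int[mu]_(x in [set` `[0, 1]%R]) (g k x ^+ 2)%:E <= (M ^+ 2)%:E)%E.
    have lk := locint_sqr (cg k).
    rewrite -[leLHS]fineK; last first.
      by apply: integrable_fin_num => //; exact: (locint_itv _ _ lk).
    by rewrite lee_fin; case: (Hg k) => -[psi []].
  have mk k : measurable_fun setT (fun x => g k x * \1_D x).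
    apply: measurable_funM; first exact: continuous_measurable_fun (cg k).
    by apply: measurable_indic.
  apply: le_trans (fatou _ _ _ _) _ => //.
  + move=> k; apply/measurable_EFinP.
    apply: (measurable_funS measurableT) => //; apply: measurable_funX; exact: mk.
  + by move=> k x _; rewrite lee_fin sqr_ge0.
  rewrite limn_einf_lim; apply: lime_le; first exact: is_cvg_einfs.
  apply: nearW => n; rewrite /einfs /=.
  apply: le_trans (fin n); apply: le_trans (_ : _ <= \int[mu]_(x in [set` `[0, 1]%R]) ((g n x * \1_D x) ^+ 2)%:E)%E _.
    by apply: ereal_inf_lbound; exists n => /=.
  apply: ge0_le_integral => //.
  + by move=> x _; rewrite lee_fin sqr_ge0.
  + apply/measurable_EFinP; apply: (measurable_funS measurableT) => //.
    by apply: measurable_funX; exact: mk.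
  + apply/measurable_EFinP; apply: (measurable_funS measurableT) => //.
    exact: continuous_measurable_fun (continuous_sqr (cg n)).
  + by move=> x _; rewrite lee_fin.
Qed.

End Riesz.

(** * Gluing estimates over unit intervals; L^2 norms *)

Section gluing.
Variable R : realType.
Notation mu := (@lebesgue_measure R).
Implicit Types (f g h u v w phi psi G W A : R -> R) (a b c x N M e : R) (i j k m n : nat).

Lemma floorD1E x : Num.floor (x + 1) = Num.floor x + 1.
Proof.
apply: floor_def; have := floor_le x; have := floorD1_gt x.
by rewrite !rmorphD/= => ? ?; apply/andP; split; lra.
Qed.

(** A property of intervals that can be glued and is invariant under integer
    translations need only be checked inside one period. *)
Lemma unit_interval_gluing (P : R -> R -> Prop) :
  (forall a b c, a <= b -> b <= c -> P a b -> P b c -> P a c) ->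
  (forall a b, P a b <-> P (a + 1) (b + 1)) ->
  (forall a b, 0 <= a -> a <= b -> b <= 1 -> P a b) ->
  forall a b, a <= b -> P a b.
Proof.
move=> tr sh base.
have pos n : forall a b, 0 <= a -> a <= b -> b <= n%:R -> P a b.
  elim: n => [|n IH] a b a0 ab bn.
    by apply: base => //; apply: le_trans bn _.
  have [b1|b1] := leP b 1; first exact: base.
  have shb c : 1 <= c -> c <= b -> P c b.
    move=> c1 cb; have -> : c = (c - 1) + 1 by ring.
    have -> : b = (b - 1) + 1 by ring.
    apply: (sh _ _).1; apply: IH; [by rewrite subr_ge0|by rewrite lerD2r|].
    by move: bn; rewrite -natr1; lra.
  have [a1|a1] := leP 1 a; first exact: shb.
  exact: (tr a 1 b (ltW a1) (ltW b1) (base a 1 a0 (ltW a1) (lexx 1))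
    (shb 1 (lexx 1) (ltW b1))).
have shn n a b : P (a + n%:R) (b + n%:R) -> P a b.
  elim: n => [|n IH]; first by rewrite !addr0.
  rewrite -natr1 !addrA => H; apply: IH; exact: (sh _ _).2 H.
move=> a b ab.
pose n := (Num.truncn `|a|).+1; pose p := (Num.truncn `|b + n%:R|).+1.
have na : `|a| < n%:R by exact: truncnS_gt.
have pb : `|b + n%:R| < p%:R by exact: truncnS_gt.
apply: (shn n); apply: (pos p).
- by move: na; rewrite ltr_norml; lra.
- by rewrite lerD2r.
- by apply: le_trans (ler_norm _) (ltW pb).
Qed.

Lemma periodic_lip f M : periodic1 f ->
  (forall a b, 0 <= a -> a <= b -> b <= 1 -> `|f b - f a| <= M * (b - a)) ->
  lip M f.
Proof.
move=> pf base x y.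
wlog xy : x y / x <= y.
  by move=> S; have [/S//|/ltW/S] := leP x y; rewrite distrC (distrC y).
rewrite distrC (distrC x) (ger0_norm (_ : 0 <= y - x)) ?subr_ge0//.
apply: (@unit_interval_gluing (fun a b => `|f b - f a| <= M * (b - a))) => //.
- move=> a b c ab bc h1 h2.
  have -> : f c - f a = (f c - f b) + (f b - f a) by ring.
  apply: (le_trans (ler_normD _ _)); lra.
- by move=> a b; rewrite !pf (_ : b + 1 - (a + 1) = b - a)//; ring.
Qed.

(** Cauchy-Schwarz for two terms, in the form that lets the inequality of [H1] be
    glued along adjacent intervals. *)
Lemma CS_glue (x y l1 l2 a1 a2 : R) : 0 <= l1 -> 0 <= l2 -> 0 <= a1 -> 0 <= a2 ->
  x ^+ 2 <= l1 * a1 -> y ^+ 2 <= l2 * a2 -> (x + y) ^+ 2 <= (l1 + l2) * (a1 + a2).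
Proof.
move=> l10 l20 a10 a20 hx hy.
suff : 2 * (x * y) <= l1 * a2 + l2 * a1 by lra.
have h : (2 * (x * y)) ^+ 2 <= (l1 * a2 + l2 * a1) ^+ 2.
  have h1 : x ^+ 2 * y ^+ 2 <= (l1 * a1) * (l2 * a2).
    by apply: ler_pM => //; exact: sqr_ge0.
  have h2 : 0 <= (l1 * a2 - l2 * a1) ^+ 2 by exact: sqr_ge0.
  nra.
have q0 : 0 <= l1 * a2 + l2 * a1 by rewrite addr_ge0// mulr_ge0.
apply: le_trans (ler_norm _) _.
by rewrite -ler_sqr ?nnegrE// real_normK ?num_real.
Qed.

(** The distribution function given on one period is extended quasi-periodically. *)
Lemma periodic_H1 f A M : periodic1 f -> (forall a b, a <= b -> A a <= A b) ->
  A 1 - A 0 = M ^+ 2 ->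
  (forall a b, 0 <= a -> a <= b -> b <= 1 ->
    (f b - f a) ^+ 2 <= (b - a) * (A b - A a)) -> H1 M f.
Proof.
move=> pf ndA A10 base.
pose B x := (Num.floor x)%:~R * M ^+ 2 + A (x - (Num.floor x)%:~R).
have B1 x : B (x + 1) = B x + M ^+ 2.
  by rewrite /B floorD1E rmorphD/= (_ : x + 1 - _ = x - (Num.floor x)%:~R); ring.
have BA x : 0 <= x -> x <= 1 -> B x = A x.
  move=> x0; rewrite le_eqVlt => /predU1P[->|x1].
    by rewrite /B floor1 subrr mul1r -A10 subrK.
  have fx : Num.floor x = 0.
    by apply: floor_def; rewrite /= x0 add0r.
  by rewrite /B fx mul0r add0r subr0.
exists B; split => //.
suff H : forall a b, a <= b -> B a <= B b /\ (f b - f a) ^+ 2 <= (b - a) * (B b - B a).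
  by move=> a b /H[].
apply: (@unit_interval_gluing (fun a b => B a <= B b /\
    (f b - f a) ^+ 2 <= (b - a) * (B b - B a))).
- move=> a b c ab bc [B1' h1] [B2' h2]; split; first exact: le_trans B2'.
  have -> : f c - f a = (f b - f a) + (f c - f b) by ring.
  have -> : c - a = (b - a) + (c - b) by ring.
  have -> : B c - B a = (B b - B a) + (B c - B b) by ring.
  by apply: CS_glue => //; rewrite subr_ge0.
- move=> a b; rewrite !pf !B1 lerD2r.
  have -> : b + 1 - (a + 1) = b - a by ring.
  by have -> : B b + M ^+ 2 - (B a + M ^+ 2) = B b - B a by ring.
- move=> a b a0 ab b1; rewrite !BA ?(le_trans a0 ab)// ?(le_trans ab b1)//.
  by split; [exact: ndA|exact: base].
Qed.

Lemma itg_CS u a b : a <= b -> locint u -> locint (fun x => u x ^+ 2) ->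
  itg a b u ^+ 2 <= (b - a) * itg a b (fun x => u x ^+ 2).
Proof.
rewrite le_eqVlt => /predU1P[->|ab] lu lu2.
  by rewrite !itgxx expr0n mulr0.
have ba : 0 < b - a by rewrite subr_gt0.
(* the mean of [u]: the variance is nonnegative *)
pose l := itg a b u / (b - a).
have lc : locint (fun=> l ^+ 2) by exact: locint_cst.
have lZ : locint (fun x => (- (2 * l)) * u x).
  exact: locintZ.
have : 0 <= itg a b (fun x => (u x - l) ^+ 2) by apply: itg_ge0 => x; exact: sqr_ge0.
rewrite (@eq_itg _ _ _ _ (fun x => (u x ^+ 2 + (- (2 * l)) * u x) + l ^+ 2)); last first.
  by move=> x _; ring.
rewrite itgD//; last exact: locintD.
rewrite itgD// itgZ// (itg_cst _ (ltW ab)) => h.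
rewrite -subr_ge0; set I := itg a b (fun x => u x ^+ 2) in h *.
have -> : (b - a) * I - itg a b u ^+ 2 =
    (b - a) * (I + - (2 * l) * itg a b u + l ^+ 2 * (b - a)).
  by rewrite /l; field; exact: lt0r_neq0.
by rewrite mulr_ge0// ltW.
Qed.

Lemma Lpnorm2E w : Lpnorm (@unit_cell R) 2%:E w =
  ((\int[mu]_(x in [set` `[0, 1]%R]) (w x ^+ 2)%:E) `^ 2^-1)%E.
Proof.
rewrite /Lpnorm unlock /=; congr (_ `^ _)%E.
rewrite [RHS]integral_mkcond; apply: eq_integral => x _.
rewrite /= patchE /patch /unit_cell; case: ifP => _ /=.
  by rewrite powR_mulrn// real_normK// num_real.
by rewrite [point](_ : _ = 0)// normr0 powR0// pnatr_eq0.
Qed.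

Lemma sqr_integral_ge0 w : (0 <= \int[mu]_(x in [set` `[0, 1]%R]) (w x ^+ 2)%:E)%E.
Proof. by apply: integral_ge0 => x _; rewrite lee_fin sqr_ge0. Qed.

Lemma Lpnorm2_le w M : 0 <= M ->
  (\int[mu]_(x in [set` `[0, 1]%R]) (w x ^+ 2)%:E <= (M ^+ 2)%:E)%E ->
  (Lpnorm (@unit_cell R) 2%:E w <= M%:E)%E.
Proof.
move=> M0 h; rewrite Lpnorm2E.
have -> : M%:E = ((M ^+ 2)%:E `^ 2^-1)%E.
  by rewrite poweR_EFin powR12_sqrt ?sqr_ge0// sqrtr_sqr ger0_norm.
by apply: gt0_ler_poweR => //; rewrite in_itv/= ?andbT ?sqr_integral_ge0 ?lee_fin ?sqr_ge0 ?leey.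
Qed.

Lemma Lpnorm2_fin w : (Lpnorm (@unit_cell R) 2%:E w < +oo)%E ->
  exists M, [/\ 0 <= M, Lpnorm (@unit_cell R) 2%:E w = M%:E &
   (\int[mu]_(x in [set` `[0, 1]%R]) (w x ^+ 2)%:E = (M ^+ 2)%:E)%E].
Proof.
rewrite Lpnorm2E; have := sqr_integral_ge0 w.
case: (\int[mu]_(x in _) _)%E => [r| |//]; rewrite ?lee_fin => r0; last first.
  by rewrite poweRyr ?invr_eq0 ?pnatr_eq0.
move=> _.
exists (Num.sqrt r); split; first exact: sqrtr_ge0.
  by rewrite poweR_EFin powR12_sqrt.
by rewrite sqr_sqrtr.
Qed.

Lemma measurable_sqr w : measurable_fun setT w ->
  measurable_fun ([set` `[0, 1]%R] : set R) (fun x => (w x ^+ 2)%:E).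
Proof.
move=> mw; apply/measurable_EFinP; apply: (measurable_funS measurableT) => //.
exact: measurable_funX.
Qed.

Lemma Lpnorm2_ae v w : measurable_fun setT v -> measurable_fun setT w ->
  {ae mu, forall x, v x = w x} ->
  Lpnorm (@unit_cell R) 2%:E v = Lpnorm (@unit_cell R) 2%:E w.
Proof.
move=> mv mw vw; rewrite !Lpnorm2E; congr (_ `^ _)%E.
apply: ae_eq_integral => //; try exact: measurable_sqr.
by move: vw; apply: ae_mono => x -> _.
Qed.

Lemma Lpnorm2_continuous v : continuous v ->
  Lpnorm (@unit_cell R) 2%:E v = (Num.sqrt (sqn v))%:E.
Proof.
move=> cv; rewrite Lpnorm2E.
have lv : locint (fun x => v x ^+ 2) by apply: locint_continuous; exact: continuous_sqr.
have fin : (\int[mu]_(x in [set` `[0, 1]%R]) (v x ^+ 2)%:E)%E \is a fin_num.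
  by apply: integrable_fin_num => //; exact: (locint_itv _ _ lv).
by rewrite -(fineK fin) poweR_EFin powR12_sqrt// fine_ge0// sqr_integral_ge0.
Qed.

End gluing.

(** * Sobolev spaces on the torus *)

Section sobolev_torus.
Variable R : realType.
Notation mu := (@lebesgue_measure R).
Implicit Types (f g h u v w phi psi G W A : R -> R) (a b c x N M e : R) (i j k m n : nat).

(** Real value of the seminorm, meaningful when the latter is finite, as it is on
    [HT k]. *)
Definition snorm k v : R := fine (seminormT k 2%:E v).

Lemma HT_weak m v : HT m v -> [/\ is_weak_deriv m v (weak_deriv m v),
  measurable_fun setT (weak_deriv m v), 0 <= snorm m v,
  seminormT m 2%:E v = (snorm m v)%:E &
  (\int[mu]_(x in [set` `[0, 1]%R]) (weak_deriv m v x ^+ 2)%:E =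
    (snorm m v ^+ 2)%:E)%E].
Proof.
move=> [_ [_ /(_ m (leqnn _)) [g [Hg gfin]]]].
have HW : is_weak_deriv m v (weak_deriv m v) by apply: weak_deriv_spec; exists g.
have mW : measurable_fun setT (weak_deriv m v) by case: HW => _ /locint_measurable.
have [|M [M0 WM IM]] := @Lpnorm2_fin R (weak_deriv m v).
  rewrite (@Lpnorm2_ae R _ g)//; last exact: weak_deriv_ae.
  by case: Hg => _ /locint_measurable.
have snM : snorm m v = M by rewrite /snorm /seminormT /seminorm WM.
by split; rewrite ?snM.
Qed.

Lemma periodic_derive1n m v : periodic1 v -> periodic1 (derive1n m v).
Proof. by move=> pv; elim: m => [//|m IH]; rewrite derive1nS; exact: periodic_derive1. Qed.

(** Membership in H^(m+1)(T) gives classical derivatives up to order [m] and, by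
    Cauchy-Schwarz, the increment bound for the last one, the controlling measure
    being the square of the weak derivative. *)
Lemma HT_elim m v : HT m.+1 v -> [/\ periodic1 v, continuous v,
  forall k, (k < m)%N -> forall x, derivable (derive1n k v) x 1,
  0 <= snorm m.+1 v /\ seminormT m.+1 2%:E v = (snorm m.+1 v)%:E &
  H1 (snorm m.+1 v) (derive1n m v)].
Proof.
move=> HTv; have [HW mW s0 sE IM] := HT_weak HTv.
have [pv [/(_ isT) cv Hv]] := HTv.
have [dv av] := weak_regular cv (fun j jm => let: ex_intro g Hg := Hv j jm in
   ex_intro _ g Hg.1).
set W := weak_deriv m.+1 v.
have [_ lW _] := HW; have aW := av _ HW.
split; [exact: pv|exact: cv|exact: dv|by split|].
pose I01 := [set` `[0, 1]%R] : set R.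
pose W1 x := W x * \1_I01 x.
have W1E x : 0 <= x <= 1 -> W1 x = W x.
  by move=> x01; rewrite /W1 indicE mem_set ?mulr1//= /I01/= in_itv/=.
have mW1 : measurable_fun setT W1.
  by apply: measurable_funM => //; apply: measurable_indic; exact: measurable_itv.
have lW1 : locint W1.
  apply: (locint_le mW1 _ lW) => x; rewrite /W1 normrM; apply: ler_piMr => //.
  by rewrite indicE; case: (_ \in _); rewrite ?normr1 ?normr0.
have lW2 : locint (fun x => W1 x ^+ 2).
  apply: locint_of_itv; first exact: measurable_funX.
  move=> N; apply/integrableP; split.
    by apply/measurable_EFinP; apply: (measurable_funS measurableT) => //; exact: measurable_funX.
  apply: (@le_lt_trans _ _ (\int[mu]_x (W1 x ^+ 2)%:E)%E).
    under eq_integral do rewrite /= ger0_norm ?sqr_ge0//.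
    apply: ge0_subset_integral => //.
    - by apply/measurable_EFinP; exact: measurable_funX.
    - by move=> x _; rewrite lee_fin sqr_ge0.
  have -> : (\int[mu]_x (W1 x ^+ 2)%:E = \int[mu]_(x in I01) (W x ^+ 2)%:E)%E.
    rewrite [RHS]integral_mkcond; apply: eq_integral => x _.
    rewrite patchE /W1 indicE; case: ifP => _; first by rewrite mulr1.
    by rewrite mulr0 expr0n.
  by rewrite IM ltry.
pose A := prim (fun x => W1 x ^+ 2).
have aA := prim_antider lW2.
apply: (@periodic_H1 _ _ A).
- exact: periodic_derive1n.
- move=> a b ab; rewrite -subr_ge0 aA//; apply: itg_ge0 => x; exact: sqr_ge0.
- rewrite aA// /itg /Rintegral -[RHS]/(fine (snorm m.+1 v ^+ 2)%:E) -IM; congr fine.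
  apply: eq_integral => x; rewrite inE/= in_itv/= => x01; by rewrite W1E.
- move=> a b a0 ab b1; rewrite aW// aA//.
  have E : itg a b W = itg a b W1.
    apply: eq_itg => x /andP[ax xb]; rewrite W1E//; lra.
  by rewrite E; exact: itg_CS.
Qed.

(** Converse of [HT_elim]: the density given by [riesz] is the missing weak
    derivative, with the right L^2 norm. *)
Lemma HT_intro m v M : periodic1 v -> 0 <= M ->
  (forall k, (k < m)%N -> forall x, derivable (derive1n k v) x 1) ->
  H1 M (derive1n m v) -> HT m.+1 v /\ snorm m.+1 v <= M.
Proof.
move=> pv M0 dv Hv.
have [G [lG aG GM]] := riesz (periodic_derive1n m pv) M0 Hv.
have [wj wG] := classical_weak_deriv dv lG aG.
have cj j : (j <= m)%N -> continuous (derive1n j v).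
  rewrite leq_eqVlt => /predU1P[->|jm]; first exact: H1_continuous M0 Hv.
  by apply: derivable_cont; exact: dv.
have GM' := Lpnorm2_le M0 GM.
have HTv : HT m.+1 v.
  split => //; split => [_|j]; first exact: (cj 0%N).
  rewrite leq_eqVlt => /predU1P[->|jm].
    by exists G; split => //; apply: le_lt_trans GM' _; rewrite ltry.
  exists (derive1n j v); split; first exact: wj.
  by rewrite Lpnorm2_continuous ?ltry//; exact: cj.
split => //; have [_ _ _ [_ snE] _] := HT_elim HTv.
rewrite -lee_fin -snE; apply: le_trans GM'.
rewrite /seminormT /seminorm (@Lpnorm2_ae R _ G)//.
- have [_ l _] : is_weak_deriv m.+1 v (weak_deriv m.+1 v).
    by apply: weak_deriv_spec; exists G.
  exact: locint_measurable.
- exact: locint_measurable.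
- exact: weak_deriv_ae.
Qed.

Lemma is_weak_derivD k v w g h : is_weak_deriv k v g -> is_weak_deriv k w h ->
  is_weak_deriv k (fun x => v x + w x) (fun x => g x + h x).
Proof.
move=> [lv lg Hv] [lw lh Hw]; split; try exact: locintD.
move=> phi tphi.
have [sphi [N sN]] := (test_functionP _).1 tphi.
have skN : exists N', supp (derive1n k phi) N'.
  elim: k {Hv Hw} => [|k [N' IH]]; first by exists N.
  by exists (N' + 1); rewrite derive1nS; exact: supp_derive1.
have [N' sN'] := skN.
have cphi := smooth_continuous sphi.
have ckphi : continuous (derive1n k phi).
  by apply: derivable_cont; exact: smooth_derivable.
rewrite (Rintegral_supp _ sN') (Rintegral_supp _ sN).
under eq_fun do rewrite mulrDl.
under [X in _ = _ * itg _ _ X]eq_fun do rewrite mulrDl.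
rewrite !itgD; try exact: locintM_continuous.
by rewrite -!(Rintegral_supp _ sN') -!(Rintegral_supp _ sN) Hv// Hw// mulrDr.
Qed.

Lemma snorm_pythagoras m v w : HT m.+1 v -> HT m.+1 w ->
  \int[mu]_(y in @unit_cell R) (weak_deriv m.+1 v y * weak_deriv m.+1 w y) = 0 ->
  snorm m.+1 (fun x => v x + w x) ^+ 2 = snorm m.+1 v ^+ 2 + snorm m.+1 w ^+ 2.
Proof.
move=> Hv Hw ort.
have [wv _ _ _ Iv] := HT_weak Hv.
have [ww _ _ _ Iw] := HT_weak Hw.
set Mv := snorm m.+1 v in Iv *; set Mw := snorm m.+1 w in Iw *.
set a := weak_deriv m.+1 v in wv Iv ort; set b := weak_deriv m.+1 w in ww Iw ort.
have wvw := is_weak_derivD wv ww.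
have [_ la _] := wv; have [_ lb _] := ww; have [_ lab _] := wvw.
have ma := locint_measurable la; have mb := locint_measurable lb.
have isq (z : R -> R) M : measurable_fun setT z ->
   (\int[mu]_(x in [set` `[0, 1]%R]) (z x ^+ 2)%:E = (M ^+ 2)%:E)%E ->
   mu.-integrable [set` `[0, 1]%R] (EFin \o (fun x => z x ^+ 2)).
  move=> mz Iz; apply/integrableP; split; first exact: measurable_sqr.
  by under eq_integral do rewrite /= ger0_norm ?sqr_ge0//; rewrite Iz ltry.
have ia := isq _ _ ma Iv; have ib := isq _ _ mb Iw.
have iD (y z : R -> R) : mu.-integrable [set` `[0, 1]%R] (EFin \o y) ->
    mu.-integrable [set` `[0, 1]%R] (EFin \o z) ->
    mu.-integrable [set` `[0, 1]%R] (EFin \o (fun x => y x + z x)).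
  by move=> iy iz; have := @integrableD _ _ R mu _ _ _ _ iy iz; apply.
have iab : mu.-integrable [set` `[0, 1]%R] (EFin \o (fun x => a x * b x)).
  apply: (@le_integrable _ _ _ mu _ _ _ (EFin \o (fun x => a x ^+ 2 + b x ^+ 2))) => //.
  - apply/measurable_EFinP; apply: (measurable_funS measurableT) => //.
    exact: measurable_funM.
  - move=> x _; rewrite /= lee_fin [leRHS]ger0_norm; last by rewrite addr_ge0// sqr_ge0.
    rewrite normrM -[a x ^+ 2]real_normK ?num_real// -[b x ^+ 2]real_normK ?num_real//.
    have := sqr_ge0 (`|a x| - `|b x|); have := normr_ge0 (a x); have := normr_ge0 (b x); nra.
  - exact: iD.
have lE : Lpnorm (@unit_cell R) 2%:E (weak_deriv m.+1 (fun x => v x + w x)) =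
    Lpnorm (@unit_cell R) 2%:E (fun x => a x + b x).
  apply: Lpnorm2_ae.
  - have [_ l _] : is_weak_deriv m.+1 (fun x => v x + w x) (weak_deriv m.+1 (fun x => v x + w x)).
      by apply: weak_deriv_spec; exists (fun x => a x + b x).
    exact: locint_measurable.
  - exact: locint_measurable.
  - exact: weak_deriv_ae.
have I2 : (\int[mu]_(x in [set` `[0, 1]%R]) ((a x + b x) ^+ 2)%:E = (Mv ^+ 2 + Mw ^+ 2)%:E)%E.
  have i2 : mu.-integrable [set` `[0, 1]%R] (EFin \o (fun x => 2 * (a x * b x))).
    exact: (integrableZl _ 2 iab).
  have E : Rintegral mu [set` `[0, 1]%R] (fun x => (a x ^+ 2 + b x ^+ 2) + 2 * (a x * b x)) =
      Mv ^+ 2 + Mw ^+ 2.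
    rewrite RintegralD//; last exact: iD.
    rewrite RintegralD// RintegralZl// [X in 2 * X]ort mulr0 addr0.
    by rewrite /Rintegral Iv Iw.
  rewrite -E /Rintegral fineK; last first.
    apply: integrable_fin_num => //.
    by apply: (iD _ _ (iD _ _ ia ib) i2).
  by apply: eq_integral => x _; congr (_%:E); ring.
rewrite {1}/snorm /seminormT /seminorm lE Lpnorm2E I2 poweR_EFin powR12_sqrt.
  by rewrite sqr_sqrtr// addr_ge0// sqr_ge0.
by rewrite addr_ge0// sqr_ge0.
Qed.

Lemma lebesgue_setT_gt0 : (0 < mu [set: R])%E.
Proof.
apply: (@lt_le_trans _ _ (mu [set` `[0, 1]%R])).
  by rewrite lebesgue_measure_itv/= lte_fin ltr01 -EFinB lte_fin subr0 ltr01.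
by apply: le_measure => //; rewrite inE.
Qed.

Lemma ae_conj (P Q : R -> Prop) : {ae mu, forall x, P x} ->
  {ae mu, forall x, Q x} -> {ae mu, forall x, P x /\ Q x}.
Proof.
move=> hP hQ; have := negligibleU hP hQ; apply: negligibleS => x /= nPQ.
by have [Px|nP] := pselect (P x); [right => Qx; apply: nPQ|left].
Qed.

Lemma Lpnormy_ae (D : set R) w M : (Lpnorm D +oo%E w <= M%:E)%E ->
  {ae mu, forall x, D x -> `|w x| <= M}.
Proof.
rewrite /Lpnorm unlock /= lebesgue_setT_gt0 => /ess_supP.
apply: ae_mono => x + Dx; by rewrite /= patchE mem_set// lee_fin.
Qed.

Lemma ae_bounded_itg (D : set R) w M a b : locint w -> a <= b -> 0 <= M ->
  {ae mu, forall x, D x -> `|w x| <= M} -> (forall x, a <= x <= b -> D x) ->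
  `|itg a b w| <= M * (b - a).
Proof.
move=> lw ab M0 wM DI; apply: (le_trans (ler_norm_itg _ _ lw)).
rewrite -itg_cst// /itg /Rintegral; apply: fine_le.
- by apply: integrable_fin_num => //; exact: (locint_itv _ _ (locint_norm lw)).
- apply: integrable_fin_num => //; apply: locint_itv.
  exact: locint_cst.
apply: ae_ge0_le_integral => //.
- by apply/measurable_EFinP; apply: measurable_funS (locint_measurable (locint_norm lw)).
- by move: wM; apply: ae_mono => x Hx; rewrite /= in_itv/= => /DI /Hx; rewrite lee_fin.
Qed.

(** A continuous function is bounded at a point by the means over short intervals
    to the right of it; used to read off pointwise bounds from essential ones. *)
Lemma itg_bounded_pt phi M x d : continuous phi -> 0 < d ->
  (forall b, x <= b -> b <= x + d -> `|itg x b phi| <= M * (b - x)) -> `|phi x| <= M.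
Proof.
move=> cphi d0 H; apply/ler_addgt0Pr => e e0.
have near_x : \forall y \near x, `|phi x - phi y| <= e.
  by have /cvgrPdist_le := cphi x; apply.
have [r /= r0 Hr] := (nbhs_ballP _ _).1 near_x.
pose t := Num.min d (r / 2).
have t0 : 0 < t by rewrite lt_min d0 divr_gt0.
have lphi := locint_continuous cphi.
have lc (c : R) : locint (fun=> c) by exact: locint_cst.
have xt : x <= x + t by rewrite lerDl ltW.
have h1 : `|itg x (x + t) phi| <= M * t.
  have := H (x + t) xt; rewrite (_ : x + t - x = t); last ring.
  by apply; rewrite lerD2l ge_min lexx.
have h2 : `|itg x (x + t) (fun y => phi x - phi y)| <= e * t.
  have -> : e * t = itg x (x + t) (fun=> e) by rewrite itg_cst//; ring.
  have lB : locint (fun y => phi x - phi y) by exact: locintB.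
  apply: (le_trans (ler_norm_itg _ _ lB)).
  apply: le_itg => //; first exact: locint_norm.
  move=> y /andP[xy yt]; apply: Hr; rewrite /ball/= ler0_norm ?subr_le0// opprB.
  have : t <= r / 2 by rewrite ge_min lexx orbT.
  lra.
have E : phi x * t = itg x (x + t) phi + itg x (x + t) (fun y => phi x - phi y).
  by rewrite itgB// itg_cst//; ring.
have : `|phi x| * t <= (M + e) * t.
  rewrite -[X in _ * X <= _](gtr0_norm t0) -normrM E mulrDl.
  by apply: (le_trans (ler_normD _ _)); rewrite lerD.
by rewrite ler_pM2r.
Qed.

Lemma periodic_shiftz f (z : int) x : periodic1 f -> f (x + z%:~R) = f x.
Proof.
move=> pf; case: z => n; first exact: periodic_shiftn.
by rewrite NegzE mulrNz -[LHS](periodic_shiftn pf n.+1) -pmulrn subrK.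
Qed.

Lemma CL_intro m : forall v M,
  (forall k, (k < m)%N -> forall x, derivable (derive1n k v) x 1) ->
  (forall j, (j <= m)%N -> bnd M (derive1n j v)) -> lip M (derive1n m v) -> CL m v M.
Proof.
elim: m => [|m IH] v M dv bv lv; first by split; [exact: (bv 0%N)|].
split; [exact: (bv 0%N)|exact: (dv 0%N)|].
apply: IH => [k km|j jm|]; rewrite -derive1Sn//; first exact: dv.
exact: bv.
Qed.

(** Bounds of weak derivatives that hold almost everywhere in [D] become bounds
    of integrals over subintervals of [D], a form that does not see null sets. *)
Lemma weak_sup_bounded (D : set R) m v M : continuous v -> 0 <= M ->
  (forall j, (j <= m.+1)%N -> exists g, is_weak_deriv j v g) ->
  (forall j, (j <= m.+1)%N -> (seminorm D j +oo%E v <= M%:E)%E) ->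
  [/\ forall k, (k < m)%N -> forall x, derivable (derive1n k v) x 1,
    forall j, (j <= m)%N -> continuous (derive1n j v),
    forall j a b, (j <= m)%N -> a <= b -> (forall x, a <= x <= b -> D x) ->
      `|itg a b (derive1n j v)| <= M * (b - a) &
    forall a b, a <= b -> (forall x, a <= x <= b -> D x) ->
      `|derive1n m v b - derive1n m v a| <= M * (b - a)].
Proof.
move=> cv M0 wv sv.
have [dv av] := weak_regular cv wv.
have HW := weak_deriv_spec (wv m.+1 (leqnn _)).
have [_ lW _] := HW; have aW := av _ HW.
have cj j : (j <= m)%N -> continuous (derive1n j v).
  rewrite leq_eqVlt => /predU1P[->|jm]; first exact: antider_continuous aW.
  by apply: derivable_cont; exact: dv.
split => //.
- move=> j a b jm ab DI.
  apply: (@ae_bounded_itg D) => //; first by apply: locint_continuous; exact: cj.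
  have [wj _] := classical_weak_deriv dv lW aW.
  have h1 := Lpnormy_ae (sv j (leqW jm)).
  have h2 := weak_deriv_ae (wj j jm).
  have : {ae mu, forall x, (D x -> `|weak_deriv j v x| <= M) /\
      weak_deriv j v x = derive1n j v x}.
    exact: (ae_conj h1 h2).
  by apply: ae_mono => x [h <-].
- move=> a b ab DI; rewrite aW//.
  by apply: (@ae_bounded_itg D) => //; exact: Lpnormy_ae (sv m.+1 (leqnn _)).
Qed.

Lemma Wspace_line_CL s f M : Wspace setT s.+1 +oo%E f ->
  Wnorm setT s.+1 +oo%E f = M%:E -> CL s f M.
Proof.
move=> [/(_ isT) cf wf] fM.
have sf j : (j <= s.+1)%N -> (seminorm setT j +oo%E f <= M%:E)%E.
  move=> js; rewrite -fM /Wnorm.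
  exact: (@le_bigmax _ _ _ _ (fun j : 'I_s.+2 => seminorm setT j +oo%E f) (Ordinal (js : (j < s.+2)%N))).
have M0 : 0 <= M.
  rewrite -lee_fin; apply: le_trans (sf 0%N isT); exact: Lnorm_ge0.
have [|df cdf bf lf] := @weak_sup_bounded setT s f M cf M0 _ sf.
  by move=> j /wf[g [Hg _]]; exists g.
apply: CL_intro => //.
- move=> j js x; apply: (itg_bounded_pt (cdf j js) ltr01) => b xb _.
  exact: bf.
- move=> x y; wlog xy : x y / x <= y.
    by move=> S; have [/S//|/ltW/S] := leP x y; rewrite distrC (distrC y).
  by rewrite distrC (distrC x) (ger0_norm (_ : 0 <= y - x)) ?subr_ge0//; exact: lf.
Qed.

(** The essential suprema are over one closed period, hence the reduction of a
    point to the half-open period and of an interval by gluing. *)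
Lemma Wspace_torus_CL s v M : periodic1 v -> continuous v ->
  (forall j, (j <= s.+1)%N -> exists g, is_weak_deriv j v g) ->
  (normT s.+1 +oo%E v <= M%:E)%E -> CL s v M.
Proof.
move=> pv cv wv vM.
have sv j : (j <= s.+1)%N -> (seminorm (@unit_cell R) j +oo%E v <= M%:E)%E.
  move=> js; apply: le_trans vM; rewrite /normT /Wnorm.
  exact: (@le_bigmax _ _ _ _ (fun j : 'I_s.+2 => seminorm (@unit_cell R) j +oo%E v) (Ordinal (js : (j < s.+2)%N))).
have M0 : 0 <= M.
  rewrite -lee_fin; apply: le_trans (sv 0%N isT); exact: Lnorm_ge0.
have [dv cdv bv lv] := @weak_sup_bounded (@unit_cell R) s v M cv M0 wv sv.
have pj j := periodic_derive1n j pv.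
apply: CL_intro => //.
- move=> j js x.
  have -> : derive1n j v x = derive1n j v (x - (Num.floor x)%:~R).
    by rewrite -[in LHS](subrK (Num.floor x)%:~R x) periodic_shiftz.
  have := floor_le x; have := floorD1_gt x; rewrite rmorphD/= => h1 h2.
  set z := x - _.
  have z0 : 0 <= z by rewrite /z subr_ge0.
  have z1 : 0 < 1 - z by rewrite /z; lra.
  apply: (itg_bounded_pt (cdv j js) z1) => b zb b1.
  apply: bv => // y /andP[zy yb]; rewrite /unit_cell/= in_itv/=; apply/andP; split; lra.
- apply: periodic_lip => // a b a0 ab b1; apply: lv => // y /andP[ay yb].
  by rewrite /unit_cell/= in_itv/=; apply/andP; split; lra.
Qed.

End sobolev_torus.

(** * Sobolev norms and the weighted energy *)

Section torus_classes.
Variable R : realType.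
Notation mu := (@lebesgue_measure R).
Implicit Types (f g h u v w : R -> R) (a b c x N M e : R) (i j k m n : nat).

Lemma derive1_shift_fun f c : (forall x, derivable f x 1) ->
  (forall x, derivable (fun x => f (x + c)) x 1) /\
  (fun x => f (x + c))^`() = (fun x => f^`() (x + c)).
Proof.
move=> df.
have da x : derivable (fun x => x + c) x 1.
  by have := @derivable_affine R 1 c x; under eq_fun do rewrite mul1r.
have Da : (fun x => x + c)^`() = (fun=> 1).
  by have := @derive1_affine R 1 c; under eq_fun do rewrite mul1r.
have [d1 d2] := derive1_comp_fun df da.
by split => //; rewrite d2 Da; apply/funext => x; rewrite mulr1.
Qed.

Lemma Hd_shift m : forall f c M, Hd m f M -> Hd m (fun x => f (x + c)) M.
Proof.
elim: m => [|m IH] f c M.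
  move=> [A [AM HA]]; exists (fun x => A (x + c)); split.
    by move=> x; rewrite addrAC AM.
  move=> a b ab; have := HA (a + c) (b + c); rewrite lerD2r => /(_ ab).
  by rewrite (_ : b + c - (a + c) = b - a)//; ring.
move=> [df bf Hf]; have [d1 d2] := derive1_shift_fun c df.
split => //; rewrite d2; last exact: IH.
by move=> x; exact: bf.
Qed.

Lemma CLD m : forall f g M N, CL m f M -> CL m g N ->
  CL m (fun x => f x + g x) (M + N).
Proof.
elim: m => [|m IH] f g M N.
  move=> [bf lf] [bg lg]; split => [|x y]; first exact: bndD.
  by rewrite opprD addrACA mulrDl; apply: (le_trans (ler_normD _ _)); exact: lerD.
move=> [bf df Hf] [bg dg Hg]; have [dfg fgE] := derive1D_fun df dg.
by split => //; [exact: bndD|rewrite fgE; exact: IH].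
Qed.

Lemma CLZ m : forall f c M, CL m f M -> CL m (fun x => c * f x) (`|c| * M).
Proof.
elim: m => [|m IH] f c M.
  move=> [bf lf]; split => [|x y]; first exact: bndZ.
  by rewrite -mulrBr normrM -mulrA ler_wpM2l.
move=> [bf df Hf]; have [dcf cfE] := derive1Z_fun c df.
by split => //; [exact: bndZ|rewrite cfE; exact: IH].
Qed.

Lemma CL_shift m : forall f c M, CL m f M -> CL m (fun x => f (x + c)) M.
Proof.
elim: m => [|m IH] f c M.
  move=> [bf lf]; split => [x|x y]; first exact: bf.
  by apply: (le_trans (lf _ _)); rewrite (_ : x + c - (y + c) = x - y)//; ring.
move=> [bf df Hf]; have [d1 d2] := derive1_shift_fun c df.
by split => //; rewrite d2; exact: IH.
Qed.

Lemma Hd_derivable m f M : Hd m f M ->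
  (forall k, (k < m)%N -> forall x, derivable (derive1n k f) x 1) /\
  H1 M (derive1n m f).
Proof.
elim: m f => [|m IH] f; first by split.
move=> [df _ /IH[d H]]; split.
  by move=> [_ x|k km x]; [exact: df|rewrite derive1Sn; exact: d].
by rewrite derive1Sn.
Qed.

Lemma HT_Hd m v : HT m.+1 v -> [/\ periodic1 v, continuous v, 0 <= snorm m.+1 v,
  seminormT m.+1 2%:E v = (snorm m.+1 v)%:E & Hd m v (snorm m.+1 v)].
Proof.
move=> /HT_elim[pv cv dv [s0 sE] Hv]; split => //.
by have [] := periodic_Hd pv s0 dv Hv.
Qed.

Lemma Hd_HT m v M : periodic1 v -> 0 <= M -> Hd m v M ->
  HT m.+1 v /\ snorm m.+1 v <= M.
Proof. by move=> pv M0 /Hd_derivable[dv Hv]; exact: HT_intro. Qed.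

Lemma HT_comb m a b v w : HT m.+1 v -> HT m.+1 w ->
  HT m.+1 (fun x => a * v x + b * w x) /\
  snorm m.+1 (fun x => a * v x + b * w x) <= `|a| * snorm m.+1 v + `|b| * snorm m.+1 w.
Proof.
move=> /HT_Hd[pv _ v0 _ Hv] /HT_Hd[pw _ w0 _ Hw]; apply: Hd_HT.
- by move=> x; rewrite pv pw.
- by rewrite addr_ge0// mulr_ge0.
- by apply: HdD; rewrite ?mulr_ge0//; exact: HdZ.
Qed.

Lemma HTD m v w : HT m.+1 v -> HT m.+1 w ->
  HT m.+1 (fun x => v x + w x) /\
  snorm m.+1 (fun x => v x + w x) <= snorm m.+1 v + snorm m.+1 w.
Proof.
move=> Hv Hw; have := HT_comb 1 1 Hv Hw; rewrite !normr1 !mul1r.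
by under eq_fun do rewrite !mul1r.
Qed.

Lemma HTB m v w : HT m.+1 v -> HT m.+1 w ->
  HT m.+1 (fun x => v x - w x) /\
  snorm m.+1 (fun x => v x - w x) <= snorm m.+1 v + snorm m.+1 w.
Proof.
move=> Hv Hw; have := HT_comb 1 (- 1) Hv Hw; rewrite normrN !normr1 !mul1r.
by under eq_fun do rewrite mul1r mulN1r.
Qed.

Lemma sqn_le_bnd v c : continuous v -> bnd c v -> sqn v <= c ^+ 2.
Proof.
move=> cv bv.
have -> : c ^+ 2 = itg 0 1 (fun=> c ^+ 2) by rewrite itg_cst//; ring.
apply: le_itg; first exact: locint_sqr.
  exact: locint_cst.
move=> x _; have := bv x; have := normr_ge0 (v x).
rewrite -[v x ^+ 2]real_normK ?num_real// !expr2 => *; exact: ler_pM.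
Qed.

Lemma sqn_ge_pt v c : continuous v -> 0 <= c -> (forall x, c <= `|v x|) ->
  c ^+ 2 <= sqn v.
Proof.
move=> cv c0 bv.
have -> : c ^+ 2 = itg 0 1 (fun=> c ^+ 2) by rewrite itg_cst//; ring.
apply: le_itg; last 1 first.
- by move=> x _; rewrite -[v x ^+ 2]real_normK ?num_real// !expr2 ler_pM.
- exact: locint_cst.
- exact: locint_sqr.
Qed.

Lemma sqn_dom v w (y : R -> R) a b : continuous v -> continuous w -> continuous y ->
  0 <= a -> 0 <= b ->
  (forall x, v x ^+ 2 <= a * w x ^+ 2 + b * y x ^+ 2) ->
  sqn v <= a * sqn w + b * sqn y.
Proof.
move=> cv cw cy a0 b0 H.
have lw := locint_sqr cw; have ly := locint_sqr cy.
rewrite /sqn -!itgZ// -itgD//; [|exact: locintZ|exact: locintZ].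
apply: le_itg => //; first exact: locint_sqr.
by apply: locintD; exact: locintZ.
Qed.

Lemma sqr_young (x y t : R) : 0 < t ->
  (x + y) ^+ 2 <= (1 + t) * x ^+ 2 + (1 + t^-1) * y ^+ 2.
Proof.
move=> t0.
have -> : (1 + t) * x ^+ 2 + (1 + t^-1) * y ^+ 2 =
    (x + y) ^+ 2 + t^-1 * (t * x - y) ^+ 2 by field; rewrite gt_eqF.
by rewrite lerDl mulr_ge0 ?sqr_ge0// invr_ge0 ltW.
Qed.

Lemma sqn_young v w t : continuous v -> continuous w -> 0 < t ->
  sqn (fun x => v x + w x) <= (1 + t) * sqn v + (1 + t^-1) * sqn w.
Proof.
move=> cv cw t0; apply: sqn_dom => //.
- by move=> x; apply: cvgD; [exact: cv|exact: cw].
- by rewrite addr_ge0// ltW.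
- by rewrite addr_ge0// invr_ge0 ltW.
- by move=> x; exact: sqr_young.
Qed.

Lemma sqnZ v c : continuous v -> sqn (fun x => c * v x) = c ^+ 2 * sqn v.
Proof.
move=> cv; rewrite /sqn -itgZ; last exact: locint_sqr.
by congr itg; apply/funext => x; rewrite exprMn.
Qed.

(** The mean square controls |v| somewhere, the oscillation controls the rest. *)
Lemma HT_HB m v : HT m.+1 v -> HB m v (Num.sqrt (sqn v) + snorm m.+1 v).
Proof.
move=> Hv; have [pv cv s0 _ Hdv] := HT_Hd Hv.
have n0 := sqrtr_ge0 (sqn v).
split; last by apply: Hd_mono Hdv; rewrite s0 lerDr.
move=> x; rewrite leNgt; apply/negP => lt.
pose c := `|v x| - snorm m.+1 v.
have [dv Hv1] := Hd_derivable Hdv.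
have [_ Hv0] := periodic_Hd pv s0 dv Hv1.
have cn : Num.sqrt (sqn v) < c by rewrite /c ltrBrDr.
have : c ^+ 2 <= sqn v.
  apply: sqn_ge_pt => //; first by rewrite (le_trans n0)// ltW.
  move=> y; rewrite /c lerBlDr -lerBlDl; apply: le_trans (lerB_dist _ _) _.
  exact: periodic_osc.
rewrite leNgt => /negP; apply.
by rewrite -[X in X < _]sqr_sqrtr ?sqn_ge0// !expr2 ltr_pM.
Qed.

Lemma norm2TE v : continuous v -> norm2T v = (Num.sqrt (sqn v))%:E.
Proof. exact: Lpnorm2_continuous. Qed.

Lemma norm_starE m v : HT m.+1 v ->
  norm_star m.+1 v = (Num.sqrt (sqn v + snorm m.+1 v ^+ 2))%:E.
Proof.
move=> /HT_Hd[_ cv _ sE _]; rewrite /norm_star norm2TE// sE.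
rewrite -!EFin_expe -EFinD poweR_EFin powR12_sqrt ?sqr_sqrtr ?sqn_ge0//.
by rewrite addr_ge0 ?sqn_ge0// sqr_ge0.
Qed.

Lemma norm_DeltaE m (h dt : R) v : 0 <= h -> 0 < dt -> HT m.+1 v ->
  norm_Delta m.+1 h dt v =
  (Num.sqrt (sqn v + h ^+ (2 * m.+1) / dt * snorm m.+1 v ^+ 2))%:E.
Proof.
move=> h0 dt0 /HT_Hd[_ cv _ sE _]; rewrite /norm_Delta norm2TE// sE.
rewrite -!EFin_expe -EFinM -EFinD poweR_EFin powR12_sqrt ?sqr_sqrtr ?sqn_ge0//.
by rewrite addr_ge0 ?sqn_ge0// mulr_ge0 ?sqr_ge0// divr_ge0 ?exprn_ge0// ltW.
Qed.

(** The square of the norm [norm_Delta] with the quotient h^(2s)/dt replaced by a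
    fixed weight. *)
Definition wenergy (th : R) m v := sqn v + th * snorm m.+1 v ^+ 2.

Lemma wenergy_ge0 th m v : 0 <= th -> 0 <= wenergy th m v.
Proof. by move=> t0; rewrite addr_ge0 ?sqn_ge0// mulr_ge0// sqr_ge0. Qed.

Lemma wenergy_young (th : R) m v w (t : R) : 0 <= th -> 0 < t -> HT m.+1 v -> HT m.+1 w ->
  wenergy th m (fun x => v x + w x) <= (1 + t) * wenergy th m v + (1 + t^-1) * wenergy th m w.
Proof.
move=> th0 t0 Hv Hw; have [_ cv v0 _ _] := HT_Hd Hv; have [_ cw w0 _ _] := HT_Hd Hw.
have [Hvw le] := HTD Hv Hw; have [_ _ vw0 _ _] := HT_Hd Hvw.
have h1 := sqn_young cv cw t0.
have h2 : snorm m.+1 (fun x => v x + w x) ^+ 2 <=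
    (1 + t) * snorm m.+1 v ^+ 2 + (1 + t^-1) * snorm m.+1 w ^+ 2.
  by apply: le_trans (sqr_young _ _ t0); rewrite !expr2 ler_pM.
move: h1 (ler_wpM2l th0 h2); rewrite /wenergy; clear; lra.
Qed.

Lemma wenergyZ th m v c : 0 <= th -> HT m.+1 v ->
  wenergy th m (fun x => c * v x) <= c ^+ 2 * wenergy th m v.
Proof.
move=> th0 Hv; have [_ cv v0 _ _] := HT_Hd Hv.
have [Hc le] := HT_comb c 0 Hv Hv; move: Hc le.
rewrite normr0 mul0r addr0; under eq_fun do rewrite mul0r addr0.
move=> Hc le; have [_ _ c0 _ _] := HT_Hd Hc.
rewrite /wenergy sqnZ// mulrDr lerD2l [leRHS]mulrCA ler_wpM2l//.
by rewrite -[c ^+ 2]real_normK ?num_real// -exprMn !expr2 ler_pM.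
Qed.

Lemma wenergy_bounds th m v : 1 <= th -> HT m.+1 v ->
  (Num.sqrt (sqn v) + snorm m.+1 v) ^+ 2 <= 2 * wenergy th m v /\
  snorm m.+1 v ^+ 2 <= wenergy th m v.
Proof.
move=> th1 Hv; have n0 := sqn_ge0 v.
have s2 := sqr_ge0 (snorm m.+1 v).
have h : snorm m.+1 v ^+ 2 <= th * snorm m.+1 v ^+ 2 by rewrite ler_peMl.
split; last by rewrite /wenergy; lra.
have := sqr_young (Num.sqrt (sqn v)) (snorm m.+1 v) (@ltr01 R).
rewrite sqr_sqrtr// invr1 /wenergy; lra.
Qed.

Lemma norm_star_wenergy th m v c : 1 <= th -> HT m.+1 v -> 0 <= c ->
  wenergy th m v <= c ^+ 2 -> (norm_star m.+1 v <= c%:E)%E.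
Proof.
move=> th1 Hv c0 Ec; rewrite norm_starE// lee_fin.
rewrite -(ger0_norm c0) -sqrtr_sqr; apply: ler_wsqrtr; apply: le_trans Ec.
have s2 := sqr_ge0 (snorm m.+1 v).
by rewrite /wenergy lerD2l ler_peMl.
Qed.

Lemma wenergy_norm_star th m v c : 1 <= th -> HT m.+1 v -> 0 <= c ->
  (norm_star m.+1 v <= c%:E)%E -> wenergy th m v <= th * c ^+ 2.
Proof.
move=> th1 Hv c0; rewrite norm_starE// lee_fin => h.
have p0 : 0 <= sqn v + snorm m.+1 v ^+ 2 by rewrite addr_ge0 ?sqn_ge0 ?sqr_ge0.
have : sqn v + snorm m.+1 v ^+ 2 <= c ^+ 2.
  by rewrite -[leLHS]sqr_sqrtr// !expr2 ler_pM ?sqrtr_ge0.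
have n0 := sqn_ge0 v; have s2 := sqr_ge0 (snorm m.+1 v).
rewrite /wenergy; move: (sqn v) (snorm m.+1 v ^+ 2) (c ^+ 2) n0 s2 {h p0} => x y z; nra.
Qed.

End torus_classes.

(** * Interpolation, translates and transport *)

Section operators.
Variable R : realType.
Notation mu := (@lebesgue_measure R).
Implicit Types (f g v w : R -> R) (a b c x N M e : R) (i j k m n : nat).
Implicit Types (Ih : (R -> R) -> (R -> R)) (p : nat -> R).

Lemma interpolation_facts m Nx p Ih : interpolation_operator m.+1 Nx p Ih ->
  [/\ forall v, HT m.+1 v -> HT m.+1 (Ih v),
      forall v w, HT m.+1 v -> HT m.+1 w ->
        Ih (fun x => v x - w x) = (fun x => Ih v x - Ih w x) &
      forall v, HT m.+1 v -> Ih (Ih v) = Ih v].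
Proof.
move=> [[HI lin] interp].
split => //.
- move=> v w Hv Hw; have := lin (- 1) w v Hw Hv.
  under eq_fun do rewrite mulN1r addrC.
  by move=> ->; apply/funext => x; rewrite mulN1r addrC.
- move=> v Hv; have HIv := HI _ Hv.
  by case: interp => -[uni rep]; apply: uni => //; exact: rep.
Qed.

(** With z = I - Ih, the error is z v + Ih (v - w) = (v - w) + z w.  The first
    form and [propP1] give its seminorm, the second its mean square: the bound
    of [propP2], applied to z w = z (z w), bounds the L^2 norm of z w by Cs h^s
    times its seminorm, hence by the seminorms of z v and z (v - w) times a small
    factor; the latter seminorm is what the projection gains in the first form. *)
Lemma interpolation_step m Nx p Ih (Cs h dt CD th : R) :
  interpolation_operator m.+1 Nx p Ih -> propP1 m.+1 Ih -> propP2 m.+1 Cs h Ih ->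
  0 < Cs -> 0 <= h -> 0 < dt <= 1 -> h ^+ (2 * m.+1) / dt <= CD ->
  4 * CD * Cs ^+ 2 <= th -> 0 <= th ->
  forall v w, HT m.+1 v -> HT m.+1 w ->
  HT m.+1 (fun x => v x - Ih w x) /\
  wenergy th m (fun x => v x - Ih w x) <=
  (1 + dt) * wenergy th m (fun x => v x - w x) +
  2 * th * snorm m.+1 (fun x => v x - Ih v x) ^+ 2.
Proof.
move=> /interpolation_facts[HI linI idI] P1 P2 Cs0 h0 /andP[dt0 dt1] hdt thC th0 v w Hv Hw.
pose z (y : R -> R) := fun x => y x - Ih y x.
have Hz y : HT m.+1 y -> HT m.+1 (z y) by move=> Hy; exact: (HTB Hy (HI _ Hy)).1.
have Iz y : HT m.+1 y -> Ih (z y) = (fun=> 0).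
  move=> Hy; rewrite /z linI//; last exact: HI.
  by apply/funext => x; rewrite idI// subrr.
have P2z y : HT m.+1 y -> sqn (z y) <= Cs ^+ 2 * h ^+ (2 * m.+1) * snorm m.+1 (z y) ^+ 2.
  move=> Hy; have [_ cz s0 sE _] := HT_Hd (Hz _ Hy).
  have := P2 _ (Hz _ Hy); rewrite sE.
  rewrite (_ : (z y \- Ih (z y)) = z y); last first.
    by apply/funext => x; rewrite /= Iz// subr0.
  rewrite norm2TE// -EFinM lee_fin => le.
  rewrite -[leLHS]sqr_sqrtr ?sqn_ge0// mulnC exprM -!exprMn.
  by rewrite !(expr2 (Num.sqrt _)) expr2 ler_pM ?sqrtr_ge0.
have pyth y1 y2 : HT m.+1 y1 -> HT m.+1 y2 ->
    snorm m.+1 (fun x => z y1 x + Ih y2 x) ^+ 2 = snorm m.+1 (z y1) ^+ 2 + snorm m.+1 (Ih y2) ^+ 2.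
  move=> H1 H2; apply: (snorm_pythagoras (Hz _ H1) (HI _ H2)).
  exact: (P1 _ _ H1 H2).
pose d x := v x - w x.
have [Hd _] : HT m.+1 d /\ _ := HTB Hv Hw.
have He := (HTB Hv (HI _ Hw)).1; split => //.
have e1 : (fun x => v x - Ih w x) = (fun x => z v x + Ih d x).
  by apply/funext => x; rewrite /z /d linI//; ring.
have e2 : (fun x => v x - Ih w x) = (fun x => d x + z w x).
  by apply/funext => x; rewrite /z /d; ring.
have e3 : z w = (fun x => z v x - z d x).
  by apply/funext => x; rewrite /z /d linI//; ring.
have e4 : d = (fun x => z d x + Ih d x) by apply/funext => x; rewrite /z; ring.
have s1 : snorm m.+1 (fun x => v x - Ih w x) ^+ 2 =
    snorm m.+1 (z v) ^+ 2 + snorm m.+1 (Ih d) ^+ 2 by rewrite e1 pyth.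
have s2 : snorm m.+1 d ^+ 2 = snorm m.+1 (z d) ^+ 2 + snorm m.+1 (Ih d) ^+ 2.
  by rewrite [in LHS]e4 pyth.
have s3 : snorm m.+1 (z w) ^+ 2 <= 2 * snorm m.+1 (z v) ^+ 2 + 2 * snorm m.+1 (z d) ^+ 2.
  have [_ le] := HTB (Hz _ Hv) (Hz _ Hd); move: le; rewrite -e3 => le.
  have [_ _ w0 _ _] := HT_Hd (Hz _ Hw).
  have := sqr_young (snorm m.+1 (z v)) (snorm m.+1 (z d)) (@ltr01 R); rewrite invr1.
  by apply: le_trans; rewrite !expr2 ler_pM.
have [_ cd _ _ _] := HT_Hd Hd; have [_ cz _ _ _] := HT_Hd (Hz _ Hw).
have n1 : sqn (fun x => v x - Ih w x) <= (1 + dt) * sqn d + (1 + dt^-1) * sqn (z w).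
  by rewrite e2; exact: sqn_young.
have n2 : (1 + dt^-1) * sqn (z w) <= th * (snorm m.+1 (z v) ^+ 2 + snorm m.+1 (z d) ^+ 2).
  have h2 : 0 <= h ^+ (2 * m.+1) by rewrite exprn_ge0.
  have i1 : 1 <= dt^-1 by rewrite invf_ge1.
  have k1 : (1 + dt^-1) * sqn (z w) <= 2 * dt^-1 * (Cs ^+ 2 * h ^+ (2 * m.+1) * snorm m.+1 (z w) ^+ 2).
    apply: ler_pM; [|exact: sqn_ge0| |exact: P2z]; move: i1; clear; lra.
  apply: (le_trans k1).
  have k2 : 2 * dt^-1 * (Cs ^+ 2 * h ^+ (2 * m.+1) * snorm m.+1 (z w) ^+ 2) =
     2 * Cs ^+ 2 * (h ^+ (2 * m.+1) / dt) * snorm m.+1 (z w) ^+ 2 by ring.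
  rewrite k2.
  have q0 : 0 <= 2 * Cs ^+ 2 by rewrite mulr_ge0// sqr_ge0.
  have k3 : 2 * Cs ^+ 2 * (h ^+ (2 * m.+1) / dt) * snorm m.+1 (z w) ^+ 2 <=
     2 * Cs ^+ 2 * CD * snorm m.+1 (z w) ^+ 2.
    by rewrite ler_wpM2r ?sqr_ge0// ler_wpM2l.
  apply: (le_trans k3).
  have CD0 : 0 <= CD by apply: le_trans hdt; rewrite divr_ge0// ltW.
  have q1 : 0 <= 2 * Cs ^+ 2 * CD by rewrite mulr_ge0.
  apply: (le_trans (ler_wpM2l q1 s3)).
  rewrite (_ : _ * (2 * _ + 2 * _) = (4 * CD * Cs ^+ 2) *
    (snorm m.+1 (z v) ^+ 2 + snorm m.+1 (z d) ^+ 2)); last by ring.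
  by rewrite ler_wpM2r// addr_ge0 ?sqr_ge0.
have q2 : 0 <= dt * (th * snorm m.+1 d ^+ 2) by rewrite mulr_ge0 ?(ltW dt0)// mulr_ge0 ?sqr_ge0.
rewrite /wenergy s1 -/d -/(z v).
have k4 : th * snorm m.+1 d ^+ 2 = th * snorm m.+1 (z d) ^+ 2 + th * snorm m.+1 (Ih d) ^+ 2.
  by rewrite s2 mulrDr.
move: n1 n2 q2 k4; rewrite !mulrDr !mulrDl; clear; lra.
Qed.

Section translates.
Variables (c : R).
Implicit Types (L : seq (R * R)).
Let S L v := fun x => \sum_(gl <- L) gl.1 * v (x + gl.2 * c).

Lemma translates_Hd L m v M : 0 <= M -> Hd m v M ->
  Hd m (S L v) ((\sum_(gl <- L) `|gl.1|) * M).
Proof.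
move=> M0 Hv; rewrite /S; elim: L => [|gl L IH].
  rewrite big_nil mul0r; under eq_fun do rewrite big_nil.
  by have := HdZ 0 M0 Hv; rewrite normr0 mul0r; under eq_fun do rewrite mul0r.
rewrite big_cons mulrDl; under eq_fun do rewrite big_cons.
apply: HdD => //; try by rewrite mulr_ge0// sumr_ge0.
by apply: HdZ => //; exact: Hd_shift.
Qed.

Lemma translates_CL L m v M : CL m v M ->
  CL m (S L v) ((\sum_(gl <- L) `|gl.1|) * M).
Proof.
move=> Hv; rewrite /S; elim: L => [|gl L IH].
  rewrite big_nil mul0r; under eq_fun do rewrite big_nil.
  by have := CLZ 0 Hv; rewrite normr0 mul0r; under eq_fun do rewrite mul0r.
rewrite big_cons mulrDl; under eq_fun do rewrite big_cons.
by apply: CLD => //; apply: CLZ => //; exact: CL_shift.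
Qed.

End translates.

Section dispersion.
Variables (T nu : R) (Lambda : {fset R * R}).

Definition SD_bound : R := \sum_(gl <- Lambda) `|gl.1|.

Lemma SD_bound_ge0 : 0 <= SD_bound.
Proof. by rewrite sumr_ge0. Qed.

Lemma SD_periodic dt v : periodic1 v -> periodic1 (SD nu Lambda dt v).
Proof.
by move=> pv x; apply: eq_bigr => gl _; rewrite addrAC pv.
Qed.

Lemma SD_CL dt m v M : CL m v M -> CL m (SD nu Lambda dt v) (SD_bound * M).
Proof. exact: translates_CL. Qed.

Lemma SD_HT dt m v : HT m.+1 v -> HT m.+1 (SD nu Lambda dt v).
Proof.
move=> /HT_Hd[pv _ s0 _ Hv].
apply: (Hd_HT (SD_periodic _ pv) _ (translates_Hd _ _ s0 Hv)).1.
by rewrite mulr_ge0// SD_bound_ge0.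
Qed.

Lemma SDB dt v w : SD nu Lambda dt (fun x => v x - w x) =
  (fun x => SD nu Lambda dt v x - SD nu Lambda dt w x).
Proof.
by apply/funext => x; rewrite -sumrB; apply: eq_bigr => gl _; rewrite mulrBr.
Qed.

(** The weight [th] is a legitimate value of h^(2s)/dt in the stability property,
    for an auxiliary h unrelated to the mesh. *)
Lemma SD_wenergy m th Nt v : propD1 T nu Lambda m.+1 -> (0 < Nt)%N ->
  0 < time_step T Nt -> 0 < th -> time_step T Nt * th <= 1 -> HT m.+1 v ->
  wenergy th m (SD nu Lambda (time_step T Nt) v) <= wenergy th m v.
Proof.
move=> D1 Nt0; set dt := time_step T Nt => dt0 th0 dtth Hv.
have [_ _ D] := D1 Nt Nt0.
(* the solution of h^(2s) = dt th, at most 1 since [dt * th <= 1] *)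
pose h := (dt * th) `^ (2 * m.+1)%:R^-1.
have p0 : 0 < dt * th by rewrite mulr_gt0.
have hE : h ^+ (2 * m.+1) / dt = th.
  rewrite /h -powR_mulrn ?powR_ge0// -powRrM mulVf ?pnatr_eq0// powRr1 ?(ltW p0)//.
  by rewrite mulrC mulKf// gt_eqF.
have h01 : 0 < h <= 1.
  rewrite powR_gt0//=; have := @ge0_ler_powR R (2 * m.+1)%:R^-1 _ (dt * th) 1.
  by rewrite powR1; apply => //; rewrite ?invr_ge0// ?nnegrE ?(ltW p0).
have := D h v h01 Hv.
have hh : 0 <= h by rewrite powR_ge0.
rewrite !norm_DeltaE// -/dt ?hE; last exact: SD_HT.
by rewrite lee_fin ler_sqrt//; exact: wenergy_ge0 (ltW th0).
Qed.

End dispersion.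

Lemma periodic_flow dt F v : periodic1 F -> periodic1 v ->
  periodic1 (fun x => v (X1 dt F x)).
Proof. by move=> pF pv x; rewrite /X1 pF addrAC pv. Qed.

(** The mean square changes by O(dt) because the displacement is O(dt), and the
    seminorm because of the commutator estimate [HB_comp_flow_commutator]. *)
Lemma wenergy_comp_flow m : forall M, 0 <= M -> forall th, 1 <= th -> exists2 C, 0 <= C &
  forall v F dt, 0 < dt <= 1 -> dt * M <= 2^-1 -> periodic1 F -> HB m.+1 F M ->
  HT m.+2 v -> HT m.+2 (fun x => v (X1 dt F x)) /\
  wenergy th m.+1 (fun x => v (X1 dt F x)) <= (1 + C * dt) * wenergy th m.+1 v.
Proof.
move=> M M0 th th1.
have [C1 C10 HC1] := HB_comp_flow m.+1 M0.
have [C0 C00 HC0] := HB_comp_flow_commutator m.+1 0 M0.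
exists (1 + 2 * M ^+ 2 + th * (4 * M ^+ 2 + 8 * C0 ^+ 2)).
  have := sqr_ge0 M; have := sqr_ge0 C0; nra.
move=> v F dt /andP[dt0 dt1] dtM pF HF Hv.
have [pv cv s0 _ Hdv] := HT_Hd Hv.
have n0 := sqrtr_ge0 (sqn v); have HBv := HT_HB Hv.
set s := snorm m.+2 v in s0 Hdv HBv; set N := Num.sqrt (sqn v) + s in HBv.
have N0 : 0 <= N by rewrite addr_ge0.
have sf : small_field dt M F.
  by split; [rewrite ltW| exact: HB_lip HF | |].
have HX := HC1 _ _ _ _ _ sf M0 HF HBv.
have pX := periodic_flow dt pF pv.
have HF' : HB (m.+1 + 0) F M by rewrite addn0.
have HBv' : HB (m.+1 + 0) v N by rewrite addn0.
have [_ Hcom] := HC0 _ _ _ _ _ sf M0 HF' HBv'.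
have [dv Hv1] := Hd_derivable Hdv.
have Htr := H1_comp_flow sf M0 s0 Hv1.
have [dX _] := Hd_derivable HX.2.
have bX0 : 0 <= C0 * (dt * N) + (1 + dt * M) * s.
  by rewrite addr_ge0// mulr_ge0// ?mulr_ge0 ?(ltW dt0)// addr_ge0// mulr_ge0// ltW.
have HXs : H1 (C0 * (dt * N) + (1 + dt * M) * s) (derive1n m.+1 (fun x => v (X1 dt F x))).
  rewrite (_ : derive1n m.+1 _ = fun x => (derive1n m.+1 (fun y => v (X1 dt F y)) x -
      derive1n m.+1 v (X1 dt F x)) + derive1n m.+1 v (X1 dt F x)).
    apply: H1D => //; rewrite mulr_ge0//; first by rewrite mulr_ge0// ltW.
    by rewrite addr_ge0// mulr_ge0// ltW.
  by apply/funext => x; rewrite subrK.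
have [HTX snX] := HT_intro pX bX0 dX HXs.
split => //.
have [_ cX sX0 _ _] := HT_Hd HTX.
have lv : lip s v by case: (Hdv) => df bf _; exact: MVT_le.
(* Young's inequality with parameter [dt] costs 1/dt on terms of size dt^2 *)
have dsq : dt ^+ 2 * (1 + dt^-1) <= 2 * dt.
  have -> : dt ^+ 2 * (1 + dt^-1) = dt * dt + dt by field; rewrite gt_eqF.
  by have := ler_wpM2l (ltW dt0) dt1; lra.
have q1 : sqn (fun x => v (X1 dt F x)) <= (1 + dt) * sqn v + 2 * dt * (M * s) ^+ 2.
  have cd : continuous (fun x => v (X1 dt F x) - v x).
    by move=> x; apply: cvgB; [exact: cX|exact: cv].
  have bd : bnd (dt * (M * s)) (fun x => v (X1 dt F x) - v x).
    move=> x; apply: (le_trans (lv _ _)).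
    rewrite (_ : X1 dt F x - x = - (F x * dt)); last by rewrite /X1; ring.
    rewrite normrN normrM (gtr0_norm dt0) (_ : s * (_ * dt) = dt * (`|F x| * s)); last by ring.
    by rewrite ler_wpM2l ?(ltW dt0)// ler_wpM2r//; exact: HF.1.
  have := sqn_young cv cd dt0.
  under [X in sqn X <= _ -> _]eq_fun do rewrite addrC subrK.
  move=> /le_trans; apply; rewrite lerD2l.
  have i0 : 0 <= 1 + dt^-1 by rewrite addr_ge0// invr_ge0 ltW.
  apply: (le_trans (ler_wpM2l i0 (sqn_le_bnd cd bd))).
  rewrite exprMn mulrA [(1 + _) * _]mulrC ler_wpM2r ?sqr_ge0//.
have [b1 b2] := wenergy_bounds th1 Hv.
have q2 : snorm m.+2 (fun x => v (X1 dt F x)) ^+ 2 <=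
    (1 + dt) * s ^+ 2 + 2 * dt * (M * s + C0 * N) ^+ 2.
  have le1 : snorm m.+2 (fun x => v (X1 dt F x)) <= s + dt * (M * s + C0 * N).
    by apply: (le_trans snX); lra.
  have := sqr_young s (dt * (M * s + C0 * N)) dt0.
  move=> h; apply: (@le_trans _ _ ((s + dt * (M * s + C0 * N)) ^+ 2)).
    by rewrite !expr2 ler_pM.
  apply: (le_trans h); rewrite lerD2l exprMn mulrA [(1 + _) * _]mulrC.
  by rewrite ler_wpM2r ?sqr_ge0.
have q3 : (M * s + C0 * N) ^+ 2 <= (2 * M ^+ 2 + 4 * C0 ^+ 2) * wenergy th m.+1 v.
  have := sqr_young (M * s) (C0 * N) (@ltr01 R); rewrite invr1 !exprMn => h.
  have := ler_wpM2l (sqr_ge0 C0) b1; have := ler_wpM2l (sqr_ge0 M) b2.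
  by rewrite -/s -/N; lra.
have q4 : (M * s) ^+ 2 <= M ^+ 2 * wenergy th m.+1 v.
  by rewrite exprMn ler_wpM2l ?sqr_ge0.
have th0 : 0 <= th by apply: le_trans th1.
have p3 : 2 * dt * (th * (M * s + C0 * N) ^+ 2) <=
   2 * dt * (th * ((2 * M ^+ 2 + 4 * C0 ^+ 2) * wenergy th m.+1 v)).
  by rewrite !ler_wpM2l// mulr_ge0// ltW.
have p4 : 2 * dt * (M * s) ^+ 2 <= 2 * dt * (M ^+ 2 * wenergy th m.+1 v).
  by rewrite !ler_wpM2l// mulr_ge0// ltW.
have := ler_wpM2l th0 q2.
move: q1 p3 p4; rewrite /wenergy -/s.
clear; lra.
Qed.

End operators.

(** * One evolution step *)

Section step.
Variable R : realType.
Notation mu := (@lebesgue_measure R).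
Implicit Types (f g v w : R -> R) (a b c x N M e : R) (i j k m n : nat).

Lemma Lpnormy_le (D : set R) w M : 0 <= M -> {ae mu, forall x, `|w x| <= M} ->
  (Lpnorm D +oo%E w <= M%:E)%E.
Proof.
move=> M0 wM; rewrite /Lpnorm unlock /= lebesgue_setT_gt0; apply/ess_supP.
move: wM; apply: ae_mono => x wx; rewrite /= patchE; case: ifP => _; last by rewrite normr0 lee_fin.
by rewrite lee_fin.
Qed.

Lemma seminorm1_le (D : set R) f K : (forall x, derivable f x 1) ->
  continuous f^`() -> bnd K f^`() -> (seminorm D 1 +oo%E f <= K%:E)%E.
Proof.
move=> df cf bf; have K0 := bnd_ge0 bf.
have af : antider f f^`().
  by apply: is_derive_antider => // x; exact: derivable_is_derive.
have [_ wf] := @classical_weak_deriv R 0 f f^`() (fun k (h : (k < 0)%N) => match Bool.diff_false_true h with end) (locint_continuous cf) af.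
apply: Lpnormy_le => //.
have := weak_deriv_ae wf; apply: ae_mono => x ->; exact: bf.
Qed.

Lemma step_condition_bounds f w K N dt : (forall x, derivable f x 1) ->
  continuous f^`() -> bnd K f^`() -> (forall x, derivable w x 1) ->
  continuous w^`() -> bnd N w^`() -> 0 <= dt -> 3 * dt * (K * N) <= 1 ->
  step_condition f dt w.
Proof.
move=> df cf bf dw cw bw dt0 le1.
have h1 := seminorm1_le setT df cf bf.
have h2 := seminorm1_le (@unit_cell R) dw cw bw.
have K0 := bnd_ge0 bf; have N0 := bnd_ge0 bw.
have p0 D (g : R -> R) : (0 <= seminorm D 1 +oo%E g)%E by exact: Lnorm_ge0.
rewrite /step_condition -muleA.
apply: (@le_trans _ _ ((3 * dt)%:E * (K%:E * N%:E))%E); last by rewrite -!EFinM lee_fin.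
by rewrite lee_wpmul2l ?lee_fin ?mulr_ge0// lee_pmul//; exact: p0.
Qed.

Lemma Hd_id m : Hd m (fun x => x) 1.
Proof.
case: m => [|m] /=; first by apply: lip_H1 => x y; rewrite mul1r.
have [d1 d2] : (forall x : R, derivable (fun x : R => x) x 1) /\ (fun x : R => x)^`() = (fun=> 1).
  by apply: is_derive_fun => x; exact: is_derive_id.
split => //; first by move=> x; rewrite d2 normr1.
by have := (HB_cst m (1 : R)).2; rewrite d2 normr1.
Qed.

Lemma Hd_X1 m dt F M : 0 <= dt <= 1 -> HB m F M -> Hd m (X1 dt F) (1 + M).
Proof.
move=> /andP[dt0 dt1] HF; have M0 := HB_ge0 HF.
rewrite X1E (_ : (fun x => x - dt * F x) = (fun x => x + - dt * F x)); last first.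
  by apply/funext => x; rewrite mulNr.
apply: HdD => //; first exact: Hd_id.
have := HdZ (- dt) M0 HF.2; rewrite normrN ger0_norm//; apply: Hd_mono.
by rewrite mulr_ge0//= ler_piMl.
Qed.

Lemma HB_wenergy m g N th : periodic1 g -> 0 <= th -> HB m g N ->
  HT m.+1 g /\ wenergy th m g <= (1 + th) * N ^+ 2.
Proof.
move=> pg th0 Hg; have N0 := HB_ge0 Hg.
have [HTg sg] := Hd_HT pg N0 Hg.2; have [_ cg s0 _ _] := HT_Hd HTg.
split => //; rewrite mulrDl mul1r lerD//; first exact: sqn_le_bnd cg Hg.1.
by rewrite ler_wpM2l// !expr2 ler_pM.
Qed.

(** The arithmetic of one step: [X], [Z], [W] and [S] are the energies of the
    transported error, of the remainder, and of the two parts of the remainder.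
    The part proportional to [D] is absorbed by the left-hand side. *)
Lemma step_algebra (dt C5 CE beta B X Z S W D E : R) : 0 < dt <= 1 ->
  0 <= C5 -> 0 <= CE -> 4 * C5 * dt <= 2^-1 -> 0 <= D -> 0 <= E -> 0 <= B ->
  B <= beta -> W <= dt ^+ 2 * B -> S <= C5 * dt ^+ 2 * D -> X <= (1 + CE * dt) * E ->
  Z <= (1 + 1) * W + (1 + 1) * S -> D <= (1 + dt) * X + (1 + dt^-1) * Z ->
  D <= (1 + (8 * C5 + (1 + 2 * CE) + 8 * C5 * (1 + 2 * CE)) * dt) *
    (E + 4 * dt * beta).
Proof.
move=> /andP[dt0 dt1] C50 CE0 dtC5 D0 E0 B0 Bb WB SD XE ZW DX.
have beta0 : 0 <= beta by apply: le_trans Bb.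
have Zb : Z <= dt ^+ 2 * (2 * beta + 2 * (C5 * D)).
  have := ler_wpM2l (sqr_ge0 dt) Bb; move: ZW WB SD; clear; lra.
have dsq : (1 + dt^-1) * dt ^+ 2 <= 2 * dt.
  have -> : (1 + dt^-1) * dt ^+ 2 = dt * dt + dt by field; rewrite gt_eqF.
  by have := ler_wpM2l (ltW dt0) dt1; clear; lra.
have C5D0 := mulr_ge0 C50 D0.
have Y0 : 0 <= 2 * beta + 2 * (C5 * D) by move: C5D0 beta0; clear; lra.
have i0 : 0 <= 1 + dt^-1 by rewrite addr_ge0// invr_ge0 ltW.
have Zb2 : (1 + dt^-1) * Z <= 2 * dt * (2 * beta + 2 * (C5 * D)).
  by apply: (le_trans (ler_wpM2l i0 Zb)); rewrite [leLHS]mulrA; exact: ler_wpM2r.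
set C6 := 1 + 2 * CE.
have XE' : (1 + dt) * X <= (1 + C6 * dt) * E.
  have i1 : 0 <= 1 + dt by rewrite addr_ge0// ltW.
  apply: (le_trans (ler_wpM2l i1 XE)); rewrite mulrA ler_wpM2r//.
  have := ler_wpM2l (mulr_ge0 (ltW dt0) CE0) dt1; rewrite /C6; clear; lra.
have C60 : 0 <= C6 by rewrite addr_ge0// mulr_ge0.
clearbody C6; clear ZW WB SD XE Zb dsq CE0 B0 Bb.
set x := C5 * dt; have x0 : 0 <= x by rewrite mulr_ge0// ltW.
have x1 : 4 * x <= 2^-1 by rewrite mulrA.
set y := (1 + C6 * dt) * E + 4 * dt * beta.
have main : (1 - 4 * x) * D <= y.
  by move: DX Zb2 XE'; rewrite /y /x; clear; lra.
have z0 : 0 <= 4 * dt * beta by rewrite !mulr_ge0// ltW.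
have c60 : 0 <= C6 * dt by rewrite mulr_ge0// ltW.
have main2 : D <= (1 + 8 * x) * y.
  have c0 : 0 <= 1 + 8 * x by rewrite addr_ge0// mulr_ge0.
  apply: le_trans (ler_wpM2l c0 main); rewrite mulrA ler_peMl//.
  have : 0 <= x * (2^-1 - 4 * x) by rewrite mulr_ge0// subr_ge0.
  by clear; lra.
apply: (le_trans main2).
have c1 : 0 <= 1 + 8 * x by rewrite addr_ge0// mulr_ge0.
have c2 : y <= (1 + C6 * dt) * (E + 4 * dt * beta).
  by rewrite /y mulrDr lerD2l ler_peMl// lerDl.
apply: (le_trans (ler_wpM2l c1 c2)); rewrite mulrA ler_wpM2r//.
  by rewrite addr_ge0.
have := ler_wpM2l (mulr_ge0 (mulr_ge0 C50 C60) (ltW dt0)) dt1; rewrite /x; clear; lra.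
Qed.

(** The evolution step for the decomposition
    b - a = (v - w) o X_a + (v o X_b - v o X_a) + dt tau.  The bound by 1 on the
    previous error is there to bound [w] in H^s by a constant. *)
Lemma step_estimate p : forall K M (th : R), 0 <= K -> 0 <= M -> 1 <= th ->
  exists C d1 : R, [/\ 0 <= C, 0 < d1 & forall f v w (b tau : R -> R) (dt beta : R),
    0 < dt <= 1 -> dt <= d1 ->
    CL p.+2 f K -> CL p.+2 v M -> periodic1 v -> CL p.+2 b M -> periodic1 b ->
    HT p.+2 w -> wenergy th p.+1 (fun x => v x - w x) <= 1 ->
    (forall x, b x = v (X1 dt (f \o b) x) + dt * tau x) ->
    (HT p.+2 tau -> wenergy th p.+1 tau <= beta) ->
    step_condition f dt w /\ exists a : R -> R, [/\ SA_solution f p.+2 dt w a,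
      forall a' : R -> R, SA_solution f p.+2 dt w a' -> a' = a &
      wenergy th p.+1 (fun x => b x - a x) <=
        (1 + C * dt) * (wenergy th p.+1 (fun x => v x - w x) + 4 * dt * beta)]].
Proof.
move=> K M th K0 M0 th1; have th0 : 0 <= th by apply: le_trans th1.
(* a bound of [w]: [M] for [v], and 2 for an error of energy at most 1 *)
pose N := M + 2; have N0 : 0 <= N by rewrite addr_ge0.
have [Ca Ca0 HCa] := @implicit_step_HB R p K N K0 N0 p.+1 (leqnn p.+1).
pose P := Num.max Ca M.
have P0 : 0 <= P by rewrite le_max M0 orbT.
have [CF CF0 HCF] := HB_comp_CL p.+1 K P0.
have [CG CG0 HCG] := HB_comp_diff p.+1 K P0.
have Q0 : 0 <= 1 + CF by rewrite addr_ge0.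
have [CV CV0 HCV] := HB_comp_diff p.+1 M Q0.
have [CE CE0 HCE] := wenergy_comp_flow p CF0 th1.
pose C5 := 2 * ((1 + th) * (CV * CG) ^+ 2).
have C50 : 0 <= C5 by rewrite !mulr_ge0 ?sqr_ge0// addr_ge0.
pose C6 := 1 + 2 * CE.
have C60 : 0 <= C6 by rewrite addr_ge0// mulr_ge0.
(* the time step is small enough for the contraction property of the implicit
   equation, for the monotonicity of the flows and for the absorption *)
exists (8 * C5 + C6 + 8 * C5 * C6), ((4 * (K * N) + 2 * CF + 8 * C5 + 1)^-1).
have KN0 : 0 <= K * N by rewrite mulr_ge0.
have D0 : 0 < 4 * (K * N) + 2 * CF + 8 * C5 + 1 by lra.
split; [by have := mulr_ge0 C50 C60; lra|by rewrite invr_gt0|].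
move=> f v w b tau dt beta /andP[dt0 dt1] dtd Hf Hv pv Hb pb Hw Ee Htau bE.
have dtD : dt * (4 * (K * N) + 2 * CF + 8 * C5 + 1) <= 1.
  by rewrite -ler_pdivlMr// div1r.
have a1 : 0 <= dt * (K * N) by rewrite mulr_ge0// ltW.
have a2 : 0 <= dt * CF by rewrite mulr_ge0// ltW.
have a3 : 0 <= dt * C5 by rewrite mulr_ge0// ltW.
have dtKN : dt * (K * N) <= 4^-1 by lra.
have dtCF : dt * CF <= 2^-1 by lra.
have dtC5 : 4 * C5 * dt <= 2^-1 by lra.
have HvHB := CL_HB (CL_S Hv); have HbHB := CL_HB (CL_S Hb).
have [HTv _] := Hd_HT pv M0 HvHB.2.
have [HTb _] := Hd_HT pb M0 HbHB.2.
pose e x := v x - w x.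
have [HTe _] : HT p.+2 e /\ _ := HTB HTv Hw.
have HBe := HT_HB HTe.
have [be1 be2] := wenergy_bounds th1 HTe.
have N2 : Num.sqrt (sqn e) + snorm p.+2 e <= 2.
  rewrite -ler_sqr ?nnegrE//; last exact: HB_ge0 HBe.
  by apply: (le_trans be1); move: Ee; rewrite -/e; lra.
have [pw cw _ _ _] := HT_Hd Hw.
have HBw : HB p.+1 w N.
  rewrite (_ : w = fun x => v x - e x); last by apply/funext => x; rewrite /e; ring.
  by apply: HBB => //; exact: HB_mono N2 HBe.
have [bw dw Hw'] := (HBS _ _ _).1 HBw.
have lw := HB_lip HBw.
have lf := CL_lip Hf.
have bf := CL_bnd Hf.
have [df Hf'] : (forall x, derivable f x 1) /\ CL p.+1 f^`() K by case: Hf.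
have cf' : continuous f^`() by exact: (lip_continuous (CL_lip Hf')).
have cw' : continuous w^`().
  case: (p) Hw' => [[_ H]|q /HB_lip H]; first exact: (H1_continuous N0 H).
  exact: (lip_continuous H).
split.
  apply: (step_condition_bounds df cf' (CL_bnd Hf') dw cw' Hw'.1 (ltW dt0)).
  by rewrite -mulrA; lra.
have [a aE] := implicit_exists dt lf lw bw.
have ai : implicit_step dt f w a by move=> x; exact: aE.
have pa := implicit_step_periodic (ltW dt0) N0 lf lw dtKN ai pw.
have dt01 : 0 <= dt <= 1 by rewrite ltW.
have HBa : HB p.+1 a Ca by exact: (HCa _ _ _ _ dt01 Hf HBw pw dtKN ai).
have [HTa _] := Hd_HT pa Ca0 HBa.2.
exists a; split.
- split => //; exact/funext.
- move=> a' [_ a'E]; apply/funext => x.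
  apply: (implicit_unique (ltW dt0) N0 lf lw dtKN); last exact: ai.
  by rewrite [in LHS]a'E.
have Hda : Hd p.+1 a P by apply: Hd_mono HBa.2; rewrite Ca0 le_max lexx.
have Hdb : Hd p.+1 b P by apply: Hd_mono HbHB.2; rewrite M0 le_max lexx orbT.
have HFa : HB p.+1 (f \o a) CF by exact: HCF (CL_S Hf) Hda.
have HFb : HB p.+1 (f \o b) CF by exact: HCF (CL_S Hf) Hdb.
have pFa : periodic1 (f \o a) by move=> x /=; rewrite pa.
have pFb : periodic1 (f \o b) by move=> x /=; rewrite pb.
have dt01' : 0 < dt <= 1 by rewrite dt0.
have [HTvb _] := HCE _ _ _ dt01' dtCF pFb HFb HTv.
have [HTeX EeX] := HCE _ _ _ dt01' dtCF pFa HFa HTe.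
pose d x := b x - a x.
have [HTd _] : HT p.+2 d /\ _ := HTB HTb HTa.
have HBd := HT_HB HTd; have [bd1 _] := wenergy_bounds th1 HTd.
set Nd := Num.sqrt (sqn d) + snorm p.+2 d in HBd bd1.
have HFd : HB p.+1 (fun x => (f \o b) x - (f \o a) x) (CG * Nd) by exact: HCG Hf Hdb Hda HBd.
have HXd : HB p.+1 (fun x => X1 dt (f \o b) x - X1 dt (f \o a) x) (dt * (CG * Nd)).
  have := HBZ (- dt) HFd; rewrite normrN (gtr0_norm dt0).
  rewrite (_ : (fun x => - dt * _) =
    (fun x => X1 dt (f \o b) x - X1 dt (f \o a) x))//.
  by apply/funext => x; rewrite /X1; ring.
have Hsec := HCV _ _ _ _ Hv (Hd_X1 dt01 HFb) (Hd_X1 dt01 HFa) HXd.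
set sec := (fun x => v _ - v _) in Hsec.
have psec : periodic1 sec.
  by move=> x; rewrite /sec !(periodic_flow _ _ pv).
have [HTsec Esec] := HB_wenergy psec th0 Hsec.
have Ed0 : 0 <= wenergy th p.+1 d by exact: wenergy_ge0.
have Esec' : wenergy th p.+1 sec <= C5 * dt ^+ 2 * wenergy th p.+1 d.
  apply: (le_trans Esec).
  rewrite (_ : (1 + th) * _ = (1 + th) * (CV * CG) ^+ 2 * dt ^+ 2 * Nd ^+ 2); last by ring.
  rewrite (_ : C5 * _ * _ = (1 + th) * (CV * CG) ^+ 2 * dt ^+ 2 * (2 * wenergy th p.+1 d)); last by rewrite /C5; ring.
  apply: ler_wpM2l bd1; apply: mulr_ge0; last exact: sqr_ge0.
  by apply: mulr_ge0; [rewrite addr_ge0|exact: sqr_ge0].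
have HTtau : HT p.+2 tau.
  have := (HT_comb dt^-1 (- dt^-1) HTb HTvb).1.
  rewrite (_ : (fun x => _ + _) = tau)//; apply/funext => x.
  by rewrite Htau; field; rewrite gt_eqF.
have Etau := bE HTtau.
have Edt := wenergyZ dt th0 HTtau.
have HTdt : HT p.+2 (fun x => dt * tau x).
  have := (HT_comb dt 0 HTtau HTtau).1.
  by under eq_fun do rewrite mul0r addr0.
pose z x := dt * tau x + sec x.
have [HTz _] : HT p.+2 z /\ _ := HTD HTdt HTsec.
have Ez := wenergy_young th0 (@ltr01 R) HTdt HTsec; rewrite invr1 -/z in Ez.
have Ed := wenergy_young th0 dt0 HTeX HTz.
rewrite (_ : (fun x => e _ + z x) = d) in Ed; last first.
  by apply/funext => x; rewrite /e /z /sec /d Htau aE /X1/=; ring.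
exact: (step_algebra dt01' C50 CE0 dtC5 Ed0 (wenergy_ge0 _ _ th0) (wenergy_ge0 _ _ th0)
  Etau Edt Esec' EeX Ez Ed).
Qed.

End step.

(** * Regularity of the exact solution at every time *)

Section exact_solution_regularity.
Variable R : realType.
Notation mu := (@lebesgue_measure R).
Implicit Types (f g v w : R -> R) (a b c x N M e t T : R) (i j k m n : nat).

Lemma ae_interval (P : R -> Prop) a b : {ae mu, forall x, P x} -> a < b ->
  exists2 x, a < x < b & P x.
Proof.
move=> [A [mA A0 PA]] ab; apply: contrapT => nP.
have IA : [set` `]a, b[%R] `<=` A.
  move=> x /=; rewrite in_itv/= => xab; apply: PA => Px; apply: nP.
  by exists x.
have : (mu [set` `]a, b[%R] <= mu A)%E by apply: le_measure => //; rewrite inE.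
rewrite A0 lebesgue_measure_itv/= lte_fin ab -EFinB lee_fin leNgt subr_gt0 ab.
by [].
Qed.

(** Equicontinuity: convergence at the points of a fine grid of one period
    suffices. *)
Lemma pointwise_ucvg (W : nat -> R -> R) v M : 0 <= M ->
  (forall n, lip M (W n)) -> (forall n, periodic1 (W n)) -> periodic1 v ->
  (forall x e, 0 < e -> exists n0, forall n, (n0 <= n)%N -> `|W n x - v x| <= e) ->
  ucvg W v.
Proof.
move=> M0 lW pW pv cW.
have lv : lip M v.
  move=> x y; apply/ler_addgt0Pr => e e0.
  have e2 : 0 < e / 2 by rewrite divr_gt0.
  have [n1 H1] := cW x _ e2; have [n2 H2] := cW y _ e2.
  have := H1 _ (leq_maxl n1 n2); have := H2 _ (leq_maxr n1 n2).
  set n := maxn n1 n2 => h2 h1; have h3 := lW n x y.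
  have -> : v x - v y = (W n x - W n y) - (W n x - v x) + (W n y - v y) by ring.
  apply: (le_trans (ler_normD _ _)); apply: (le_trans (lerD (ler_normB _ _) (lexx _))).
  lra.
move=> e e0.
pose K := (Num.truncn (3 * M / e)).+1.
have K0 : 0 < K%:R :> R by rewrite ltr0n.
have MK : M / K%:R <= e / 3.
  have := truncnS_gt (3 * M / e); rewrite -/K ltr_pdivrMr// => h.
  by rewrite ler_pdivrMr//; lra.
have e3 : 0 < e / 3 by rewrite divr_gt0.
have [g Hg] := @choice _ _ _ (fun i : 'I_K.+1 => cW (i%:R / K%:R) _ e3).
exists (\max_i g i)%N => n nmax x.
pose y := x - (Num.floor x)%:~R.
have xE : x = y + (Num.floor x)%:~R by rewrite subrK.
have -> : W n x - v x = W n y - v y by rewrite [in LHS]xE !periodic_shiftz.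
have y0 : 0 <= y by rewrite subr_ge0 floor_le.
have y1 : y < 1 by rewrite /y; have := floorD1_gt x; rewrite rmorphD/=; lra.
pose i := Num.truncn (K%:R * y).
have Ky0 : 0 <= K%:R * y by rewrite mulr_ge0// ltW.
have /andP[iy yi] := truncn_itv Ky0.
have iK : (i < K.+1)%N.
  rewrite ltnS -(ler_nat R); apply: (le_trans iy); rewrite -[leRHS]mulr1.
  by rewrite ler_wpM2l// ltW.
have := Hg (Ordinal iK) n (leq_trans (leq_bigmax (Ordinal iK)) nmax).
rewrite /=; set z := i%:R / K%:R => hz.
have yz : `|y - z| <= K%:R^-1.
  have h1 : z <= y by rewrite /z ler_pdivrMr// mulrC.
  rewrite ger0_norm ?subr_ge0// lerBlDr.
  have -> : K%:R^-1 + z = i.+1%:R / K%:R by rewrite /z -(@natr1 _ i); ring.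
  by rewrite ler_pdivlMr// mulrC ltW.
have h1 : `|W n y - W n z| <= e / 3.
  by apply: (le_trans (lW _ _ _)); apply: le_trans MK; exact: ler_wpM2l.
have h2 : `|v y - v z| <= e / 3.
  by apply: (le_trans (lv _ _)); apply: le_trans MK; exact: ler_wpM2l.
have -> : W n y - v y = (W n y - W n z) + (W n z - v z) - (v y - v z) by ring.
apply: (le_trans (ler_normB _ _)); apply: (le_trans (lerD (ler_normD _ _) (lexx _))).
lra.
Qed.

Lemma derive1nB m f g :
  (forall k, (k < m)%N -> forall x, derivable (derive1n k f) x 1) ->
  (forall k, (k < m)%N -> forall x, derivable (derive1n k g) x 1) ->
  derive1n m (fun x => f x - g x) = (fun x => derive1n m f x - derive1n m g x).
Proof.
elim: m => [//|m IH] df dg; rewrite derive1nS IH.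
- by have [_ ->] := derive1B_fun (df m (ltnSn _)) (dg m (ltnSn _)); rewrite -!derive1nS.
- by move=> k km; apply: df; exact: ltnW.
- by move=> k km; apply: dg; exact: ltnW.
Qed.

(** The derivatives of order [m.+1] converge uniformly, and they dominate the
    seminorm. *)
Lemma ucvg_snorm m M (W : nat -> R -> R) v : 0 <= M -> periodic1 v ->
  (forall n, periodic1 (W n)) -> (forall n, CL m.+1 (W n) M) -> ucvg W v ->
  CL m.+1 v M /\ forall e, 0 < e -> exists n, snorm m.+1 (fun x => v x - W n x) <= e.
Proof.
move=> M0 pv pW HW cW; have [Hv cd] := CL_limit HW cW; split => // e e0.
have [n /(_ n (leqnn n)) Hn] := cd m.+1 (leqnn _) _ e0; exists n.
have [dv _] := Hd_derivable (CL_HB Hv).2.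
have [dW _] := Hd_derivable (CL_HB (HW n)).2.
have dv' k : (k < m)%N -> forall x, derivable (derive1n k v) x 1.
  by move=> km; apply: dv; exact: ltnW.
have dW' k : (k < m)%N -> forall x, derivable (derive1n k (W n)) x 1.
  by move=> km; apply: dW; exact: ltnW.
have [d1 d2] := derive1B_fun (dv m (ltnSn _)) (dW m (ltnSn _)).
apply: (HT_intro _ (ltW e0) _ _).2.
- by move=> x; rewrite pv pW.
- move=> k km x; rewrite derive1nB.
  + have [+ _] := derive1B_fun (dv' k km) (dW' k km); exact.
  + by move=> j jk; apply: dv'; exact: ltn_trans km.
  + by move=> j jk; apply: dW'; exact: ltn_trans km.
- rewrite derive1nB//; apply: lip_H1; apply: MVT_le => // x.
  by rewrite d2 -!derive1nS distrC.
Qed.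

Lemma Linfty_ae T (N : (R -> R) -> \bar R) (u : R -> R -> R) M :
  Linfty_norm T N u = M%:E ->
  {ae mu, forall t, time_interval T t -> (N (u t) <= M%:E)%E}.
Proof.
move=> uM; have : (Linfty_norm T N u <= M%:E)%E by rewrite uM.
rewrite /Linfty_norm unlock /= lebesgue_setT_gt0 => /ess_supP.
apply: ae_mono => t + Tt; rewrite /= patchE mem_set// => /(le_trans _); apply.
exact: lee_abs.
Qed.

Lemma normT_seminorm q v M : HT q.+1 v -> (normT q.+1 2%:E v <= M%:E)%E ->
  (seminormT q.+1 2%:E v <= M%:E)%E.
Proof.
move=> /HT_Hd[_ _ s0 sE _]; rewrite /normT /Wnorm => /(le_trans _); apply.
rewrite big_ord_recr/= -/(seminormT q.+1 2%:E v) sE.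
have h : ((snorm q.+1 v) `^ 2 = (snorm q.+1 v) ^+ 2)%R by rewrite powR_mulrn.
rewrite poweR_EFin h.
apply: (@le_trans _ _ (((snorm q.+1 v ^+ 2)%:E) `^ 2^-1)%E).
  by rewrite poweR_EFin powR12_sqrt ?sqr_ge0// sqrtr_sqr ger0_norm.
apply: gt0_ler_poweR => //.
- by rewrite in_itv/= leey lee_fin sqr_ge0.
- rewrite in_itv/= leey andbT adde_ge0// ?lee_fin ?sqr_ge0//.
  by apply: sume_ge0 => i _; exact: poweR_ge0.
- by rewrite leeDr//; apply: sume_ge0 => i _; exact: poweR_ge0.
Qed.

(** Almost every time is good, so every time is a limit of good times [tk], and
    [u] is continuous in time.  The seminorm of order [q] is not carried to the
    limit; it is kept on functions [z] close to [u t], which is enough to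
    interpolate. *)
Lemma exact_solution_regular T nu f u0 u p q MW MH : 0 < T -> (p.+2 < q)%N ->
  smooth_solution T nu f u0 u ->
  Linfty_space T (@HT R q) (normT q 2%:E) u ->
  Linfty_norm T (normT p.+3 +oo%E) u = MW%:E ->
  Linfty_norm T (normT q 2%:E) u = MH%:E ->
  forall t, 0 <= t <= T -> CL p.+2 (u t) MW /\
   forall e, 0 < e -> exists z, [/\ HT q z, (seminormT q 2%:E z <= MH%:E)%E,
     CL p.+2 z MW & snorm p.+2 (fun x => u t x - z x) <= e].
Proof.
move=> T0 pq [pu cu _ _ _] [[sf [_ sm]] _] uMW uMH t /andP[t0 tT].
pose good t' := HT q (u t') /\ ((normT p.+3 +oo%E (u t') <= MW%:E)%E /\
   (normT q 2%:E (u t') <= MH%:E)%E).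
have good_ae : {ae mu, forall t', time_interval T t' -> good t'}.
  have := ae_conj sm (ae_conj (Linfty_ae uMW) (Linfty_ae uMH)).
  by apply: ae_mono => t' [h1 [h2 h3]] Tt'; split; [exact: (h1 Tt').1|split; [exact: h2|exact: h3]].
have goodCL t' : good t' -> periodic1 (u t') /\ CL p.+2 (u t') MW.
  move=> [[pt' [ct' wt']] [h _]]; split => //; apply: Wspace_torus_CL => //.
    by apply: ct'; case: (q) pq.
  by move=> j jp; have [g [Hg _]] := wt' j (leq_trans jp pq); exists g.
have dense k : exists t', [/\ 0 <= t' <= T, `|t' - t| < k.+1%:R^-1 & good t'].
  have : 0 < k.+1%:R^-1 :> R by rewrite invr_gt0.
  move: (k.+1%:R^-1) => d d0.
  have lt : Num.max 0 (t - d) < Num.min T (t + d).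
    by rewrite lt_min !gt_max; apply/andP; split; apply/andP; split => //; lra.
  have [t' /andP[]] := ae_interval good_ae lt.
  rewrite gt_max lt_min => /andP[h1 h2] /andP[h3 h4] gt'.
  exists t'; split; [by rewrite !ltW| |apply: gt'].
    by rewrite ltr_distlC; apply/andP; split; lra.
  by rewrite /time_interval/= in_itv/= h1 h3.
have [tk Htk] := boolp.choice dense.
pose W k := u (tk k).
have HW k : CL p.+2 (W k) MW by have [_ _ /goodCL[]] := Htk k.
have pW k : periodic1 (W k) by have [_ _ /goodCL[]] := Htk k.
have MW0 : 0 <= MW by exact: bnd_ge0 (CL_bnd (HW 0%N)).
have put : periodic1 (u t) by apply: pu; rewrite t0.
have cW : ucvg W (u t).
  apply: (pointwise_ucvg MW0) => // [n|x e e0]; first exact: CL_lip (HW n).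
  have Atx : ([set` `[0, T]%R] `*` [set: R]) (t, x).
    by split => //=; rewrite in_itv/= t0.
  have cutx : (fun z : R * R => u z.1 z.2) @
      within ([set` `[0, T]%R] `*` [set: R]) (nbhs (t, x)) --> u t x.
    by rewrite (nbhs_subspace_in Atx); exact: (cu (t, x)).
  move: cutx => /cvgrPdist_le /(_ e e0) /nbhs_ballP[r /= r0 Hr].
  have rI : 0 <= r^-1 by rewrite invr_ge0 ltW.
  exists (Num.truncn r^-1) => n nr.
  have [tkT tkt _] := Htk n.
  have nr' : n.+1%:R^-1 <= r.
    rewrite -[leRHS]invrK lef_pV2 ?posrE ?invr_gt0 ?ltr0n//.
    have /andP[_ /ltW h] := truncn_itv rI; apply: (le_trans h).
    by rewrite ler_nat.
  rewrite distrC; apply: (Hr (tk n, x)).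
    split; last exact: ballxx.
    by rewrite /ball/= distrC; exact: lt_le_trans nr'.
  by split => //=; rewrite in_itv.
have [Ht snt] := ucvg_snorm MW0 put pW HW cW.
split => // e e0; have [n Hn] := snt e e0; exists (W n).
have [_ _ [hq [_ hM]]] := Htk n.
split; [exact: hq| |exact: HW|exact: Hn].
by case: (q) pq hq hM => [//|q' _]; exact: normT_seminorm.
Qed.

End exact_solution_regularity.

(** * Propagation of the error *)

Section convergence.
Variable R : realType.
Notation mu := (@lebesgue_measure R).
Implicit Types (f v w : R -> R) (a c x N M e t : R) (i j k m n : nat).
Implicit Types (Ih : (R -> R) -> (R -> R)).

(** Apply [propP3] to an approximation [z] of [v] and the contraction property of
    I - Ih, a consequence of [propP1], to the difference. *)
Lemma exact_interpolation_error p q Nx (xs : nat -> R) Ih (Cq h MW MH : R) v :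
  (p.+2 < q)%N -> interpolation_operator p.+2 Nx xs Ih -> propP1 p.+2 Ih ->
  propP3 p.+2 q Cq h Ih -> 0 <= Cq -> 0 <= h -> periodic1 v -> CL p.+2 v MW ->
  (forall e, 0 < e -> exists z, [/\ HT q z, (seminormT q 2%:E z <= MH%:E)%E,
     CL p.+2 z MW & snorm p.+2 (fun x => v x - z x) <= e]) ->
  snorm p.+2 (fun x => v x - Ih v x) <= Cq * h ^+ (q - p.+2) * MH.
Proof.
move=> pq hI P1 P3 Cq0 h0 pv Hv appr.
have [HI linI _] := interpolation_facts hI.
have MW0 := bnd_ge0 (CL_bnd Hv).
have HTof z : periodic1 z -> CL p.+2 z MW -> HT p.+2 z.
  by move=> pz Hz; apply: (Hd_HT pz MW0 (CL_HB (CL_S Hz)).2).1.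
have HTv := HTof _ pv Hv.
apply/ler_addgt0Pr => e e0; have [z [HTq zM Hz ze]] := appr e e0.
have pz : periodic1 z by case: (HTq).
have HTz := HTof _ pz Hz.
pose y x := v x - z x.
have [HTy _] : HT p.+2 y /\ _ := HTB HTv HTz.
have [HTzI _] := HTB HTz (HI _ HTz).
have [HTyI _] := HTB HTy (HI _ HTy).
have -> : (fun x => v x - Ih v x) =
    (fun x => (z x - Ih z x) + (y x - Ih y x)).
  by apply/funext => x; rewrite /y linI//; ring.
have [_ le] := HTD HTzI HTyI; apply: (le_trans le); apply: lerD.
  have [_ _ _ sE _] := HT_Hd HTzI.
  rewrite -lee_fin -sE; apply: (le_trans (P3 _ HTq)).
  by rewrite (EFinM _ MH) lee_wpmul2l// lee_fin mulr_ge0// exprn_ge0.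
apply: le_trans ze.
have [_ _ y0 _ _] := HT_Hd HTy; have [_ _ yI0 _ _] := HT_Hd HTyI.
rewrite -ler_sqr ?nnegrE//.
have := snorm_pythagoras HTyI (HI _ HTy) (P1 _ _ HTy HTy).
under [X in snorm _ X]eq_fun do rewrite subrK.
by move=> ->; rewrite lerDl sqr_ge0.
Qed.

Lemma one_plus_pow_le (c dt : R) n : 0 <= c * dt ->
  (1 + c * dt) ^+ n <= expR (c * (n%:R * dt)).
Proof.
move=> cdt; rewrite (_ : c * (n%:R * dt) = n%:R * (c * dt)); last by ring.
rewrite expRM_natl; apply: lerXn2r; rewrite ?nnegrE ?expR_ge0//.
  by rewrite addr_ge0.
exact: expR_ge1Dx.
Qed.

(** The evolution step followed by the interpolation step, along the scheme. *)
Lemma scheme_step T nu (Lambda : {fset R * R}) p (K Cs CDelta Mf MW : R) :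
  0 <= K -> 0 < Cs -> 0 <= CDelta -> 0 <= Mf -> 0 <= MW ->
  propD1 T nu Lambda p.+2 ->
  let th := 1 + 4 * CDelta * Cs ^+ 2 in
  exists c d1 : R, [/\ 0 <= c, 0 < d1 <= 1 &
    forall f u r Nx Nt (xs : nat -> R) Ih h eta uh n,
    let dt := time_step T Nt in
    (0 < Nt)%N -> 0 < dt <= d1 ->
    CL p.+2 f Mf -> propD3 T nu Lambda f p.+2 r K u ->
    (forall t, 0 <= t <= T -> periodic1 (u t) /\ CL p.+2 (u t) MW) ->
    (forall t, 0 <= t <= T -> snorm p.+2 (fun x => u t x - Ih (u t) x) <= eta) ->
    interpolation_operator p.+2 Nx xs Ih -> propP1 p.+2 Ih -> propP2 p.+2 Cs h Ih ->
    0 <= h -> h ^+ (2 * p.+2) / dt <= CDelta ->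
    (n < Nt)%N -> HT p.+2 uh ->
    let E (k : nat) v := wenergy th p.+1 (fun x => u (k%:R * dt) x - v x) in
    E n uh <= 1 ->
    let v := SD nu Lambda dt uh in
    [/\ step_condition f dt v, exists! w, SA_solution f p.+2 dt v w,
      HT p.+2 (Ih (SA f p.+2 dt v)) &
      E n.+1 (Ih (SA f p.+2 dt v)) <= (1 + c * dt) *
       (E n uh + dt * (4 * th * (K * dt `^ r) ^+ 2 + 2 * th * eta ^+ 2 / dt))]].
Proof.
move=> K0 Cs0 CD0 Mf0 MW0 D1 th.
have th1 : 1 <= th by rewrite /th lerDl mulr_ge0 ?sqr_ge0// mulr_ge0.
have th0 : 0 < th by apply: lt_le_trans th1.
pose G := SD_bound Lambda; have G0 : 0 <= G := SD_bound_ge0 Lambda.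
have M0 : 0 <= MW + G * MW by rewrite addr_ge0// mulr_ge0.
have [C [d1 [C0 d10 step]]] := step_estimate p Mf0 M0 th1.
exists (1 + 2 * C), (Num.min (Num.min 1 d1) th^-1).
split; [by rewrite addr_ge0// mulr_ge0|by rewrite !lt_min d10 invr_gt0 th0 ltr01 !ge_min lexx|].
move=> f u r Nx Nt xs Ih h eta uh n dt Nt0 /andP[dt0]; rewrite !le_min -andbA.
move=> /and3P[dt1 dtd1 dtth] Hf D3 Hu hu hI P1 P2 h0 hdt nN Huh E En v.
have dtT : Nt%:R * dt = T by rewrite /dt /time_step mulrC divfK// pnatr_eq0 -lt0n.
have tin k : (k <= Nt)%N -> 0 <= k%:R * dt <= T.
  by move=> kN; rewrite mulr_ge0 ?(ltW dt0)//= -dtT ler_wpM2r ?(ltW dt0)// ler_nat.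
have [pn Hn] := Hu _ (tin n (ltnW nN)).
have [pn1 Hn1] := Hu _ (tin n.+1 nN).
set un := u (n%:R * dt) in pn Hn; set un1 := u (n.+1%:R * dt) in pn1 Hn1.
have HTof z : periodic1 z -> CL p.+2 z MW -> HT p.+2 z.
  by move=> pz Hz; apply: (Hd_HT pz MW0 (CL_HB (CL_S Hz)).2).1.
have HTn := HTof _ pn Hn; have HTn1 := HTof _ pn1 Hn1.
have [HTe _] := HTB HTn Huh.
pose vn := SD nu Lambda dt un.
have Hvn : CL p.+2 vn (MW + G * MW).
  by apply: CL_mono (SD_CL nu Lambda dt Hn); rewrite lerDr.
have Hn1' : CL p.+2 un1 (MW + G * MW).
  by apply: CL_mono Hn1; rewrite lerDl mulr_ge0.
have pvn : periodic1 vn by exact: SD_periodic.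
have dtth1 : dt * th <= 1 by rewrite -ler_pdivlMr// div1r.
have ESD : wenergy th p.+1 (fun x => vn x - v x) <= E n uh.
  by rewrite /vn /v -SDB; exact: SD_wenergy.
pose tau := consistency_error T nu Lambda f u Nt n.+1.
have tauE x : un1 x = vn (X1 dt (f \o un1) x) + dt * tau x.
  by rewrite /tau /consistency_error -/dt -/un1 -/un /= mulVKf ?gt_eqF// addrC subrK.
have Etau : HT p.+2 tau -> wenergy th p.+1 tau <= th * (K * dt `^ r) ^+ 2.
  move=> HTt; apply: wenergy_norm_star => //; first by rewrite mulr_ge0 ?powR_ge0.
  by apply: D3; rewrite /= nN.
have dt01 : 0 < dt <= 1 by rewrite dt0.
have HTv : HT p.+2 v by exact: SD_HT.
have [sc [a [sa ua Ea]]] := step _ _ _ _ _ _ _ dt01 dtd1 Hf Hvn pvn Hn1' pn1 HTv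
  (le_trans ESD En) tauE Etau.
have SAa : SA f p.+2 dt v = a by apply: xget_unique.
rewrite SAa; have [HTa _] := sa.
have [HTI EI] := interpolation_step hI P1 P2 Cs0 h0 dt01 hdt (th := th)
  (ltac:(by rewrite /th lerDr)) (ltW th0) HTn1 HTa.
split => //.
- by exists a; split => // a' /ua.
- have [HI _ _] := interpolation_facts hI; exact: HI.
apply: (le_trans EI).
have hu1 := hu _ (tin n.+1 nN).
have [HI _ _] := interpolation_facts hI.
have [_ _ s0 _ _] := HT_Hd (HTB HTn1 (HI _ HTn1)).1.
rewrite -/un1 in hu1.
set X := wenergy _ _ _ in Ea *; set S := snorm _ _ in hu1 s0 *.
have S2 : S ^+ 2 <= eta ^+ 2 by rewrite !expr2 ler_pM.
set Y := E n uh; have Y0 : 0 <= Y by exact: wenergy_ge0 (ltW th0).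
have XY : X <= (1 + C * dt) * (Y + 4 * dt * (th * (K * dt `^ r) ^+ 2)).
  apply: (le_trans Ea); rewrite ler_wpM2l ?lerD2r//.
  by rewrite addr_ge0// mulr_ge0// ltW.
have b0 : 0 <= th * (K * dt `^ r) ^+ 2 by rewrite mulr_ge0 ?sqr_ge0// ltW.
set b := th * _ in b0 XY.
rewrite (_ : dt * _ = 4 * dt * b + 2 * th * eta ^+ 2); last first.
  by rewrite /b; field; rewrite gt_eqF.
clearbody X Y S b.
have thS : th * S ^+ 2 <= th * eta ^+ 2 by rewrite ler_wpM2l// ltW.
have te0 : 0 <= th * eta ^+ 2 by rewrite mulr_ge0 ?sqr_ge0// ltW.
have Z0 : 0 <= Y + 4 * dt * b by rewrite addr_ge0// mulr_ge0// mulr_ge0// ltW.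
have c0 : 0 <= (1 + 2 * C) * dt by rewrite mulr_ge0 ?(ltW dt0)// addr_ge0// mulr_ge0.
have k1 : (1 + dt) * (1 + C * dt) <= 1 + (1 + 2 * C) * dt.
  have := ler_wpM2l (mulr_ge0 C0 (ltW dt0)) dt1; clear; lra.
have k2 : (1 + dt) * X <= (1 + (1 + 2 * C) * dt) * (Y + 4 * dt * b).
  have i1 : 0 <= 1 + dt by rewrite addr_ge0// ltW.
  apply: (le_trans (ler_wpM2l i1 XY)); rewrite mulrA; exact: ler_wpM2r.
have k3 := mulr_ge0 c0 te0.
move: k2 k3 thS; clear; lra.
Qed.

End convergence.

(** * The convergence theorem *)

Lemma powR_small (R : realType) (al ka : R) : 0 < al -> 0 < ka ->
  exists2 d, 0 < d & forall dt, 0 < dt <= d -> dt `^ al <= ka.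
Proof.
move=> al0 ka0; exists (ka `^ al^-1); first exact: powR_gt0.
move=> dt /andP[dt0 dtd].
rewrite -[leRHS]powRr1 ?(ltW ka0)// -(mulVf (lt0r_neq0 al0)) powRrM.
by apply: ge0_ler_powR => //; rewrite ?nnegrE ?powR_ge0// ltW.
Qed.

Theorem theorem3p1 (R : realType) (T nu : R) (hT : 0 < T) (hnu : 0 < nu)
  (s q : nat) (hs : (2 <= s)%N) (hsq : (s < q)%N)
  (Lambda : {fset R * R}) (r : R) (hr : 0 < r <= 1)
  (Cs Cq CD : R) (hCs : 0 < Cs) (hCq : 0 < Cq) (hCD : 0 < CD)
  (hD1 : propD1 T nu Lambda s) (hD2 : propD2 T nu Lambda s CD)
  (CDelta eps : R) (hCDelta : 0 < CDelta) (heps : 0 < eps)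
  (* the constants below only depend on the data above and on these numbers *)
  (MW MH Mf K : R) (hK : 0 < K) :
  exists h0 dt0 CE : R,
    [/\ 0 < h0 < 1, 0 < dt0 < 1 & 0 < CE] /\
    forall (f u0 : R -> R) (u : R -> R -> R),
      Wspace setT s.+1 +oo f ->
      exact_solution T nu f u0 u ->
      W1infty_space T (@HT R (s + 2)) (normT (s + 2) 2%:E) u ->
      Linfty_space T (@HT R (s + 4)) (normT (s + 4) 2%:E) u ->
      Linfty_space T (@HT R q) (normT q 2%:E) u ->
      propD3 T nu Lambda f s r K u ->
      Linfty_norm T (normT s.+1 +oo) u = MW%:E ->
      Linfty_norm T (normT q 2%:E) u = MH%:E ->
      Wnorm setT s.+1 +oo f = Mf%:E ->
    forall (Nx Nt : nat) (x : nat -> R) (Ih : (R -> R) -> (R -> R)),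
      let h := mesh_size Nx x in
      let dt := time_step T Nt in
      mesh Nx x -> (0 < Nt)%N ->
      interpolation_operator s Nx x Ih ->
      propP1 s Ih -> propP2 s Cs h Ih -> propP3 s q Cq h Ih ->
      0 < h < h0 -> 0 < dt < dt0 ->
      h ^+ (2 * s) / dt <= CDelta ->
      h ^+ (2 * (q - s)) / dt `^ (1 + eps) <= CDelta ->
      scheme_well_defined T nu Lambda f s Nt Ih u0 /\
      forall n, (n <= Nt)%N ->
        (norm_star s (u (n%:R * dt) \- scheme nu Lambda f s dt Ih u0 n)%R <=
           (CE * (dt `^ r + h ^+ (q - s) / dt `^ 2^-1))%:E)%E.
Proof.
have [hr0 hr1] := andP hr.
case: s hs hsq hD1 hD2 => [//|[//|p]] _ pq hD1 _.
have [c [d1 [c0 /andP[d10 d11] step]]] := scheme_step (ltW hK) hCs (ltW hCDelta)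
  (normr_ge0 Mf) (normr_ge0 MW) hD1.
set th := 1 + 4 * CDelta * Cs ^+ 2 in step.
have th1 : 1 <= th.
  by rewrite /th lerDl mulr_ge0 ?sqr_ge0// mulr_ge0// ltW.
have th0 : 0 <= th by apply: le_trans th1.
(* [G] is the Gronwall factor, [B1] and [B2] the contributions of the
   consistency and interpolation errors *)
pose G := expR (c * T) * (1 + T).
have G0 : 0 <= G by rewrite mulr_ge0 ?expR_ge0// addr_ge0// ltW.
pose B1 := 4 * th * K ^+ 2; pose B2 := 2 * th * (Cq * `|MH|) ^+ 2.
have B10 : 0 <= B1 by rewrite mulr_ge0 ?sqr_ge0// mulr_ge0.
have B20 : 0 <= B2 by rewrite mulr_ge0 ?sqr_ge0// mulr_ge0.
have GB1 : 0 <= G * B1 by rewrite mulr_ge0.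
have GB2 : 0 <= G * B2 * CDelta by rewrite mulr_ge0 ?(ltW hCDelta)// mulr_ge0.
have k1 : 0 < (2 * (G * B1 + 1))^-1 by rewrite invr_gt0 mulr_gt0// ltr_wpDl.
have k2 : 0 < (2 * (G * B2 * CDelta + 1))^-1 by rewrite invr_gt0 mulr_gt0// ltr_wpDl.
(* each of the two contributions to the energy is at most 1/2 *)
have [da da0 Hda] := powR_small hr0 k1.
have [db db0 Hdb] := powR_small heps k2.
have CE1 : 1 <= G * (B1 + B2) + 1 by rewrite lerDr mulr_ge0// addr_ge0.
exists 2^-1, (Num.min (Num.min 2^-1 d1) (Num.min da db)), (G * (B1 + B2) + 1).
split.
  split; [|by rewrite !lt_min d10 da0 db0 invr_gt0 !gt_min invf_lt1 ?ltr1n ?ltr0n|exact: lt_le_trans CE1].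
  by rewrite invr_gt0 invf_lt1 ?ltr1n ?ltr0n.
move=> f u0 u Wf [su _] _ _ Hq D3 uMW uMH fM Nx Nt xs Ih h dt _ Nt0 hI P1 P2 P3.
move=> /andP[h0 _] /andP[dt0]; rewrite !lt_min -!andbA => /and4P[dth /ltW dtd1 /ltW dta /ltW dtb].
move=> hdt hdt2.
have dt1 : dt <= 1 by apply: (le_trans (ltW dth)); rewrite invf_le1 ?ler1n.
have Hf : CL p.+2 f `|Mf|.
  by apply: CL_mono (ler_norm _) _; exact: Wspace_line_CL Wf fM.
have reg := exact_solution_regular hT pq su Hq uMW uMH.
have pu t : 0 <= t <= T -> periodic1 (u t) by case: su => H _ _ _ _; exact: H.
have Hu t : 0 <= t <= T -> periodic1 (u t) /\ CL p.+2 (u t) `|MW|.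
  by move=> tT; split; [exact: pu|apply: CL_mono (ler_norm _) (reg t tT).1].
pose eta := Cq * h ^+ (q - p.+2) * `|MH|.
have hq0 : 0 <= h ^+ (q - p.+2) by rewrite exprn_ge0// ltW.
have hu t : 0 <= t <= T -> snorm p.+2 (fun x => u t x - Ih (u t) x) <= eta.
  move=> tT; have [Ht appr] := reg t tT.
  apply: (le_trans (exact_interpolation_error pq hI P1 P3 (ltW hCq) (ltW h0) (pu t tT) Ht appr)).
  by rewrite ler_wpM2l ?ler_norm// mulr_ge0// ltW.
pose beta := 4 * th * (K * dt `^ r) ^+ 2 + 2 * th * eta ^+ 2 / dt.
have betaE : beta = B1 * (dt `^ r) ^+ 2 + B2 * (h ^+ (2 * (q - p.+2)) / dt).
  by rewrite /beta /B1 /B2 /eta mulnC exprM; ring.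
have y0 : 0 <= h ^+ (2 * (q - p.+2)) / dt.
  by rewrite mulr_ge0 ?invr_ge0 ?(ltW dt0)// exprn_ge0// ltW.
have beta0 : 0 <= beta by rewrite betaE addr_ge0// mulr_ge0 ?sqr_ge0.
have small : G * beta <= 1.
  have r1 : dt `^ r <= (2 * (G * B1 + 1))^-1 by apply: Hda; rewrite dt0.
  have e1 : dt `^ eps <= (2 * (G * B2 * CDelta + 1))^-1 by apply: Hdb; rewrite dt0.
  have r2 : (dt `^ r) ^+ 2 <= (2 * (G * B1 + 1))^-1.
    apply: le_trans r1; rewrite expr2 ler_piMl ?powR_ge0//.
    apply: (le_trans (Hda _ _)); first by rewrite dt0.
    by rewrite invf_le1; lra.
  have y1 : h ^+ (2 * (q - p.+2)) / dt <= CDelta * dt `^ eps.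
    rewrite ler_pdivrMr// -mulrA.
    move: hdt2; rewrite ler_pdivrMr ?powR_gt0// powRD ?(gt_eqF dt0) ?implybT//.
    by rewrite powRr1 ?(ltW dt0)// [dt * _]mulrC.
  rewrite betaE mulrDr.
  have x1 : G * (B1 * (dt `^ r) ^+ 2) <= 2^-1.
    rewrite mulrA; apply: (le_trans (ler_wpM2l GB1 r2)).
    by rewrite invfM mulrCA ler_piMr// ler_pdivrMr ?mul1r; lra.
  have x2 : G * (B2 * (h ^+ (2 * (q - p.+2)) / dt)) <= 2^-1.
    rewrite mulrA; apply: (le_trans (ler_wpM2l (mulr_ge0 G0 B20) y1)).
    rewrite mulrA; apply: (le_trans (ler_wpM2l GB2 e1)).
    by rewrite invfM mulrCA ler_piMr// ler_pdivrMr ?mul1r; lra.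
  lra.
pose uh := scheme nu Lambda f p.+2 dt Ih u0.
have dtT : Nt%:R * dt = T by rewrite /dt /time_step mulrC divfK// pnatr_eq0 -lt0n.
pose E (k : nat) v := wenergy th p.+1 (fun x => u (k%:R * dt) x - v x).
have c1 : 1 <= 1 + c * dt by rewrite lerDl mulr_ge0// ltW.
have growth n : (n <= Nt)%N -> (1 + c * dt) ^+ n * (1 + n%:R * dt) * beta <= G * beta.
  move=> nN; have ndt : n%:R * dt <= T by rewrite -dtT ler_wpM2r ?(ltW dt0)// ler_nat.
  have ndt0 : 0 <= n%:R * dt by rewrite mulr_ge0// ltW.
  apply: ler_wpM2r => //; apply: ler_pM; last by rewrite lerD2l.
  - by rewrite exprn_ge0// (le_trans ler01).
  - by rewrite addr_ge0.
  - have cdt0 : 0 <= c * dt by rewrite mulr_ge0// ltW.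
    apply: (le_trans (one_plus_pow_le n cdt0)).
    by rewrite ler_expR ler_wpM2l.
(* linear growth in [n] of the accumulated errors, times the Gronwall factor *)
have inv n : (n <= Nt)%N -> HT p.+2 (uh n) /\
    E n (uh n) <= (1 + c * dt) ^+ n * (1 + n%:R * dt) * beta.
  elim: n => [_|n IH nN].
    have T0 : 0 <= (0 : R) <= T by rewrite lexx ltW.
    have u00 : u 0 = u0 by case: su => _ _ _ _ [].
    have [pu0 Hu0] := Hu 0 T0; rewrite u00 in pu0 Hu0.
    have [HTu0 _] := Hd_HT pu0 (normr_ge0 MW) (CL_HB (CL_S Hu0)).2.
    have dt01 : 0 < dt <= 1 by rewrite dt0.
    have [HTI EI] := interpolation_step hI P1 P2 hCs (ltW h0) dt01 hdt (th := th)
      (ltac:(by rewrite /th lerDr)) th0 HTu0 HTu0.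
    have [HI _ _] := interpolation_facts hI.
    split; first exact: HI.
    rewrite /E mul0r u00 expr0 addr0 !mul1r; apply: (le_trans EI).
    have E00 : wenergy th p.+1 (fun x => u0 x - u0 x) <= 0.
      have := wenergyZ 0 th0 HTu0; rewrite expr0n/= mul0r.
      rewrite (_ : (fun x => 0 * u0 x) = (fun x => u0 x - u0 x))//.
      by apply/funext => x; rewrite mul0r subrr.
    have h2 := hu 0 T0; rewrite u00 in h2.
    have [_ _ s0 _ _] := HT_Hd HTI.
    have s2 : snorm p.+2 (fun x => u0 x - Ih u0 x) ^+ 2 <= eta ^+ 2.
      by rewrite !expr2 ler_pM.
    have i1 : 0 <= 1 + dt by rewrite addr_ge0// ltW.
    have e1 := ler_wpM2l i1 E00; rewrite mulr0 in e1.
    have th2 : 0 <= 2 * th by rewrite mulr_ge0.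
    have e2 := ler_wpM2l th2 s2.
    have e3 : 2 * th * eta ^+ 2 <= 2 * th * eta ^+ 2 / dt.
      by rewrite ler_peMr ?invf_ge1// mulr_ge0// sqr_ge0.
    have e4 : 0 <= 4 * th * (K * dt `^ r) ^+ 2 by rewrite mulr_ge0 ?sqr_ge0// mulr_ge0.
    by rewrite /beta; move: e1 e2 e3 e4; clear; lra.
  have [HTn En] := IH (ltnW nN).
  have En1 : E n (uh n) <= 1.
    apply: (le_trans En); apply: (le_trans (growth n (ltnW nN))); exact: small.
  have dtd : 0 < dt <= d1 by rewrite dt0.
  have [_ _ HT1 E1] := step f u r Nx Nt xs Ih h eta (uh n) n Nt0 dtd Hf D3 Hu hu hI P1 P2
    (ltW h0) hdt nN HTn En1.
  split; first exact: HT1.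
  apply: (le_trans E1); rewrite -/beta -/dt.
  have cp : 1 <= (1 + c * dt) ^+ n by exact: exprn_ege1.
  have q0 : 0 <= dt * beta by rewrite mulr_ge0// ltW.
  have q1 : E n (uh n) + dt * beta <= (1 + c * dt) ^+ n * (1 + n.+1%:R * dt) * beta.
    have -> : (1 + c * dt) ^+ n * (1 + n.+1%:R * dt) * beta =
      (1 + c * dt) ^+ n * (1 + n%:R * dt) * beta + (1 + c * dt) ^+ n * (dt * beta).
      by rewrite -(@natr1 _ n); ring.
    by rewrite lerD// ler_peMl.
  rewrite (_ : (1 + c * dt) ^+ n.+1 * _ * beta = (1 + c * dt) *
    ((1 + c * dt) ^+ n * (1 + n.+1%:R * dt) * beta)); last by rewrite exprS !mulrA.
  by apply: ler_wpM2l q1; exact: (le_trans ler01 c1).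
have invs n : (n <= Nt)%N -> E n (uh n) <= G * beta.
  by move=> nN; apply: (le_trans (inv n nN).2); exact: growth.
split.
  split=> [n nN|[//|n] /= nN]; first exact: (inv n nN).1.
  have dtd : 0 < dt <= d1 by rewrite dt0.
  have [sc ex _ _] := step f u r Nx Nt xs Ih h eta (uh n) n Nt0 dtd Hf D3 Hu hu hI P1 P2
    (ltW h0) hdt nN (inv n (ltnW nN)).1 (le_trans (invs n (ltnW nN)) small).
  by split.
move=> n nN.
have ndt : 0 <= n%:R * dt <= T.
  by rewrite mulr_ge0 ?(ltW dt0)//= -dtT ler_wpM2r ?(ltW dt0)// ler_nat.
have [pun Hun] := Hu _ ndt.
have [HTun _] := Hd_HT pun (normr_ge0 MW) (CL_HB (CL_S Hun)).2.
have [HTe _] := HTB HTun (inv n nN).1.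
have z0 : 0 <= h ^+ (q - p.+2) / dt `^ 2^-1 by rewrite divr_ge0// powR_ge0.
have r0 := powR_ge0 dt r.
apply: (norm_star_wenergy th1 HTe).
  by rewrite mulr_ge0 ?(le_trans ler01 CE1)// addr_ge0.
apply: (le_trans (invs n nN)).
have zE : h ^+ (2 * (q - p.+2)) / dt = (h ^+ (q - p.+2) / dt `^ 2^-1) ^+ 2.
  by rewrite powR12_sqrt ?(ltW dt0)// expr_div_n sqr_sqrtr ?(ltW dt0)// mulnC exprM.
rewrite betaE zE.
move: (dt `^ r) (h ^+ (q - p.+2) / dt `^ 2^-1) r0 z0 => x y r0 z0.
have xy := mulr_ge0 r0 z0.
apply: (@le_trans _ _ (G * (B1 + B2) * (x + y) ^+ 2)).
  rewrite -mulrA ler_wpM2l//.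
  have := mulr_ge0 B10 (sqr_ge0 y); have := mulr_ge0 B20 (sqr_ge0 x).
  have := mulr_ge0 B10 xy; have := mulr_ge0 B20 xy; clear; lra.
rewrite [leRHS]exprMn ler_wpM2r ?sqr_ge0//.
apply: (@le_trans _ _ (G * (B1 + B2) + 1)); first by rewrite lerDl.
by rewrite expr2 ler_peMl// (le_trans ler01).
Qed.
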